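(* Let $A$ be a reduced curve of degree $a$ and let $B$ be a reduced curve of degree $b$ in $\mathbb{P}^3$, both not necessarily irreducible, and such that $A$ and $B$ share no components. Assume that $a\leq b$. Let $m$ be the number of intersection points of $A$ and $B$ (counted without multiplicity). Assume that $m=ab$. Then: (i) If $a=1$ then $B$ is a disjoint union of plane curves, each of them coplanar with $A$. (ii) If $2\leq a$ then either $A\cup B$ is a plane curve, or both $A$ and $B$ are unions of pairwise skew lines. In the latter case, if $a\geq 3$ then there is a smooth quadric surface $Q$ that contains both $A$ and $B$, and $A$ is of type $(a,0)$ and $B$ is of type $(0,b)$ on $Q$.
   Context: The base field is a field $\mathbb{K}$ of characteristic $0$. Curves are of pure dimension one. On a smooth quadric surface $Q\cong\mathbb{P}^1\times\mathbb{P}^1$, a curve of type $(a,0)$ consists of $a$ lines of one ruling (here distinct, since curves are reduced), and a curve of type $(0,b)$ of $b$ lines of the other ruling. *)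

(* Defs.v *)
From HB Require Import structures.
From mathcomp Require Import all_boot all_order all_algebra.
From mathcomp.multinomials Require Import mpoly.
From mathcomp Require Import boolp classical_sets functions cardinality.

Set Implicit Arguments.
Unset Strict Implicit.
Unset Printing Implicit Defensive.

Import GRing.Theory.
Local Open Scope classical_set_scope.
Local Open Scope ring_scope.

(* P^3 over an arbitrary field K is Proj of S = K[X_0,..,X_3].  A closed        *)
(* subscheme is given by its saturated homogeneous ideal I, as a set of         *)
(* polynomials; inclusions are reversed, and unions of reduced subschemes       *)
(* correspond to intersections of ideals.                                       *)

Section ProjectiveSpace.
Variable K : fieldType.
Local Notation S := {mpoly K[4]}.

Record homogeneous_ideal (I : set S) : Prop := HomogeneousIdeal {
  hideal0 : I 0;
  hidealD : forall f g, I f -> I g -> I (f + g);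
  hidealM : forall f g, I g -> I (f * g);
  hideal_pihomog : forall f d, I f -> I (pihomog mdeg d f) }.

(* A point of Proj S: a homogeneous prime not containing the irrelevant ideal.  *)
Record proj_point (P : set S) : Prop := ProjPoint {
  point_ideal : homogeneous_ideal P;
  point_proper : ~ P 1;
  point_prime : forall f g, P (f * g) -> P f \/ P g;
  point_relevant : exists i : 'I_4, ~ P 'X_i }.

Definition zeros (I : set S) : set (set S) :=
  [set P | proj_point P /\ I `<=` P].

Definition disjoint_subschemes (I J : set S) : Prop :=
  zeros I `&` zeros J = set0.

(* Irreducible components, identified with their generic points.                *)
Definition component (I P : set S) : Prop :=
  zeros I P /\ forall P', zeros I P' -> P' `<=` P -> P' = P.

Definition chain_of_points (I : set S) (n : nat) : Prop :=
  exists P : nat -> set S,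
    (forall i, (i <= n)%N -> zeros I (P i)) /\
    (forall i, (i < n)%N -> P i `<` P i.+1).

Definition dimension (I : set S) (n : nat) : Prop :=
  chain_of_points I n /\ ~ chain_of_points I n.+1.

(* Properness and saturation make the curve nonempty.                           *)
Record reduced_curve (I : set S) : Prop := ReducedCurve {
  curve_ideal : homogeneous_ideal I;
  curve_proper : ~ I 1;
  curve_saturated : forall f, (forall i : 'I_4, I ('X_i * f)) -> I f;
  curve_radical : forall f n, I (f ^+ n.+1) -> I f;
  curve_pure_dim1 : forall P, component I P -> dimension P 1 }.

(* h = dim_K (S / I)_t.                                                         *)
Definition hilbert_function (I : set S) (t h : nat) : Prop :=
  exists U : {vspace dhomog 4 K t},
    (forall f : dhomog 4 K t, f \in U <-> I (mpoly_of_dhomog f)) /\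
    h = (\dim {: dhomog 4 K t} - \dim U)%N.

(* The Hilbert polynomial of the curve is d t + c.                              *)
Definition curve_degree (I : set S) (d : nat) : Prop :=
  exists (c : int) (N : nat), forall t h, (N <= t)%N ->
    hilbert_function I t h -> h%:Z = (d * t)%N%:Z + c.

Definition lform (v : 'rV[K]_4) : S := \sum_(i < 4) v 0 i *: 'X_i.

Definition in_plane (v : 'rV[K]_4) (I : set S) : Prop := v != 0 /\ I (lform v).

Definition plane_curve (I : set S) : Prop :=
  reduced_curve I /\ exists v, in_plane v I.

Definition coplanar (I J : set S) : Prop :=
  exists v, in_plane v I /\ in_plane v J.

Definition ideal2 (f g : S) : set S :=
  [set h | exists u v, h = u * f + v * g].

Definition line (I : set S) : Prop :=
  exists u v : 'rV[K]_4, row_free (col_mx u v) /\ I = ideal2 (lform u) (lform v).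

Definition union_of_skew_lines (I : set S) : Prop :=
  exists (n : nat) (L : 'I_n -> set S),
    (forall i, line (L i)) /\
    (forall i j, i != j -> disjoint_subschemes (L i) (L j)) /\
    I = \bigcap_(i in setT) L i.

Definition disjoint_union_of_plane_curves_coplanar_with (A B : set S) : Prop :=
  exists (n : nat) (C : 'I_n -> set S),
    (forall i, plane_curve (C i)) /\
    (forall i j, i != j -> disjoint_subschemes (C i) (C j)) /\
    B = \bigcap_(i in setT) C i /\
    (forall i, coplanar A (C i)).

(* Jacobian criterion, at all scheme points and not only at K-points.           *)
Definition smooth_quadric (q : S) : Prop :=
  q \is 2.-homog /\
  forall P, proj_point P -> P q -> exists i : 'I_4, ~ P q^`M(i).

(* Row i of the invertible matrix M gives the linear form l_i, and              *)
(* q = l_0 l_3 - l_1 l_2, so that (l_0, l_1, l_2, l_3) =                        *)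
(* (x_0 y_0, x_0 y_1, x_1 y_0, x_1 y_1) identifies P^1 x P^1 with {q = 0}.      *)
Definition segre_frame (q : S) (M : 'M[K]_4) : Prop :=
  M \in unitmx /\
  q = lform (row 0 M) * lform (row 3 M) - lform (row 1 M) * lform (row 2 M).

(* The line {x} x P^1, for x = [x_0 : x_1].                                     *)
Definition first_ruling (M : 'M[K]_4) (I : set S) : Prop :=
  exists x : 'rV[K]_2, x != 0 /\
    I = ideal2 (lform (x 0 1 *: row 0 M - x 0 0 *: row 2 M))
               (lform (x 0 1 *: row 1 M - x 0 0 *: row 3 M)).

(* The line P^1 x {y}, for y = [y_0 : y_1].                                     *)
Definition second_ruling (M : 'M[K]_4) (I : set S) : Prop :=
  exists y : 'rV[K]_2, y != 0 /\
    I = ideal2 (lform (y 0 1 *: row 0 M - y 0 0 *: row 1 M))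
               (lform (y 0 1 *: row 2 M - y 0 0 *: row 3 M)).

Definition union_of_distinct (R : set S -> Prop) (n : nat) (I : set S) : Prop :=
  exists L : 'I_n -> set S,
    injective L /\ (forall i, R (L i)) /\ I = \bigcap_(i in setT) L i.

Definition type_a0 (M : 'M[K]_4) (a : nat) (I : set S) : Prop :=
  union_of_distinct (first_ruling M) a I.

Definition type_0b (M : 'M[K]_4) (b : nat) (I : set S) : Prop :=
  union_of_distinct (second_ruling M) b I.

End ProjectiveSpace.

(* Main.v *)
(** The heart of the matter is a Bezout bound for two distinct irreducible space curves [P] and
    [Q] of degrees [p] and [q].  Fix a pencil of planes [l0, l1] whose axis meets neither curve and
    complete it by [m2, m3] to coordinates.  Over the pencil, [S/P] and [S/Q] are torsion free, so
    [S/P (x) S/Q] modulo [l1 (x) l0 - l0 (x) l1] is the coordinate ring of a curve, and dividing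
    further by [l1 (x) m - m (x) l1], for [m = m2 + mu m3] with [mu] general, leaves at most
    [2 p q] dimensions in each large bidegree, of which [p q] come from [l1 = 0].  The remaining
    [p q] dominate the Hilbert function of [P + Q], so [P] and [Q] share at most [p q] points.
    If they share exactly [p q] points, then all of these are rational; if no plane contained both
    curves, differentiating along suitable tangent vectors of [P] and [Q] at one of them would
    yield one more linear form on that quotient, a contradiction.

    Applied to the components of [A] and [B], [m = a b] thus forces any two components [P] of [A]
    and [Q] of [B] to be coplanar and to meet in [p q] points, and no point to lie on two
    components of the same curve.  A plane not containing [P] meets it in at most [p] points, so a
    plane that contains components of [B] of total degree at least [2] contains all of [A].
    This leaves plane curves and unions of skew lines.  In the latter case three of the lines of
    [A] have equations [m0 = m1 = 0], [m2 = m3 = 0] and [m0 - m2 = m1 - m3 = 0], and every line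
    meeting all three lies in a ruling of the quadric [m0 m3 = m1 m2]. *)

(* [K] need not be algebraically closed, so the counts are inequalities between Hilbert functions in
   large degree, where each point weighs at least 1, and general choices are avoidance arguments
   over the infinite field [K]; this is where characteristic 0 enters. The constant [2 p q] is the
   self-intersection of the class (1, 1) on the product of the two curves. Numerically it is the
   second difference of [hilb P t * hilb Q n] along the diagonal, which the Koszul complex of the
   two equations produces. These equations hold on the diagonal, where the common points lie, and
   also wherever [l1] vanishes in both factors; the second locus accounts for one of the two copies
   of [p q]. The obstacle is the regularity of the second equation modulo the first. It comes from
   the linear independence of eigenvectors, in one bidegree at a time, so [mu] depends on the
   bidegree. The bound is stated for all vector-valued bilinear functions on S/P x S/Q: it then
   covers both the multiplication into S/(P + Q) and that multiplication enlarged by a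
   derivative. *)
Require Import Defs.
From mathcomp Require Import all_boot all_order all_algebra.
From mathcomp.multinomials Require Import mpoly.
From mathcomp Require Import boolp classical_sets functions cardinality.
From mathcomp Require Import ring zify.
From HB Require Import structures.
Set Implicit Arguments.
Unset Strict Implicit.
Unset Printing Implicit Defensive.
Import GRing.Theory.
Local Open Scope classical_set_scope.
Local Open Scope ring_scope.

(** * Homogeneous ideals and homogeneous primes *)

Section HomogeneousIdeals.
Variable K : fieldType.
Local Notation S := {mpoly K[4]}.
Local Notation hc := (pihomog mdeg).
Implicit Types (I J P : set S) (f g : S).

Lemma sum_pihomog f : exists n, f = \sum_(i < n) hc i f.
Proof. by exists (mmeasure mdeg f); apply: pihomog_partitionE. Qed.

Lemma pihomog_mull d e g f : g \is d.-homog -> hc (d + e)%N (g * f) = g * hc e f.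
Proof.
move=> hg; have [n Ef] := sum_pihomog f; rewrite {1}Ef {2}Ef.
rewrite mulr_sumr !linear_sum mulr_sumr; apply: eq_bigr => i _ /=.
have hgi : g * hc i f \is (d + i)%N.-homog by apply: dhomogM => //; apply: pihomogP.
have [Ei|ne] := eqVneq (i : nat) e.
  by rewrite -Ei (pihomog_dE hgi) pihomog_id.
rewrite (pihomog_ne0 _ hgi) ?eqn_add2l //.
by rewrite (pihomog_ne0 ne) ?mulr0 // pihomogP.
Qed.

Lemma pihomog_mull_lt d k g f : g \is d.-homog -> (k < d)%N -> hc k (g * f) = 0.
Proof.
move=> hg lt_kd; have [n ->] := sum_pihomog f.
rewrite mulr_sumr linear_sum big1 // => i _ /=.
by rewrite (pihomog_ne0 _ (dhomogM hg (pihomogP mdeg i f))) //; lia.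
Qed.

Lemma pihomog_trunc f i k :
  hc i (\sum_(j < k) hc j f) = if (i < k)%N then hc i f else 0.
Proof.
elim: k => [|k IH]; first by rewrite big_ord0 pihomog0.
rewrite big_ord_recr pihomogD IH /= ltnS.
have [lt|lt|->] := ltngtP i k; last by rewrite pihomog_id add0r.
  by rewrite (pihomog_ne0 _ (pihomogP mdeg k f)) ?addr0 //; lia.
by rewrite (pihomog_ne0 _ (pihomogP mdeg k f)) ?addr0 //; lia.
Qed.

Lemma pihomog_large f : exists n, forall d, (n <= d)%N -> hc d f = 0.
Proof.
have [n Ef] := sum_pihomog f; exists n => d le_d; rewrite Ef linear_sum big1 // => i _ /=.
by rewrite (pihomog_ne0 _ (pihomogP mdeg i f)) //; have := ltn_ord i; lia.
Qed.

Section Closure.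
Variables (I : set S) (hI : homogeneous_ideal I).

Lemma hideal_opp f : I f -> I (- f).
Proof. by move=> If; rewrite -mulN1r; apply: hidealM. Qed.

Lemma hideal_sub f g : I f -> I g -> I (f - g).
Proof. by move=> If Ig; apply: hidealD => //; apply: hideal_opp. Qed.

Lemma hidealMr f g : I f -> I (f * g).
Proof. by rewrite mulrC; apply: hidealM. Qed.

Lemma hideal_scale c f : I f -> I (c *: f).
Proof. by rewrite -mul_mpolyC; apply: hidealM. Qed.

Lemma hideal_sum (T : Type) (r : seq T) (Pr : pred T) (F : T -> S) :
  (forall i, Pr i -> I (F i)) -> I (\sum_(i <- r | Pr i) F i).
Proof.
move=> IF; elim/big_rec: _ => [|i x Pi Ix]; first exact: hideal0.
by apply: hidealD => //; apply: IF.
Qed.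

Lemma hideal_cancel_add f g : I f -> I (f + g) -> I g.
Proof. by move=> If Ifg; rewrite -[g](addKr f); apply: hidealD => //; apply: hideal_opp. Qed.

Lemma hideal_forms f : (forall d, I (hc d f)) -> I f.
Proof. by move=> If; have [n ->] := sum_pihomog f; apply: hideal_sum. Qed.

Lemma hideal_form_notin f : ~ I f -> exists d, ~ I (hc d f).
Proof. by move=> nIf; apply/existsNP => Iall; apply/nIf/hideal_forms. Qed.

Lemma top_form f : ~ I f ->
  exists d, ~ I (hc d f) /\ forall e, (d < e)%N -> I (hc e f).
Proof.
move=> nIf; have [d0 nd0] := hideal_form_notin nIf.
pose p d := `[< ~ I (hc d f) >].
have exp : exists d, p d by exists d0; apply/asboolP.
have [n large] := pihomog_large f.
have bnd d : p d -> (d <= n)%N.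
  move=> /asboolP; case: leqP => // lt; rewrite large ?(ltnW lt) // => H.
  by case: H; apply: hideal0.
case: (ex_maxnP exp bnd) => d /asboolP nd dmax; exists d; split=> // e lt_de.
by apply: contrapT => nIe; have := dmax e; rewrite /p leqNgt lt_de => /(_ (asboolT nIe)).
Qed.

(** Modulo [I] both factors can be truncated above their highest component outside [I]; the
    component of degree [d + e] of the product is then the product of these two top forms. Testing
    primality on forms matters because adjoining a form keeps an ideal homogeneous. *)
Lemma prime_of_forms :
  (forall d e f g, f \is d.-homog -> g \is e.-homog -> I (f * g) -> I f \/ I g) ->
  forall f g, I (f * g) -> I f \/ I g.
Proof.
move=> Pform f g Ifg; apply/or_asboolP; apply/negPn/negP; rewrite negb_or.
case/andP => /asboolPn nf /asboolPn ng.
have [d [nfd topf]] := top_form nf; have [e [nge topg]] := top_form ng.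
have trunc h k : (forall i, (k < i)%N -> I (hc i h)) ->
    I (h - \sum_(i < k.+1) hc i h).
  move=> top; apply: hideal_forms => i; rewrite pihomogB pihomog_trunc.
  have [le|lt] := ltnP i k.+1; first by rewrite subrr; apply: hideal0.
  by rewrite subr0; apply: top.
set f' := \sum_(i < d.+1) hc i f; set g' := \sum_(i < e.+1) hc i g.
have If' : I (f - f') by apply: trunc.
have Ig' : I (g - g') by apply: trunc.
have : I (hc (d + e)%N (f' * g')).
  apply: hideal_pihomog => //.
  have -> : f' * g' = f * g - (f - f') * g - f' * (g - g') by ring.
  by apply: hideal_sub; [apply: hideal_sub => //; apply: hidealMr|apply: hidealM].
have -> : hc (d + e)%N (f' * g') = hc d f * hc e g.
  have Eg' i : (i <= e)%N -> hc i g' = hc i g by move=> le; rewrite pihomog_trunc ltnS le.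
  have Eg0 i : (e < i)%N -> hc i g' = 0 by move=> lt; rewrite pihomog_trunc ltnNge lt.
  rewrite /f' big_ord_recr mulrDl pihomogD (pihomog_mull e g' (pihomogP mdeg d f)) Eg' //=.
  rewrite mulr_suml raddf_sum /=; set s := (X in X + _); suff -> : s = 0 by rewrite add0r.
  rewrite /s; apply: big1 => i _.
  have -> : (d + e = i + (d + e - i))%N by have := ltn_ord i; lia.
  rewrite (pihomog_mull _ g' (pihomogP mdeg i f)) Eg0 ?mulr0 //.
  by have := ltn_ord i; lia.
by move=> /(Pform d e) -[]; rewrite ?pihomogP.
Qed.

End Closure.

Definition ideal_add_form I g : set S :=
  [set f | exists a b, I a /\ f = a + b * g].

Lemma ideal_add_form_homogeneous I d g :
  homogeneous_ideal I -> g \is d.-homog -> homogeneous_ideal (ideal_add_form I g).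
Proof.
move=> hI hg; split.
- by exists 0, 0; split; [apply: hideal0|rewrite mul0r addr0].
- move=> _ _ [a [b [Ia ->]]] [a' [b' [Ia' ->]]].
  by exists (a + a'), (b + b'); split; [apply: hidealD|ring].
- move=> f _ [a [b [Ia ->]]].
  by exists (f * a), (f * b); split; [apply: hidealM|ring].
- move=> _ e [a [b [Ia ->]]]; have [lt|le] := ltnP e d.
    exists (hc e a), 0; split; first exact: hideal_pihomog.
    by rewrite linearD /= mulrC (pihomog_mull_lt _ hg lt) mul0r.
  exists (hc e a), (hc (e - d) b); split; first exact: hideal_pihomog.
  rewrite linearD /= [b * g]mulrC -{2}(subnKC le) pihomog_mull //.
  by rewrite [_ * g]mulrC.
Qed.

Lemma ideal_add_form_sub I g : I `<=` ideal_add_form I g.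
Proof. by move=> f If; exists f, 0; rewrite mul0r addr0. Qed.

Lemma ideal_add_form_gen I g : homogeneous_ideal I -> ideal_add_form I g g.
Proof. by move=> hI; exists 0, 1; rewrite mul1r add0r; split=> //; apply: hideal0. Qed.

Lemma ideal_add_form_min I J g :
  homogeneous_ideal J -> I `<=` J -> J g -> ideal_add_form I g `<=` J.
Proof.
move=> hJ IJ Jg _ [a [b [Ia ->]]]; apply: hidealD => //; first exact: IJ.
exact: hidealM.
Qed.

Definition ideal_add I J : set S := [set f | exists a b, [/\ I a, J b & f = a + b]].

Lemma ideal_add_homogeneous I J :
  homogeneous_ideal I -> homogeneous_ideal J -> homogeneous_ideal (ideal_add I J).
Proof.
move=> hI hJ; split.
- by exists 0, 0; split; rewrite ?addr0 //; apply: hideal0.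
- move=> _ _ [a [b [Ia Jb ->]]] [a' [b' [Ia' Jb' ->]]].
  by exists (a + a'), (b + b'); split; [apply: hidealD|apply: hidealD|ring].
- move=> f _ [a [b [Ia Jb ->]]].
  by exists (f * a), (f * b); split; [apply: hidealM|apply: hidealM|ring].
- move=> _ d [a [b [Ia Jb ->]]].
  by exists (hc d a), (hc d b); rewrite linearD; split=> //; apply: hideal_pihomog.
Qed.

Lemma ideal_add_subl I J : homogeneous_ideal J -> I `<=` ideal_add I J.
Proof. by move=> hJ f If; exists f, 0; rewrite addr0; split=> //; apply: hideal0. Qed.

Lemma ideal_add_subr I J : homogeneous_ideal I -> J `<=` ideal_add I J.
Proof. by move=> hI f Jf; exists 0, f; rewrite add0r; split=> //; apply: hideal0. Qed.

Lemma ideal_add_min I J L :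
  homogeneous_ideal L -> I `<=` L -> J `<=` L -> ideal_add I J `<=` L.
Proof.
by move=> hL IL JL _ [a [b [/IL La /JL Lb ->]]]; apply: hidealD.
Qed.

(** A homogeneous ideal maximal among those above [I] that miss all powers of [g] is prime:
    adjoining either of two outside forms brings in a power of [g], and if their product were
    inside, so would be the product of these powers. *)
Lemma exists_prime_avoiding I d g :
  homogeneous_ideal I -> g \is d.-homog -> (forall n, ~ I (g ^+ n)) ->
  exists P, [/\ homogeneous_ideal P, I `<=` P,
    (forall f f', P (f * f') -> P f \/ P f') & forall n, ~ P (g ^+ n)].
Proof.
move=> hI hg nIg.
pose good X := [/\ homogeneous_ideal X, I `<=` X & forall n, ~ X (g ^+ n)].
pose PP : set (set S) := [set X | X = set0 \/ good X].
have [F FP Ftot|M [PM Mmax]] := @Zorn_bigcup _ PP.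
  have [[X0 [FX0 gX0]]|noX] := pselect (exists X, F X /\ good X); last first.
    left; apply/seteqP; split=> // f [X FX Xf].
    case: (FP X FX) => [X0|gX]; first by rewrite X0 in Xf.
    by case: noX; exists X.
  right.
  have get X f : F X -> X f -> good X.
    by move=> FX Xf; case: (FP X FX) => // X00; rewrite X00 in Xf.
  split; first split.
  - by exists X0 => //; case: gX0 => h _ _; apply: hideal0.
  - move=> f f' [X FX Xf] [Y FY Yf'].
    have [XY|YX] := Ftot X Y FX FY.
      by exists Y => //; have [h _ _] := get Y f' FY Yf'; apply: hidealD => //; apply: XY.
    by exists X => //; have [h _ _] := get X f FX Xf; apply: hidealD => //; apply: YX.
  - by move=> f f' [X FX Xf']; exists X => //; have [h _ _] := get X f' FX Xf'; apply: hidealM.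
  - by move=> f e [X FX Xf]; exists X => //; have [h _ _] := get X f FX Xf; apply: hideal_pihomog.
  - by move=> f If; exists X0 => //; case: gX0 => _ + _; apply.
  - by move=> n [X FX Xg]; have [_ _ +] := get X _ FX Xg; apply; apply: Xg.
have gI : good I by split.
have gM : good M.
  case: PM => // M0; case: (Mmax I); last by right.
  rewrite M0; split=> // sub; have := sub 0; rewrite /set0 /=; apply.
  exact: hideal0.
case: (gM) => hM IM nMg; exists M; split=> //.
have ext e f : f \is e.-homog -> ~ M f -> exists n, ideal_add_form M f (g ^+ n).
  move=> hf nMf; apply: contrapT => /forallNP no.
  apply: (Mmax (ideal_add_form M f)); last first.
    right; split=> //; first exact: ideal_add_form_homogeneous hf.
    by move=> x /IM; apply: ideal_add_form_sub.
  split; first exact: ideal_add_form_sub.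
  by move=> sub; apply/nMf/sub/ideal_add_form_gen.
apply: prime_of_forms => // d1 d2 f1 f2 h1 h2 Mf.
apply/or_asboolP; apply/negPn/negP; rewrite negb_or => /andP[/asboolPn n1 /asboolPn n2].
have [n [a [b [Ma Ea]]]] := ext _ _ h1 n1.
have [k [a' [b' [Ma' Ea']]]] := ext _ _ h2 n2.
apply: (nMg (n + k)%N); rewrite exprD Ea Ea'.
have -> : (a + b * f1) * (a' + b' * f2) = a * (a' + b' * f2) + a' * (b * f1) + (b * b') * (f1 * f2) by ring.
by apply: hidealD => //; [apply: hidealD => //; apply: hidealMr|apply: hidealM].
Qed.

End HomogeneousIdeals.

(** * Points of projective space and general linear choices *)

Section ProjectivePoints.
Variable K : fieldType.
Local Notation S := {mpoly K[4]}.
Local Notation hc := (pihomog mdeg).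
Implicit Types (I J P : set S) (f g : S).

Lemma form_X (i : 'I_4) : ('X_i : S) \is 1.-homog.
Proof. by rewrite dhomogX; apply/eqP/mdeg1. Qed.

Lemma form_Xn (i : 'I_4) k : ('X_i ^+ k : S) \is k.-homog.
Proof. by have := dhomogMn k (form_X i); rewrite mul1n. Qed.

Lemma form_exp d g k : g \is d.-homog -> g ^+ k \is (d * k)%N.-homog.
Proof. exact: dhomogMn. Qed.

Lemma form_lform (v : 'rV[K]_4) : lform v \is 1.-homog.
Proof. by apply: rpred_sum => i _; apply: rpredZ; apply: form_X. Qed.

Lemma lform_linear : linear (@lform K).
Proof.
move=> c u v; rewrite /lform scaler_sumr -big_split /=.
by apply: eq_bigr => i _; rewrite !mxE scalerDl scalerA.
Qed.
HB.instance Definition _ := GRing.isLinear.Build K 'rV[K]_4 S _ (@lform K) lform_linear.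

Lemma lform_delta (i : 'I_4) : lform (delta_mx 0 i) = 'X_i :> S.
Proof.
rewrite /lform (bigD1 i) //= mxE !eqxx scale1r big1 ?addr0 // => j ne.
by rewrite mxE eqxx (negPf ne) scale0r.
Qed.

Lemma ideal_of_monomials J t : homogeneous_ideal J ->
  (forall m : 'X_{1..4}, mdeg m = t -> J 'X_[m]) -> forall f, f \is t.-homog -> J f.
Proof.
move=> hJ Jm f hf; rewrite [f]mpolyE big_seq; apply: hideal_sum => // m mf.
by apply: hideal_scale => //; apply: Jm; apply: (dhomogP _ _ _ hf).
Qed.

Lemma variable_notin J d f : homogeneous_ideal J ->
  f \is d.+1.-homog -> ~ J f -> exists i : 'I_4, ~ J 'X_i.
Proof.
move=> hJ hf nJf; apply/existsNP => Jall; apply: nJf; apply: (ideal_of_monomials hJ _ hf) => m mm.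
have [i] : exists i, m i != 0%N.
  apply: contrapT => /forallNP z; move: mm; rewrite mdegE big1 // => i _.
  by apply/eqP/negPn/negP/z.
move=> mi; have -> : m = (U_(i) + (m - U_(i)))%MM by rewrite addmC submK // lep1mP.
by rewrite mpolyXD; apply: hidealMr.
Qed.

Section Point.
Variables (P : set S) (pP : proj_point P).
Let hP := point_ideal pP.

Lemma point_exp f n : P (f ^+ n) -> P f.
Proof.
elim: n => [|n IH]; first by move/(point_proper pP).
by rewrite exprS => /(point_prime pP) [].
Qed.

Lemma point_prod (T : finType) (Pr : pred T) (F : T -> S) :
  P (\prod_(i | Pr i) F i) -> exists2 i, Pr i & P (F i).
Proof.
elim/big_rec: _ => [/(point_proper pP)//|i x Pi IH] /(point_prime pP) [Fi|/IH//].
by exists i.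
Qed.

Lemma point_notinM f g : ~ P f -> ~ P g -> ~ P (f * g).
Proof. by move=> nf ng /(point_prime pP) []. Qed.

Lemma point_notinX f n : ~ P f -> ~ P (f ^+ n).
Proof. by move=> nf /point_exp. Qed.

Lemma point_mem_mull f g : ~ P f -> P (f * g) -> P g.
Proof. by move=> nf /(point_prime pP) []. Qed.
End Point.

(** Projective Nullstellensatz: each variable has a power in [I], since a prime avoiding its powers
    would be a point. A monomial of degree beyond the sum of the exponents is divisible by one of
    these powers. *)
Lemma no_point_vanishing I : homogeneous_ideal I -> (forall P, ~ zeros I P) ->
  exists N, forall t f, (N <= t)%N -> f \is t.-homog -> I f.
Proof.
move=> hI noP.
have pw (i : 'I_4) : exists n, I ('X_i ^+ n).
  apply: contrapT => /forallNP no.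
  have [P [hP IP Pp Pa]] := exists_prime_avoiding hI (form_X i) no.
  apply: (noP P); split=> //; split=> //; first by have := Pa 0; rewrite expr0.
  by exists i; have := Pa 1; rewrite expr1.
have [n nP] := choice pw.
exists (\sum_i n i)%N.+1 => t f le_t; apply: ideal_of_monomials => // m mt.
have [i le_i] : exists i, (n i <= m i)%N.
  apply: contrapT => /forallNP z.
  have : (mdeg m <= \sum_i n i)%N.
    by rewrite mdegE; apply: leq_sum => i _; have /negP := z i; rewrite -ltnNge => /ltnW.
  by rewrite mt; lia.
have -> : m = (U_(i) *+ n i + (m - U_(i) *+ n i))%MM.
  rewrite addmC submK //; apply/mnm_lepP => j; rewrite mulmnE mnm1E.
  by case: eqVneq => [<-|_]; rewrite ?mul1n ?mul0n.
by rewrite mpolyXD -mpolyXn; apply: hidealMr.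
Qed.

(** A prime avoiding the powers of ['X_i * hc d f] omits ['X_i], so it is a point and not the
    irrelevant ideal. Saturation provides the variable, radicality keeps the powers outside [I]. *)
Lemma curve_point_notin I f : reduced_curve I -> ~ I f -> exists P, zeros I P /\ ~ P f.
Proof.
move=> cI nIf; have hI := curve_ideal cI.
have [d nId] := hideal_form_notin hI nIf.
have [i nIi] : exists i : 'I_4, ~ I ('X_i * hc d f).
  by apply/existsNP => Iall; apply: nId; apply: (curve_saturated cI).
have [||P [hP IP Pp Pa]] := @exists_prime_avoiding K I (1 + d)%N ('X_i * hc d f) hI.
- by apply: dhomogM; [apply: form_X|apply: pihomogP].
- case=> [|n]; first by rewrite expr0; apply: curve_proper.
  by move=> /(curve_radical cI).
have := Pa 1%N; rewrite expr1 => nPi; exists P; split; last first.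
  by move=> Pf; apply: nPi; apply: hidealM => //; apply: hideal_pihomog.
split=> //; split=> //; first by have := Pa 0%N; rewrite expr0.
by exists i => Pi; apply: nPi; apply: hidealMr.
Qed.

(** Minimal primes by Zorn's lemma for unions: passing to complements turns the intersection of a
    chain of primes into a union. *)
Lemma component_below I P : zeros I P -> exists P', component I P' /\ P' `<=` P.
Proof.
move=> zP; pose good X := zeros I (~` X) /\ ~` X `<=` P.
pose PP : set (set S) := [set X | X = set0 \/ good X].
have [F FP Ftot|M [PM Mmax]] := @Zorn_bigcup _ PP.
  have [[X0 [FX0 gX0]]|noX] := pselect (exists X, F X /\ good X); last first.
    left; apply/seteqP; split=> // f [X FX Xf].
    case: (FP X FX) => [X0|gX]; first by rewrite X0 in Xf.
    by case: noX; exists X.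
  right; have get X f : F X -> X f -> good X.
    by move=> FX Xf; case: (FP X FX) => // X00; rewrite X00 in Xf.
  have cE f : (~` \bigcup_(X in F) X) f <-> forall X, F X -> ~ X f.
    by split=> [nf X FX Xf|all [X FX Xf]]; [apply: nf; exists X|apply: all FX Xf].
  case: (gX0) => [[pX0 IX0] subX0].
  split; last by move=> f /cE nf; apply: subX0; apply: nf.
  split; last first.
    by move=> f If; apply/cE => X FX Xf; have [[_ sub] _] := get X f FX Xf; apply: (sub f If).
  split.
  - split.
    + apply/cE => X FX X00; have [[pX _] _] := get X _ FX X00.
      by case: (point_ideal pX) => + _ _ _; apply.
    + move=> f g /cE nf /cE ng; apply/cE => X FX Xfg; have [[pX _] _] := get X _ FX Xfg.
      by case: (point_ideal pX) => _ + _ _ => /(_ f g (nf X FX) (ng X FX)); apply.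
    + move=> f g /cE ng; apply/cE => X FX Xfg; have [[pX _] _] := get X _ FX Xfg.
      by case: (point_ideal pX) => _ _ + _ => /(_ f g (ng X FX)); apply.
    + move=> f d /cE nf; apply/cE => X FX Xf; have [[pX _] _] := get X _ FX Xf.
      by case: (point_ideal pX) => _ _ _ + => /(_ f d (nf X FX)); apply.
  - by move=> /cE /(_ X0 FX0) nX1; apply: (point_proper pX0).
  - move=> f g /cE nfg; apply/or_asboolP; apply/negPn/negP; rewrite negb_or.
    case/andP=> /asboolPn /cE/existsNP[X /not_implyP[FX /contrapT Xf]].
    move=> /asboolPn /cE/existsNP[Y /not_implyP[FY /contrapT Yg]].
    have key Z : F Z -> Z f -> Z g -> False.
      move=> FZ Zf Zg; have [[pZ _] _] := get Z f FZ Zf.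
      by case: (point_prime pZ (nfg Z FZ)).
    have [XY|YX] := Ftot X Y FX FY.
      by apply: (key Y) => //; apply: XY.
    by apply: (key X) => //; apply: YX.
  - have [i ni] := point_relevant (proj1 zP); exists i => /cE nX; apply: ni.
    by apply: subX0; apply: nX.
have gP : good (~` P) by rewrite /good setCK; split.
have gM : good M.
  case: PM => // M0; case: (Mmax (~` P)); last by right.
  rewrite M0; split=> // sub; apply: (sub 1); exact: (point_proper (proj1 zP)).
case: gM => zM MP; exists (~` M); split=> //; split=> // P' zP' P'M.
apply: contrapT => ne; apply: (Mmax (~` P')); last first.
  by right; rewrite /good setCK; split=> // f /P'M /MP.
split; first by rewrite -[M]setCK; apply: subsetC.
move=> sub; apply: ne; apply/seteqP; split=> // f nMf.
by apply: contrapT => nP'; apply: nMf; apply: sub.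
Qed.

Lemma not_subset_form P J : homogeneous_ideal P -> homogeneous_ideal J ->
  ~ J `<=` P -> exists d f, [/\ f \is d.-homog, J f & ~ P f].
Proof.
move=> hP hJ /existsNP[f /not_implyP[Jf nPf]]; have [d nd] := hideal_form_notin hP nPf.
by exists d, (hc d f); split=> //; [apply: pihomogP|apply: hideal_pihomog].
Qed.

Lemma separating_forms k (P : 'I_k -> set S) : (forall i, proj_point (P i)) ->
  (forall i j, i != j -> ~ P j `<=` P i) ->
  exists d (f : 'I_k -> S), forall i,
    [/\ f i \is d.-homog, ~ P i (f i) & forall j, j != i -> P j (f i)].
Proof.
move=> pP inc.
have step i j : exists dg : nat * S,
    [/\ dg.2 \is (dg.1).-homog, j != i -> P j dg.2 & ~ P i dg.2].
  case: (eqVneq j i) => [->|ne].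
    by exists (0%N, 1); split=> //; [apply: dhomog1|apply: point_proper].
  rewrite eq_sym in ne.
  have [d [f [hf Pf nPf]]] := not_subset_form (point_ideal (pP i)) (point_ideal (pP j)) (inc i j ne).
  by exists (d, f).
have [g gP] := choice (fun ij : 'I_k * 'I_k => step ij.1 ij.2).
have [x xP] := choice (fun i => point_relevant (pP i)).
pose e i := (\sum_(j < k) (g (i, j)).1)%N.
(* The power of a variable outside [P i] pads the product, of degree [e i], to the sum of all the
   [e j]. *)
pose f i := 'X_(x i) ^+ (\sum_(j < k | j != i) e j)%N * \prod_(j < k) (g (i, j)).2.
exists (\sum_(i < k) e i)%N, f => i; split.
- rewrite (bigD1 i) //= addnC; apply: dhomogM; first exact: form_Xn.
  rewrite /e; elim/big_rec2: _ => [|j d y _ IH]; first exact: dhomog1.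
  by apply: dhomogM => //; case: (gP (i, j)).
- apply: point_notinM => //; first exact: point_notinX.
  by move=> /(point_prod (pP i)) [j _]; case: (gP (i, j)).
- move=> j ne; apply: hidealM; first exact: point_ideal.
  rewrite (bigD1 j) //=; apply: hidealMr; first exact: point_ideal.
  by case: (gP (i, j)) => _ + _; apply.
Qed.

Definition subspace_set (L : set S) := L 0 /\ forall c f g, L f -> L g -> L (c *: f + g).

Lemma hideal_subspace I : homogeneous_ideal I -> subspace_set I.
Proof.
move=> hI; split; first exact: hideal0.
by move=> c f g If Ig; apply: hidealD => //; apply: hideal_scale.
Qed.

(** If [x] avoids every subspace but [W ord0], which contains it, and [y] avoids [W ord0], then
    every [c *: x + y] avoids [W ord0]. Each of the [k] others contains at most one such vector,
    since two would span [x]; so [k.+1] scalars suffice. *)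
Lemma avoid_subspaces (Kinf : injective (fun n : nat => n%:R : K))
    k (W : 'I_k -> set S) (L : set S) :
  subspace_set L -> (forall i, subspace_set (W i)) ->
  (forall i, exists2 f, L f & ~ W i f) -> exists2 f, L f & forall i, ~ W i f.
Proof.
move=> [L0 Ladd]; elim: k W => [|k IH] W sW exW; first by exists 0 => // -[].
have [x Lx nx] := IH (fun i => W (lift ord0 i)) (fun i => sW _) (fun i => exW _).
have cover (f : S) : (forall i, ~ W (lift ord0 i) f) -> ~ W ord0 f -> forall i, ~ W i f.
  by move=> n1 n0 i; case: (unliftP ord0 i) => [j ->|->].
have [W0x|] := pselect (W ord0 x); last by exists x => //; apply: cover.
have [y Ly ny] := exW ord0.
pose z (c : nat) := (c%:R : K) *: x + y.
have zL c : L (z c) by apply: Ladd.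
have z0 c : ~ W ord0 (z c).
  move=> W0z; apply: ny; have [W00 Wadd] := sW ord0.
  have -> : y = (- c%:R : K) *: x + z c by rewrite /z addrA -scalerDl addNr scale0r add0r.
  exact: Wadd.
apply: contrapT => none.
have bad (c : 'I_k.+1) : exists i, W (lift ord0 i) (z c).
  apply: contrapT => /forallNP all; apply: none; exists (z c) => //.
  exact: cover.
have [h hP] := choice bad.
have hinj : injective h.
  move=> c c' E; apply/val_inj/Kinf/eqP; rewrite -subr_eq0; apply: contrapT => /negP ne.
  apply: (nx (h c)); have [W00 Wadd] := sW (lift ord0 (h c)).
  have -> : x = ((c%:R - c'%:R)^-1 : K) *: ((-1 : K) *: z c' + z c) + 0.
    rewrite /z addr0 scaleN1r opprD addrACA [- y + y]addNr addr0 [- _ + _]addrC -scalerBl.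
    by rewrite scalerA mulVf // scale1r.
  by apply: (Wadd); [apply: (Wadd); [rewrite E; apply: hP|apply: hP]|].
by have := leq_card h hinj; rewrite !card_ord ltnn.
Qed.

End ProjectivePoints.

(** * Subspaces given by predicates, and coordinates on quotients *)

Section VectorCoordinates.
Variables (K : fieldType) (vT : vectType K).

(** A subspace of greatest dimension inside [X] exhausts it, as any vector of [X] outside would
    enlarge the subspace. *)
Lemma vspace_of_set (X : set vT) : X 0 ->
  (forall c u v, X u -> X v -> X (c *: u + v)) ->
  exists U : {vspace vT}, forall v, v \in U <-> X v.
Proof.
move=> X0 Xlin.
pose p n := `[< exists U : {vspace vT}, (forall v, v \in U -> X v) /\ \dim U = n >].
have ex : exists n, p n.
  by exists 0%N; apply/asboolP; exists 0%VS; rewrite dimv0; split=> // v; rewrite memv0 => /eqP ->.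
have bnd n : p n -> (n <= \dim {:vT})%N.
  by move=> /asboolP [U [_ <-]]; apply: dimvS; apply: subvf.
case: (ex_maxnP ex bnd) => n /asboolP [U [UX dU]] maxn; exists U => v; split; first exact: UX.
move=> Xv; apply: contrapT => nUv.
have sub w : w \in (<[v]> + U)%VS -> X w.
  by case/memv_addP => _ /vlineP[c ->] [u uU ->]; apply: Xlin => //; apply: UX.
have := maxn (\dim (<[v]> + U)%VS); rewrite /p.
have -> : `[< exists U0 : {vspace vT}, (forall v0, v0 \in U0 -> X v0) /\
    \dim U0 = \dim (<[v]> + U)%VS >] by apply/asboolP; exists (<[v]> + U)%VS.
move=> /(_ isT); rewrite -dU leqNgt => /negP; apply.
rewrite ltn_neqAle dimvS ?addvSr // andbT.
apply/eqP => E; apply: nUv.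
have /eqP -> : U == (<[v]> + U)%VS by rewrite eqEdim addvSr E leqnn.
by apply: (subvP (addvSl _ _)); apply: memv_line.
Qed.

Lemma quotient_coordinates (U : {vspace vT}) :
  exists (phi : {linear vT -> 'rV[K]_(\dim U^C)}) (s : {linear 'rV[K]_(\dim U^C) -> vT}),
    (forall v, phi (s v) = v) /\ (forall v, phi v = 0 <-> v \in U).
Proof.
pose C := (U^C)%VS.
have dir : (C :&: U = 0)%VS by rewrite capvC capv_compl.
have full : (C + U)%VS = fullv by rewrite addvC addv_complf.
pose X := vbasis C.
pose phi v : 'rV[K]_(\dim C) := \row_i coord X i (daddv_pi C U v).
pose s (w : 'rV[K]_(\dim C)) := \sum_i w 0 i *: X`_i.
have lphi : linear phi by move=> c u v; apply/rowP => i; rewrite !mxE !linearP.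
have ls : linear s.
  move=> c u v; rewrite /s scaler_sumr -big_split; apply: eq_bigr => i _ /=.
  by rewrite !mxE scalerDl scalerA.
pose Lphi := GRing.isLinear.Build _ _ _ _ phi lphi.
pose Ls := GRing.isLinear.Build _ _ _ _ s ls.
exists (HB.pack_for {linear vT -> 'rV[K]_(\dim C)} phi Lphi).
exists (HB.pack_for {linear 'rV[K]_(\dim C) -> vT} s Ls); split=> /=.
  move=> v; have sC : s v \in C.
    by apply: rpred_sum => i _; apply: rpredZ; apply: vbasis_mem; apply: memt_nth.
  apply/rowP => i; rewrite mxE daddv_pi_id // coord_sum_free //.
  exact: (basis_free (vbasisP C)).
move=> v; have Ev := daddv_pi_add dir (_ : v \in (C + U)%VS).
rewrite full memvf in Ev; split=> [E0|vU].
  have E1 : daddv_pi C U v = 0.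
    rewrite (coord_vbasis (memv_pi C U v)) big1 // => i _.
    by move/rowP: E0 => /(_ i); rewrite !mxE => ->; rewrite scale0r.
  by rewrite -(Ev isT) E1 add0r memv_pi.
have E1 : daddv_pi C U v = 0.
  by apply: (addIr (daddv_pi U C v)); rewrite (Ev isT) add0r daddv_pi_id // capvC.
by apply/rowP => i; rewrite !mxE E1 linear0.
Qed.

End VectorCoordinates.

(** * Hilbert functions and multiplication matrices *)

Section HilbertFunction.
Variable K : fieldType.
Local Notation S := {mpoly K[4]}.
Local Notation hc := (pihomog mdeg).
Implicit Types (I J P : set S) (f g : S) (t d : nat).

(** The default [0%VS] is not reached for a homogeneous ideal; it makes [hilb] a total function of
    the set [I]. *)
Definition graded_part I t : {vspace dhomog 4 K t} :=
  xget 0%VS [set U : {vspace dhomog 4 K t} | forall f : dhomog 4 K t, f \in U <-> I (mpoly_of_dhomog f)].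

Definition hilb I t : nat := \dim (graded_part I t)^C.

Lemma graded_partP I t : homogeneous_ideal I ->
  forall f : dhomog 4 K t, f \in graded_part I t <-> I (mpoly_of_dhomog f).
Proof.
move=> hI; rewrite /graded_part; case: xgetP => [U -> //|none].
have [||U UP] := @vspace_of_set K (dhomog 4 K t) [set f | I (mpoly_of_dhomog f)].
- exact: hideal0.
- by move=> c u v Iu Iv; apply: hidealD => //; apply: hideal_scale.
by case: (none U).
Qed.

Lemma hilbert_functionP I t h : homogeneous_ideal I -> hilbert_function I t h <-> h = hilb I t.
Proof.
move=> hI; have E : hilb I t = (\dim {: dhomog 4 K t} - \dim (graded_part I t))%N.
  by rewrite /hilb dimv_compl.
split=> [[U [UP ->]]|->].
  rewrite E; do 2!f_equal; apply/vspaceP => f; apply/idP/idP.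
    by move/UP/(graded_partP hI f).
  by move/(graded_partP hI f)/UP.
by exists (graded_part I t); split=> //; apply: graded_partP.
Qed.

Definition homog_proj t f : dhomog 4 K t := DHomog (pihomogP mdeg t f).

Lemma homog_proj_linear t : linear (homog_proj t).
Proof. by move=> c f g; apply/val_inj; rewrite /= linearP. Qed.
HB.instance Definition _ t :=
  GRing.isLinear.Build K S (dhomog 4 K t) _ (homog_proj t) (homog_proj_linear t).

(** A presentation of the degree [t] part of S/I by row vectors: [phi] sees only the component of
    degree [t], so it applies to any polynomial, and [s] picks a form in each class. *)
Definition coordinates_spec I t
    (phi : {linear S -> 'rV[K]_(hilb I t)}) (s : {linear 'rV[K]_(hilb I t) -> S}) :=
  [/\ forall v, s v \is t.-homog, forall v, phi (s v) = v,
      forall f, phi (hc t f) = phi f & forall f, f \is t.-homog -> phi f = 0 <-> I f].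

Lemma exists_coordinates I t : homogeneous_ideal I ->
  exists ps : {linear S -> 'rV[K]_(hilb I t)} * {linear 'rV[K]_(hilb I t) -> S},
    coordinates_spec ps.1 ps.2.
Proof.
move=> hI; have [phi [s [phis phi0]]] := quotient_coordinates (graded_part I t).
exists (phi \o homog_proj t : {linear S -> 'rV[K]_(hilb I t)},
        @mpoly_of_dhomog 4 K t \o s : {linear 'rV[K]_(hilb I t) -> S}); split=> /=.
- by move=> v; apply: dhomog_is_dhomog.
- move=> v; rewrite -[RHS]phis; congr (phi _); apply: val_inj => /=.
  by rewrite pihomog_dE //; apply: dhomog_is_dhomog.
- by move=> f; congr (phi _); apply: val_inj; rewrite /= pihomog_id.
- move=> f hf; rewrite phi0 (graded_partP hI) /=.
  by rewrite pihomog_dE.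
Qed.

Definition coordinates I t :
    {linear S -> 'rV[K]_(hilb I t)} * {linear 'rV[K]_(hilb I t) -> S} :=
  match pselect (exists ps : {linear S -> 'rV[K]_(hilb I t)} * {linear 'rV[K]_(hilb I t) -> S},
      coordinates_spec ps.1 ps.2) with
  | left H => projT1 (cid H)
  | right _ => (\0 : {linear S -> 'rV[K]_(hilb I t)}, \0 : {linear 'rV[K]_(hilb I t) -> S})
  end.

Definition crd I t := (coordinates I t).1.
Definition lft I t := (coordinates I t).2.

Lemma coordinatesP I t : homogeneous_ideal I -> coordinates_spec (crd I t) (lft I t).
Proof.
move=> hI; rewrite /crd /lft /coordinates; case: pselect => [H|[]]; last exact: exists_coordinates.
by case: (cid H).
Qed.

(** The target degree [t'] is a free parameter, so that products of these matrices need no casts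
    between [t + d] and equal expressions. *)
Definition mulm I t t' g : 'M[K]_(hilb I t, hilb I t') :=
  \matrix_(i, j) crd I t' (g * lft I t (delta_mx 0 i)) 0 j.

Definition projm I J t : 'M[K]_(hilb I t, hilb J t) :=
  \matrix_(i, j) crd J t (lft I t (delta_mx 0 i)) 0 j.

Lemma mul_row_lin m n (phi : {linear 'rV[K]_m -> 'rV[K]_n}) (v : 'rV[K]_m) :
  v *m \matrix_(i, j) phi (delta_mx 0 i) 0 j = phi v.
Proof. by rewrite -[RHS]mul_rV_lin1; congr (_ *m _); apply/matrixP => i j; rewrite !mxE. Qed.

Definition mul_by g f : S := g * f.

Lemma mul_by_linear g : linear (mul_by g).
Proof. by move=> c f f'; rewrite /mul_by mulrDr scalerAr. Qed.
HB.instance Definition _ g := GRing.isLinear.Build K S S _ (mul_by g) (mul_by_linear g).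

Lemma mulmE I t t' g v : v *m mulm I t t' g = crd I t' (g * lft I t v).
Proof. exact: (mul_row_lin (crd I t' \o mul_by g \o lft I t : {linear 'rV[K]_(hilb I t) -> 'rV[K]_(hilb I t')})). Qed.

Lemma projmE I J t v : v *m projm I J t = crd J t (lft I t v).
Proof. exact: (mul_row_lin (crd J t \o lft I t : {linear 'rV[K]_(hilb I t) -> 'rV[K]_(hilb J t)})). Qed.

Section Coordinates.
Variables (I : set S) (hI : homogeneous_ideal I).

Lemma lft_form t v : lft I t v \is t.-homog.
Proof. by case: (coordinatesP t hI). Qed.

Lemma lftK t v : crd I t (lft I t v) = v.
Proof. by case: (coordinatesP t hI). Qed.

Lemma crd_pihomog t f : crd I t (hc t f) = crd I t f.
Proof. by case: (coordinatesP t hI). Qed.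

Lemma crd_eq0 t f : f \is t.-homog -> crd I t f = 0 <-> I f.
Proof. by case: (coordinatesP t hI) => _ _ _; apply. Qed.

Lemma crd_ideal t f : I f -> crd I t f = 0.
Proof.
by move=> If; rewrite -crd_pihomog; apply/crd_eq0; [apply: pihomogP|apply: hideal_pihomog].
Qed.

Lemma crdK_mod t f : f \is t.-homog -> I (f - lft I t (crd I t f)).
Proof.
move=> hf; apply/(@crd_eq0 t); first by apply: rpredB => //; apply: lft_form.
by rewrite linearB /= lftK subrr.
Qed.

Lemma crd_mul t t' g f : f \is t.-homog -> crd I t' (g * f) = crd I t f *m mulm I t t' g.
Proof.
move=> hf; rewrite mulmE; apply/eqP; rewrite -subr_eq0 -linearB -mulrBr /=; apply/eqP.
by apply: crd_ideal; apply: hidealM => //; apply: crdK_mod.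
Qed.

Lemma mulmM t d t' t'' g g' : g \is d.-homog -> t' = (t + d)%N ->
  mulm I t t' g *m mulm I t' t'' g' = mulm I t t'' (g' * g).
Proof.
move=> hg ->; apply/row_matrixP => i; rewrite !rowE mulmxA (@mulmE I t) -crd_mul ?mulmE ?mulrA //.
by rewrite addnC; apply: dhomogM => //; apply: lft_form.
Qed.

Lemma mulm_ideal t t' g : I g -> mulm I t t' g = 0.
Proof.
move=> Ig; apply/row_matrixP => i; rewrite !rowE mulmx0 mulmE.
by apply: crd_ideal; apply: hidealMr.
Qed.

Lemma mulm_linear t t' c g g' : mulm I t t' (c *: g + g') = c *: mulm I t t' g + mulm I t t' g'.
Proof.
apply/row_matrixP => i; rewrite !rowE mulmxDr -scalemxAr !mulmE mulrDl -scalerAl.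
exact: linearP.
Qed.

Lemma mulm_const t c : mulm I t t c%:MP = c%:M.
Proof.
apply/row_matrixP => i; rewrite !rowE mulmE mul_mpolyC linearZ /= lftK.
by rewrite mul_mx_scalar.
Qed.

Lemma row_free_mulm t d g : g \is d.-homog ->
  (forall f, f \is t.-homog -> I (g * f) -> I f) -> row_free (mulm I t (t + d) g).
Proof.
move=> hg nz; rewrite -kermx_eq0; apply/eqP/row_matrixP => i.
rewrite row0; set v := row i _.
have : v *m mulm I t (t + d) g = 0 by apply/sub_kermxP; apply: row_sub.
rewrite mulmE => /(crd_eq0 (t := (t + d)%N)) E.
rewrite -[v]lftK; apply/crd_eq0; first exact: lft_form.
apply: nz; first exact: lft_form.
by apply: E; rewrite addnC; apply: dhomogM => //; apply: lft_form.
Qed.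

Lemma hilb_ge_ind t k (F : 'I_k -> S) : (forall i, F i \is t.-homog) ->
  (forall c : 'I_k -> K, I (\sum_i c i *: F i) -> forall i, c i = 0) -> (k <= hilb I t)%N.
Proof.
move=> hF ind; pose M : 'M[K]_(k, hilb I t) := \matrix_i crd I t (F i).
suff : row_free M by rewrite /row_free => /eqP <-; apply: rank_leq_col.
rewrite -kermx_eq0; apply/eqP/row_matrixP => i.
rewrite row0; set v := row i _.
have : v *m M = 0 by apply/sub_kermxP; apply: row_sub.
rewrite mulmx_sum_row => E; apply/rowP => j; rewrite [RHS]mxE.
apply: (ind (fun j => v 0 j)); apply/(@crd_eq0 t).
  by apply: rpred_sum => l _; apply: rpredZ; apply: hF.
rewrite linear_sum -[RHS]E; apply: eq_bigr => l _ /=.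
by rewrite linearZ rowK.
Qed.

Lemma hilb_le_span t k (F : 'I_k -> S) : (forall i, F i \is t.-homog) ->
  (forall f, f \is t.-homog -> exists c : 'I_k -> K, I (f - \sum_i c i *: F i)) ->
  (hilb I t <= k)%N.
Proof.
move=> hF sp; pose M : 'M[K]_(k, hilb I t) := \matrix_i crd I t (F i).
suff /eqP <- : row_full M by apply: rank_leq_row.
rewrite -sub1mx; apply/row_subP => i; rewrite row1.
have [c Ic] := sp (lft I t (delta_mx 0 i)) (lft_form _).
apply/submxP; exists (\row_j c j); rewrite mulmx_sum_row.
rewrite -[LHS]lftK; apply/eqP; rewrite -subr_eq0.
have -> : \sum_j (\row_j c j) 0 j *: row j M = crd I t (\sum_j c j *: F j).
  by rewrite linear_sum; apply: eq_bigr => j _; rewrite linearZ /= mxE rowK.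
by rewrite -linearB /= crd_ideal.
Qed.

End Coordinates.

Section TwoIdeals.
Variables (I J : set S) (hI : homogeneous_ideal I) (hJ : homogeneous_ideal J) (IJ : I `<=` J).

Lemma crd_projm t f : crd J t f = crd I t f *m projm I J t.
Proof.
rewrite projmE; apply/eqP; rewrite -subr_eq0 -linearB /= -(crd_pihomog hJ).
apply/eqP/crd_ideal => //; rewrite pihomogB (pihomog_dE (lft_form hI _)).
apply: IJ; rewrite -(crd_pihomog hI).
by apply: crdK_mod => //; apply: pihomogP.
Qed.

Lemma projm_mulm t t' g : projm I J t *m mulm J t t' g = mulm I t t' g *m projm I J t'.
Proof.
apply/row_matrixP => i; rewrite !rowE !mulmxA projmE (@mulmE I t) -(crd_mul hJ) ?lft_form //.
exact: crd_projm.
Qed.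

Lemma row_full_projm t : row_full (projm I J t).
Proof.
rewrite -sub1mx; apply/row_subP => i; rewrite row1.
apply/submxP; exists (crd I t (lft J t (delta_mx 0 i))).
by rewrite -crd_projm lftK.
Qed.

Lemma hilb_le t : (hilb J t <= hilb I t)%N.
Proof. by have /eqP <- := row_full_projm t; apply: rank_leq_row. Qed.

End TwoIdeals.

(** Exactness of S/I -> S/I -> S/(I, g) in the middle, the first map being multiplication by [g]; a
    block of rows is treated at once so that it applies to kernel matrices. *)
Lemma ker_projm_add_form I t d g m (x : 'M[K]_(m, _)) :
  homogeneous_ideal I -> g \is d.-homog ->
  x *m projm I (ideal_add_form I g) (t + d) = 0 ->
  exists y, x = y *m mulm I t (t + d) g.
Proof.
move=> hI hg Ex; apply/submxP/row_subP => i.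
have hJ := ideal_add_form_homogeneous hI hg.
have : row i x *m projm I (ideal_add_form I g) (t + d) = 0 by rewrite -row_mul Ex row0.
rewrite projmE => /(crd_eq0 hJ (lft_form hI _)) [a [b [Ia E]]].
apply/submxP; exists (crd I t b); rewrite -[row i x](lftK hI) E linearD /= crd_ideal // add0r.
have Eb : hc (t + d)%N (g * b) = g * hc t b by rewrite addnC pihomog_mull.
rewrite -(crd_pihomog hI) [b * g]mulrC Eb (crd_mul hI _ _ (pihomogP mdeg t b)).
by rewrite (crd_pihomog hI).
Qed.

Lemma hilb_add_form I t d g :
  homogeneous_ideal I -> g \is d.-homog ->
  (forall f, f \is t.-homog -> I (g * f) -> I f) ->
  hilb I (t + d) = (hilb I t + hilb (ideal_add_form I g) (t + d))%N.
Proof.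
move=> hI hg nz; set J := ideal_add_form I g.
have hJ : homogeneous_ideal J by apply: ideal_add_form_homogeneous hg.
have IJ : I `<=` J by apply: ideal_add_form_sub.
have /eqP rJ := row_full_projm hI hJ IJ (t + d).
have /eqP rg := row_free_mulm hI hg nz.
have : (mulm I t (t + d) g == kermx (projm I J (t + d)))%MS.
  apply/andP; split.
    apply/sub_kermxP; rewrite -projm_mulm // mulm_ideal ?mulmx0 //.
    exact: ideal_add_form_gen.
  have [y ->] : exists y, kermx (projm I J (t + d)) = y *m mulm I t (t + d) g.
    by apply: ker_projm_add_form => //; apply: mulmx_ker.
  exact: submxMl.
move=> E; move: (eqmx_rank E); rewrite mxrank_ker rg rJ => ->.
by rewrite subnK // hilb_le.
Qed.

End HilbertFunction.

(** * Points bound Hilbert functions from below *)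

Section CurvePoints.
Variable K : fieldType.
Hypothesis Kinf : injective (fun n : nat => n%:R : K).
Local Notation S := {mpoly K[4]}.
Local Notation hc := (pihomog mdeg).
Implicit Types (I J P w z : set S) (f g : S) (t d : nat).

Lemma hilb_eq0 I t : homogeneous_ideal I -> (forall f, f \is t.-homog -> I f) -> hilb I t = 0%N.
Proof.
move=> hI all; apply/eqP; rewrite -leqn0.
have := @hilb_le_span K I hI t 0 (fun=> 0); apply=> [[]//|f hf].
by exists (fun=> 0); rewrite big_ord0 subr0; apply: all.
Qed.

Lemma hilb_eq0_forms I t : homogeneous_ideal I -> hilb I t = 0%N ->
  forall f, f \is t.-homog -> I f.
Proof.
move=> hI E f hf; apply/(crd_eq0 hI hf); move: (crd I t f); rewrite E => v.
by apply/rowP => -[].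
Qed.

Lemma no_point_hilb I : homogeneous_ideal I -> (forall P, ~ zeros I P) ->
  exists N, forall t, (N <= t)%N -> hilb I t = 0%N.
Proof.
move=> hI /(no_point_vanishing hI)[N IN]; exists N => t le_t.
by apply: hilb_eq0 => // f; apply: IN.
Qed.

Lemma hilb_point_gt0 P t : proj_point P -> (0 < hilb P t)%N.
Proof.
move=> pP; have hP := point_ideal pP; rewrite lt0n; apply/eqP => E.
have [i ni] := point_relevant pP.
by apply: (point_notinX pP (n := t) ni); apply: (hilb_eq0_forms hP E); apply: form_Xn.
Qed.

Lemma hilb_ge_ind_fin I t (T : finType) (F : T -> S) : homogeneous_ideal I ->
  (forall i, F i \is t.-homog) ->
  (forall c : T -> K, I (\sum_i c i *: F i) -> forall i, c i = 0) -> (#|T| <= hilb I t)%N.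
Proof.
move=> hI hF ind; apply: (@hilb_ge_ind K I hI t #|T| (fun i => F (enum_val i))) => // c Ic i.
have := ind (fun x => c (enum_rank x)); rewrite (reindex_onto enum_val enum_rank) /=; last first.
  by move=> x _; rewrite enum_rankK.
rewrite (eq_bigl xpredT); last by move=> x; rewrite enum_valK eqxx.
rewrite (eq_bigr (fun i => c i *: F (enum_val i))); last by move=> x _; rewrite enum_valK.
by move=> /(_ Ic (enum_val i)); rewrite enum_valK.
Qed.

(** Take representatives of a basis of each S/P_i, times a separating form [f i]. Modulo [P i] a
    linear relation keeps only its terms of index [i], and there [f i] cancels. The shift [d] is the
    common degree of the separating forms. *)
Lemma points_hilb_sum J k (P : 'I_k -> set S) : homogeneous_ideal J ->
  (forall i, zeros J (P i)) -> (forall i j, i != j -> ~ P j `<=` P i) ->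
  exists d, forall t, (\sum_(i < k) hilb (P i) t <= hilb J (t + d))%N.
Proof.
move=> hJ zP inc; have pP i := proj1 (zP i); have hP i := point_ideal (pP i).
have [d [f fP]] := separating_forms pP inc; exists d => t.
pose T := {i : 'I_k & 'I_(hilb (P i) t)}.
pose tg l (j : 'I_(hilb (P l) t)) : T := Tagged (fun l => 'I_(hilb (P l) t)) j.
pose F (x : T) := f (tag x) * lft (P (tag x)) t (delta_mx 0 (tagged x)).
have -> : (\sum_(i < k) hilb (P i) t)%N = #|{: T}|.
  rewrite card_tagged sumnE big_map big_enum /=.
  by apply: eq_bigr => i _; rewrite card_ord.
apply: (@hilb_ge_ind_fin _ _ _ F hJ) => [x|c Jc [i j]].
  by rewrite addnC; apply: dhomogM; [case: (fP (tag x))|apply: lft_form].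
have [hf nf other] := fP i.
have : P i (f i * \sum_(j < hilb (P i) t) c (tg i j) *: lft (P i) t (delta_mx 0 j)).
  have := proj2 (zP i) _ Jc.
  have -> : \sum_x c x *: F x = \sum_(l < k) f l *
      \sum_(j < hilb (P l) t) c (tg l j) *: lft (P l) t (delta_mx 0 j).
    under [RHS]eq_bigr do rewrite mulr_sumr.
    rewrite (@sig_big_dep _ _ _ _ (fun l => 'I_(hilb (P l) t)) xpredT (fun=> xpredT)
       (fun l j => f l * (c (tg l j) *: lft (P l) t (delta_mx 0 j)))).
    by apply: eq_bigr => -[l m] _; rewrite -scalerAr.
  rewrite (bigD1 i) //= addrC; apply: (hideal_cancel_add (hP i)).
  apply: hideal_sum => // l ne; apply: hidealMr => //.
  by have [_ _] := fP l; apply; rewrite eq_sym.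
move=> /(point_mem_mull (pP i) nf).
set v : 'rV[K]_(hilb (P i) t) := \row_l c (tg i l).
have -> : \sum_(j < hilb (P i) t) c (tg i j) *: lft (P i) t (delta_mx 0 j) = lft (P i) t v.
  rewrite [v in RHS]row_sum_delta linear_sum; apply: eq_bigr => l _.
  by rewrite linearZ /= mxE.
move=> /(crd_eq0 (hP i) (lft_form (hP i) _)); rewrite lftK // => /rowP /(_ j).
by rewrite !mxE.
Qed.

End CurvePoints.

(** * Components of a curve and their degrees *)

Section CurveComponents.
Variable K : fieldType.
Hypothesis Kinf : injective (fun n : nat => n%:R : K).
Local Notation S := {mpoly K[4]}.
Local Notation hc := (pihomog mdeg).
Implicit Types (I J P w z : set S) (f g : S) (t d : nat).

(** By [points_hilb_sum] each point costs at least one dimension; a bound in arbitrarily large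
    degrees absorbs the unknown shift there. *)
Lemma finite_points J B : homogeneous_ideal J ->
  (forall t, exists2 t', (t <= t')%N & (hilb J t' <= B)%N) ->
  (forall w w', zeros J w -> zeros J w' -> w `<=` w' -> w' = w) ->
  exists k (z : 'I_k -> set S), [/\ (k <= B)%N, injective z, forall i, zeros J (z i)
    & forall w, zeros J w -> exists i, z i = w].
Proof.
move=> hJ bnd inc.
pose p k := `[< exists z : 'I_k -> set S, injective z /\ forall i, zeros J (z i) >].
have ex : exists k, p k by exists 0%N; apply/asboolP; exists (fun=> set0); split=> -[].
have le k : p k -> (k <= B)%N.
  move=> /asboolP [z [inj zz]].
  have [|d dP] := points_hilb_sum hJ zz.
    by move=> i j ne sub; case/eqP: ne; apply: inj; apply: inc.
  have [t le_t le_B] := bnd d; have := dP (t - d)%N; rewrite subnK // => le1.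
  apply: leq_trans le_B; apply: leq_trans le1.
  rewrite -[X in (X <= _)%N]card_ord -sum1_card; apply: leq_sum => i _.
  by apply: hilb_point_gt0; case: (zz i).
case: (ex_maxnP ex le) => k pk maxk; have le_k := le _ pk.
move/asboolP: pk => [z [inj zz]]; exists k, z; split=> // w zw.
apply: contrapT => /forallNP no.
pose z' (i : 'I_k.+1) := if unlift ord0 i is Some j then z j else w.
suff : p k.+1 by move=> /maxk; rewrite ltnn.
apply/asboolP; exists z'; split=> [i j|i]; rewrite /z'; last by case: unliftP.
case: (unliftP ord0 i) => [i' ->|->]; case: (unliftP ord0 j) => [j' ->|->] //.
- by move/inj ->.
- by move=> E; case: (no i').
- by move=> E; case: (no j').
Qed.

Lemma lform_notin P : proj_point P -> exists v : 'rV[K]_4, ~ P (lform v).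
Proof. by move=> pP; have [i ni] := point_relevant pP; exists (delta_mx 0 i); rewrite lform_delta. Qed.

Lemma avoid_lform k (W : 'I_k -> set S) : (forall i, homogeneous_ideal (W i)) ->
  (forall i, exists v : 'rV[K]_4, ~ W i (lform v)) ->
  exists v : 'rV[K]_4, forall i, ~ W i (lform v).
Proof.
move=> hW exW; have [||i|_ [v ->]] := avoid_subspaces Kinf (L := [set f | exists v, f = lform v]) (W := W).
- split; first by exists 0; rewrite linear0.
  by move=> c f g [u ->] [v ->]; exists (c *: u + v); rewrite linearP.
- by move=> i; apply: hideal_subspace.
- by have [v nv] := exW i; exists (lform v) => //; exists v.
by exists v.
Qed.

(** If [l] had no zero on [P], the Hilbert function of [P] would be eventually constant. Then a form
    [f] in [w] but not in [P] would leave S/(P, f) zero in some degree, so [w] would contain a power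
    of every variable. *)
Lemma point_section P w l : proj_point P -> proj_point w -> P `<=` w -> w <> P ->
  l \is 1.-homog -> ~ P l -> exists w', [/\ proj_point w', P `<=` w' & w' l].
Proof.
move=> pP pw Pw ne hl nPl; have hP := point_ideal pP; have hw := point_ideal pw.
apply: contrapT => /forallNP none.
have hJ := ideal_add_form_homogeneous hP hl.
have [|N JN] := no_point_hilb hJ.
  move=> w' [pw' sub]; apply: (none w'); split=> //.
    by apply: subset_trans sub; apply: ideal_add_form_sub.
  by apply: sub; apply: ideal_add_form_gen.
have const t s : (N <= t)%N -> hilb P (t + s) = hilb P t.
  move=> le; elim: s => [|s IH]; first by rewrite addn0.
  rewrite addnS -addn1 (hilb_add_form (g := l) hP hl) ?IH; last first.
    by move=> f _; apply: point_mem_mull.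
  by rewrite JN ?addn0 //; lia.
have [d [f [hf wf nPf]]] : exists d f, [/\ f \is d.-homog, w f & ~ P f].
  by apply: not_subset_form => // sub; apply: ne; apply/seteqP.
have hJf := ideal_add_form_homogeneous hP hf.
have E : hilb (ideal_add_form P f) (N + d) = 0%N.
  have := hilb_add_form (t := N) (g := f) hP hf; rewrite const // => H.
  suff : hilb P N = (hilb P N + hilb (ideal_add_form P f) (N + d))%N by lia.
  by apply: H => g _; apply: point_mem_mull.
have [i ni] := point_relevant pw; apply: (point_notinX pw (n := N + d) ni).
have : ideal_add_form P f ('X_i ^+ (N + d)) by apply: (hilb_eq0_forms hJf E); apply: form_Xn.
exact: ideal_add_form_min.
Qed.

(** At a point [w'] of the plane [l] some ['X_i] does not vanish. The [t.+1] forms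
    [l ^+ j * 'X_i ^+ (t - j)] are independent modulo [P]: divide a relation by the lowest power of
    [l] that occurs and reduce modulo [w']. *)
Lemma hilb_nonclosed P w t : proj_point P -> proj_point w -> P `<=` w -> w <> P ->
  (t < hilb P t)%N.
Proof.
move=> pP pw Pw ne; have hP := point_ideal pP.
have [v nv] := lform_notin pP; set l := lform v in nv.
have [w' [pw' Pw' w'l]] := point_section pP pw Pw ne (form_lform v) nv.
have [i ni] := point_relevant pw'; have hw' := point_ideal pw'.
apply: (@hilb_ge_ind K P hP t t.+1 (fun j => l ^+ j * 'X_i ^+ (t - j))) => [j|c Pc].
  rewrite -[X in X.-homog](_ : (1 * j + (t - j)) = t)%N; last by have := ltn_ord j; lia.
  by apply: dhomogM; [apply: form_exp; apply: form_lform|apply: form_Xn].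
suff all m : forall j : 'I_t.+1, (j <= m)%N -> c j = 0 by move=> j; apply: (all j).
elim/ltn_ind: m => m IH j le_j; have [lt|le] := ltnP j m.
  exact: (IH j).
have c0 l' : (l' < j)%N -> c (inord l') = 0.
  move=> lt; apply: (IH l'); first by apply: leq_trans lt le_j.
  by rewrite inordK //; have := ltn_ord j; lia.
have c0' (j' : 'I_t.+1) : (j' < j)%N -> c j' = 0.
  by move=> lt; have := c0 j' lt; rewrite inord_val.
have : P (l ^+ j * \sum_(i0 < t.+1) (if (i0 < j)%N then 0 else c i0 *: (l ^+ (i0 - j) * 'X_i ^+ (t - i0)))).
  rewrite mulr_sumr.
  rewrite (eq_bigr (fun i0 : 'I_t.+1 => c i0 *: (l ^+ i0 * 'X_i ^+ (t - i0)))) // => i0 _.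
  case: ltnP => [lt|le']; first by rewrite c0' // scale0r mulr0.
  by rewrite -scalerAr mulrA -exprD subnKC.
move=> /(point_mem_mull pP (point_notinX pP nv)) /Pw'.
rewrite (bigD1 j) //= ltnn subnn expr0 mul1r addrC => H.
have : w' (c j *: 'X_i ^+ (t - j)).
  apply: (hideal_cancel_add hw' _ H); apply: hideal_sum => // i0 ne'.
  case: ltnP => [_|le']; first exact: hideal0.
  apply: hideal_scale => //; apply: hidealMr => //.
  have -> : (i0 - j = (i0 - j).-1.+1)%N.
    by rewrite prednK // subn_gt0 ltn_neqAle le' andbT eq_sym.
  by rewrite exprS; apply: hidealMr.
have [->//|cn0] := eqVneq (c j) 0 => w'c; case: (point_notinX pw' (n := t - j) ni).
have -> : 'X_i ^+ (t - j) = (c j)^-1 *: (c j *: 'X_i ^+ (t - j)) :> S.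
  by rewrite scalerA mulVf // scale1r.
exact: hideal_scale.
Qed.

Definition linear_growth (h : nat -> nat) p := exists N, forall t, (N <= t)%N -> h t.+1 = (h t + p)%N.

(** The generic point of an irreducible curve of degree [p]: the second and third fields together
    say that the dimension is one, and the last gives the slope of the Hilbert polynomial. *)
Record curve_point P p : Prop := CurvePoint {
  curve_point_proj : proj_point P;
  curve_point_max : forall w w', proj_point w -> proj_point w' -> P `<=` w -> w <> P ->
    w `<=` w' -> w' = w;
  curve_point_nonclosed : exists w, [/\ proj_point w, P `<=` w & w <> P];
  curve_point_pos : (0 < p)%N;
  curve_point_growth : linear_growth (hilb P) p }.

Lemma hilb_le_add I t d g : homogeneous_ideal I -> g \is d.-homog ->
  (hilb I (t + d) <= hilb I t + hilb (ideal_add_form I g) (t + d))%N.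
Proof.
move=> hI hg; set J := ideal_add_form I g.
have hJ : homogeneous_ideal J by apply: ideal_add_form_homogeneous hg.
have IJ : I `<=` J by apply: ideal_add_form_sub.
have /eqP rJ := row_full_projm hI hJ IJ (t + d).
have [y E] : exists y, kermx (projm I J (t + d)) = y *m mulm I t (t + d) g.
  by apply: ker_projm_add_form => //; apply: mulmx_ker.
have : (\rank (kermx (projm I J (t + d))) <= hilb I t)%N.
  by rewrite E; apply: leq_trans (mxrankM_maxr _ _) _; apply: rank_leq_row.
by rewrite mxrank_ker rJ; have := hilb_le hI hJ IJ (t + d); lia.
Qed.

Lemma eventually_constant (h : nat -> nat) N :
  (forall t, (N <= t)%N -> (h t.+1 <= h t)%N) ->
  exists p M, forall t, (M <= t)%N -> h t = p.
Proof.
move=> dec; pose P v := `[< exists2 t, (N <= t)%N & h t = v >].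
have ex : exists v, P v by exists (h N); apply/asboolP; exists N.
case: (ex_minnP ex) => v /asboolP[M le_M hM] vmin; exists v, M => t le_t.
have le : (h t <= v)%N.
  rewrite -hM -(subnKC le_t); elim: (t - M)%N => [|s IH]; first by rewrite addn0.
  by rewrite addnS; apply: leq_trans IH; apply: dec; lia.
apply/eqP; rewrite eqn_leq le /=; apply: vmin; apply/asboolP; exists t => //; lia.
Qed.

Lemma linear_growthE h p N : (forall t, (N <= t)%N -> h t.+1 = (h t + p)%N) ->
  forall s, h (N + s)%N = (h N + s * p)%N.
Proof.
move=> hN; elim=> [|s IH]; first by rewrite addn0 mul0n addn0.
by rewrite addnS hN ?leq_addr // IH mulSn; lia.
Qed.

Lemma dimension1_point I P : component I P -> dimension P 1 ->
  (forall w w', proj_point w -> proj_point w' -> P `<=` w -> w <> P -> w `<=` w' -> w' = w) /\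
  exists w, [/\ proj_point w, P `<=` w & w <> P].
Proof.
move=> [[pP _] _] [[C [zC ltC]] no2]; split; last first.
  have [[p0 s0] [p1 s1]] := (zC 0%N isT, zC 1%N isT).
  have [sub nsub] := ltC 0%N isT.
  exists (C 1%N); split=> // E; apply: nsub; rewrite -> E.
  by have [_ +] := zC 0%N isT.
move=> w w' pw pw' Pw ne ww'; apply: contrapT => ne'; apply: no2.
have Pw' := subset_trans Pw ww'.
exists (fun i => if i is 0 then P else if i is 1 then w else w'); split.
  by case=> [|[|i]] _; split.
case=> [|[|//]] _; split=> // sub.
  by apply: ne; apply/seteqP.
by apply: ne'; apply/seteqP.
Qed.

(** There are finitely many components because each contributes at least [t.+1] to [hilb A], which
    grows with slope [a]. Comparing slopes gives only an inequality for the degrees; equality will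
    come out of the count of intersection points. *)
Theorem curve_components A a : reduced_curve A -> curve_degree A a ->
  exists k (P : 'I_k -> set S) (p : 'I_k -> nat),
  [/\ injective P /\ (forall Q, component A Q <-> exists i, P i = Q),
      (forall i, curve_point (P i) (p i)),
      (\sum_i p i <= a)%N & forall f, A f <-> forall i, P i f].
Proof.
move=> cA [c [N0 degA]]; have hA := curve_ideal cA.
have growA t : (N0 <= t)%N -> hilb A t.+1 = (hilb A t + a)%N.
  move=> le; have e1 := degA t (hilb A t) le; have e2 := degA t.+1 (hilb A t.+1) (leqW le).
  have {}e1 := e1 (proj2 (hilbert_functionP _ _ hA) erefl).
  have {}e2 := e2 (proj2 (hilbert_functionP _ _ hA) erefl).
  by lia.
have EA s := linear_growthE growA s.
have compD Q : component A Q -> dimension Q 1 by apply: curve_pure_dim1.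
have dimA Q (cQ : component A Q) := dimension1_point cQ (compD _ cQ).
have compz Q : component A Q -> zeros A Q by case.
have compinc Q Q' : component A Q -> component A Q' -> Q' `<=` Q -> Q' = Q.
  by move=> [_ minQ] [zQ' _] sub; apply: minQ.
have [k [P [injP PC]]] : exists k (P : 'I_k -> set S), injective P /\
    forall Q, component A Q <-> exists i, P i = Q.
  pose p k := `[< exists P : 'I_k -> set S, injective P /\ forall i, component A (P i) >].
  have ex : exists k, p k by exists 0%N; apply/asboolP; exists (fun=> set0); split=> -[].
  have le k : p k -> (k <= a)%N.
    move=> /asboolP [P [inj cP]].
    have [||d dP] := points_hilb_sum (J := A) (P := P) hA; first by move=> i; apply: compz.
      by move=> i j ne sub; case/eqP: ne; apply: inj; rewrite (compinc _ _ (cP i) (cP j) sub).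
    rewrite leqNgt; apply/negP => lt.
    have low t : (k * t.+1 <= hilb A (t + d))%N.
      apply: leq_trans (dP t).
      rewrite -[X in (X * _)%N]card_ord -sum_nat_const; apply: leq_sum => i _.
      have [_ [w [pw Pw ne]]] := dimA _ (cP i).
      by apply: hilb_nonclosed ne => //; case: (compz _ (cP i)).
    set h0 := hilb A (N0 + 0); pose t := (N0 + (hilb A N0 + a * d))%N.
    have := low t; have -> : (t + d = N0 + (hilb A N0 + a * d + d))%N by rewrite /t; lia.
    rewrite EA => H; have : (a.+1 * t.+1 <= k * t.+1)%N by rewrite leq_mul2r lt orbT.
    by rewrite /t; nia.
  case: (ex_maxnP ex le) => k /asboolP[P [inj cP]] maxk; exists k, P; split=> // Q.
  split=> [cQ|[i <-]//]; apply: contrapT => /forallNP no.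
  pose P' (i : 'I_k.+1) := if unlift ord0 i is Some j then P j else Q.
  suff : p k.+1 by move=> /maxk; rewrite ltnn.
  apply/asboolP; exists P'; split=> [i j|i]; rewrite /P'; last by case: unliftP.
  case: (unliftP ord0 i) => [i' ->|->]; case: (unliftP ord0 j) => [j' ->|->] //.
  - by move/inj ->.
  - by move=> E; case: (no i').
  - by move=> E; case: (no j').
have cP i : component A (P i) by apply/PC; exists i.
have zP i : zeros A (P i) by apply: compz.
have pP i : proj_point (P i) by case: (zP i).
have hP i := point_ideal (pP i).
have AP f : A f <-> forall i, P i f.
  split=> [Af i|Pf]; first by case: (zP i) => _; apply.
  apply: contrapT => nAf; have [w [zw nwf]] := curve_point_notin cA nAf.
  have [Q [cQ Qw]] := component_below zw; apply: nwf; apply: Qw.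
  by have [i <-] := proj1 (PC Q) cQ.
(* A plane [l0] containing no component cuts [A] in finitely many points, and a second plane [l1]
   misses these. Hence the Hilbert function of each section [(P i, l0)] is eventually
   non-increasing, so constant, and its final value is the degree of [P i]. *)
have [v0 nv0] := avoid_lform hP (fun i => lform_notin (pP i)).
set l0 := lform v0 in nv0; have hl0 : l0 \is 1.-homog by apply: form_lform.
set A0 := ideal_add_form A l0; have hA0 : homogeneous_ideal A0 by apply: ideal_add_form_homogeneous hl0.
have hilbA0 t : (N0 <= t)%N -> hilb A0 t.+1 = a.
  move=> le; have := hilb_add_form (t := t) hA hl0; rewrite addn1 growA //.
  move=> H; apply/eqP; rewrite -(eqn_add2l (hilb A t)) -H // => f _ /AP Pf.
  by apply/AP => i; apply: (point_mem_mull (pP i) (nv0 i)).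
have [||k0 [z [_ _ zA0 zall]]] := @finite_points A0 a hA0.
- by move=> t; exists (maxn t N0).+1; [lia|rewrite hilbA0 //; lia].
- move=> w w' [pw wA0] [pw' w'A0] ww'.
  have [Q [cQ Qw]] := component_below (conj pw (subset_trans (@ideal_add_form_sub K A l0) wA0)).
  have [i Ei] := proj1 (PC Q) cQ; have [mx _] := dimA _ cQ; apply: mx => // E.
  by apply: (nv0 i); rewrite Ei -E; apply: wA0; apply: ideal_add_form_gen.
have [v1 nv1] := avoid_lform (fun i => point_ideal (proj1 (zA0 i)))
                             (fun i => lform_notin (proj1 (zA0 i))).
set l1 := lform v1 in nv1; have hl1 : l1 \is 1.-homog by apply: form_lform.
have deg i : exists p, (0 < p)%N /\ linear_growth (hilb (P i)) p.
  set P0 := ideal_add_form (P i) l0.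
  have hP0 : homogeneous_ideal P0 by apply: ideal_add_form_homogeneous hl0.
  have [|N1 N1P] := no_point_hilb (ideal_add_form_homogeneous hP0 hl1).
    move=> w [pw sub].
    have [|j Ej] := zall w; last first.
      by apply: (nv1 j); rewrite Ej; apply: sub; apply: ideal_add_form_gen.
    split=> //; apply: subset_trans sub; apply: subset_trans (@ideal_add_form_sub K P0 l1).
    apply: ideal_add_form_min => //; last exact: ideal_add_form_gen.
    by apply: subset_trans (@ideal_add_form_sub K (P i) l0); case: (zP i).
  have [|p [M pM]] := @eventually_constant (fun t => hilb P0 t) N1.
    move=> t le; have := hilb_le_add t hP0 hl1.
    by rewrite addn1 [X in (_ + X)%N]N1P ?addn0 //; lia.
  have grow : forall t, (M <= t)%N -> hilb (P i) t.+1 = (hilb (P i) t + p)%N.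
    move=> t le; have := hilb_add_form (t := t) (hP i) hl0; rewrite addn1 => -> //.
      by rewrite -/P0 pM //; lia.
    by move=> f _; apply: point_mem_mull.
  exists p; split; last by exists M.
  rewrite lt0n; apply/eqP => p0; have [_ [w [pw Pw ne]]] := dimA _ (cP i).
  have := hilb_nonclosed (M + hilb (P i) M) (pP i) pw Pw ne.
  by rewrite (linear_growthE grow) p0; lia.
have [p pd] := choice deg; exists k, P, p; split=> // [i|].
  have [mx nc] := dimA _ (cP i).
  by split=> //; [case: (pd i)|case: (pd i)].
have [||d dP] := points_hilb_sum (J := A) (P := P) hA; first exact: zP.
  by move=> i j ne sub; case/eqP: ne; apply: injP; rewrite (compinc _ _ (cP i) (cP j) sub).
have [N NP] := choice (fun i => proj2 (pd i)).
pose M := (N0 + \sum_i N i)%N.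
have leN i : (N i <= M)%N by rewrite /M (bigD1 i) //=; lia.
have grow i s : hilb (P i) (M + s) = (hilb (P i) M + s * p i)%N.
  by apply: linear_growthE => t le; apply: NP; apply: leq_trans le.
have {dP} low s : (s * \sum_i p i <= hilb A (M + d) + s * a)%N.
  have le := dP (M + s)%N; rewrite (eq_bigr _ (fun i _ => grow i s)) in le.
  rewrite big_split /= -big_distrr /= in le.
  have -> : (hilb A (M + d) + s * a = hilb A (M + s + d))%N.
    rewrite addnAC; symmetry; apply: (linear_growthE (N := M + d)) => t le'.
    by apply: growA; rewrite /M in le'; lia.
  by apply: leq_trans le; apply: leq_addl.
rewrite leqNgt; apply/negP => lt; have := low (hilb A (M + d)).+1.
by nia.
Qed.

End CurveComponents.

(** * Pencils of planes on a curve *)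

Section BinaryForms.
Variable K : fieldType.
Local Notation S := {mpoly K[4]}.
Implicit Types (I J P Q w : set S) (f g l : S) (t d : nat).

Lemma row_free_mulm_form I t t' d g : homogeneous_ideal I -> g \is d.-homog -> t' = (t + d)%N ->
  (forall f, f \is t.-homog -> I (g * f) -> I f) -> row_free (mulm I t t' g).
Proof. by move=> hI hg -> nz; apply: row_free_mulm. Qed.

Lemma row_free_mulm_point P t t' d g : proj_point P -> g \is d.-homog -> t' = (t + d)%N ->
  ~ P g -> row_free (mulm P t t' g).
Proof.
move=> pP hg E ng; apply: (row_free_mulm_form (point_ideal pP) hg E) => f _.
exact: point_mem_mull.
Qed.

Lemma matrix_ncol0 m n (A B : 'M[K]_(m, n)) : n = 0%N -> A = B.
Proof. by move=> n0; move: A B; rewrite n0 => A B; apply/matrixP => i []. Qed.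

(** The vanishing quotient makes multiplication by [l] surjective, and equality of dimensions then
    makes it injective. This replaces cancellation for ideals [J] that are not prime. *)
Lemma row_free_mulm_hilb J t t' d l : homogeneous_ideal J -> l \is d.-homog -> t' = (t + d)%N ->
  hilb J t' = hilb J t -> hilb (ideal_add_form J l) t' = 0%N -> row_free (mulm J t t' l).
Proof.
move=> hJ hl -> E E0.
have [y Ey] : exists y, 1%:M = y *m mulm J t (t + d) l.
  apply: ker_projm_add_form => //; rewrite mul1mx.
  by apply: matrix_ncol0.
have full : row_full (mulm J t (t + d) l).
  by rewrite -sub1mx; apply/submxP; exists y.
by move: full => /eqP full; apply/eqP; rewrite full; exact: E.
Qed.

Lemma row_free_mulKl m n k (A : 'M[K]_(m, n)) (x : 'M[K]_(k, m)) :
  row_free A -> x *m A = 0 -> x = 0.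
Proof. by move=> fA E; apply: (row_free_inj fA); rewrite mul0mx. Qed.

Lemma row_free_trKl m n k (A : 'M[K]_(m, n)) (x : 'M[K]_(m, k)) :
  row_free A -> A^T *m x = 0 -> x = 0.
Proof.
move=> fA E; apply: trmx_inj; rewrite trmx0; apply: (row_free_mulKl fA).
by rewrite -[A]trmxK -trmx_mul E trmx0.
Qed.

(** For linear [f] and [g] this says that the axis of the pencil misses the curve. *)
Definition no_common_zero P f g := forall w, proj_point w -> P `<=` w -> w f -> ~ w g.

Lemma no_common_zero_sym P f g : no_common_zero P f g -> no_common_zero P g f.
Proof. by move=> no w pw Pw wg wf; apply: (no w). Qed.

Lemma no_common_zero_hilb P f g d e : homogeneous_ideal P -> f \is d.-homog -> g \is e.-homog ->
  no_common_zero P f g ->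
  exists N, forall t, (N <= t)%N -> hilb (ideal_add_form (ideal_add_form P f) g) t = 0%N.
Proof.
move=> hP hf hg no; have hPf := ideal_add_form_homogeneous hP hf.
apply: no_point_hilb; first exact: ideal_add_form_homogeneous hg.
move=> w [pw sub]; apply: (no w pw).
- by apply: subset_trans sub; apply: subset_trans (@ideal_add_form_sub K _ g); apply: ideal_add_form_sub.
- by apply: sub; apply: ideal_add_form_sub; apply: ideal_add_form_gen.
- by apply: sub; apply: ideal_add_form_gen.
Qed.

Section PencilOnPoint.
Variables (Q : set S) (q : nat) (cQ : curve_point Q q) (l0 l1 : S).
Hypotheses (hl0 : l0 \is 1.-homog) (hl1 : l1 \is 1.-homog) (axQ : no_common_zero Q l0 l1).
Let pQ := curve_point_proj cQ.
Let hQ := point_ideal pQ.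

Lemma pencil_point l : l \is 1.-homog -> exists w, [/\ proj_point w, Q `<=` w & w l].
Proof.
move=> hl; have [Ql|nQl] := pselect (Q l); first by exists Q; split.
by have [w [pw Qw ne]] := curve_point_nonclosed cQ; exact: (point_section pQ pw Qw ne hl nQl).
Qed.

Lemma pencil_notin0 : ~ Q l0.
Proof.
move=> Q0; have [w [pw Qw w1]] := pencil_point hl1.
by apply: (axQ pw Qw _ w1); apply: Qw.
Qed.

Lemma pencil_notin1 : ~ Q l1.
Proof.
move=> Q1; have [w [pw Qw w0]] := pencil_point hl0.
by apply: (axQ pw Qw w0); apply: Qw.
Qed.

(** At a point of the curve on [l1] only the term [l0 ^+ k] survives, and [l0] does not vanish
    there. *)
Lemma binary_form_notin k (c : nat -> K) : c k = 1 ->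
  ~ Q (\sum_(i < k.+1) c i *: (l0 ^+ i * l1 ^+ (k - i))).
Proof.
move=> ck Qd; have [w [pw Qw w1]] := pencil_point hl1; have hw := point_ideal pw.
move: Qd => /Qw; rewrite big_ord_recr /= ck subnn expr0 mulr1 scale1r => wd.
apply: (axQ pw Qw _ w1); apply: (point_exp pw (n := k)).
apply: (hideal_cancel_add hw _ wd); apply: hideal_sum => // i _.
have -> : (k - i = (k - i).-1.+1)%N by have := ltn_ord i; lia.
by rewrite exprS; apply: hideal_scale => //; apply: hidealM => //; apply: hidealMr.
Qed.

(* [R/Q] is torsion free over [K[l0, l1]]: Cayley-Hamilton turns the hypothesis into a
   binary form, monic in [l0], that kills the rows of [x]. *)
Lemma pencil_torsion_free n k (x : 'M[K]_(k, hilb Q n)) (kap : 'M[K]_k) :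
  x *m mulm Q n n.+1 l0 = kap *m x *m mulm Q n n.+1 l1 -> x = 0.
Proof.
case: k x kap => [|k] x kap E; first by apply/matrixP => -[].
have hi i (l : S) : l \is 1.-homog -> l ^+ i \is i.-homog.
  by move=> hl; have := form_exp i hl; rewrite mul1n.
have pow i : x *m mulm Q n (n + i) (l0 ^+ i) = kap ^+ i *m x *m mulm Q n (n + i) (l1 ^+ i).
  elim: i => [|i IH]; first by rewrite !expr0 mul1mx.
  have E1 (l : S) (hl : l \is 1.-homog) (j : nat) (l' : S) (hl' : l' \is 1.-homog) :
     mulm Q n (n + i.+1) (l * l' ^+ i) = mulm Q n (n + i) (l' ^+ i) *m mulm Q (n + i) (n + i.+1) l.
    by rewrite (mulmM hQ (d := i)) //; apply: hi.
  have E2 (l : S) (hl : l \is 1.-homog) (l' : S) :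
     mulm Q n (n + i.+1) (l' ^+ i * l) = mulm Q n n.+1 l *m mulm Q n.+1 (n + i.+1) (l' ^+ i).
    by rewrite (mulmM hQ (d := 1)) ?addn1.
  have Ek : kap ^+ i.+1 = kap ^+ i *m kap by rewrite exprSr.
  have El1 : mulm Q n (n + i.+1) (l1 ^+ i.+1) = mulm Q n n.+1 l1 *m mulm Q n.+1 (n + i.+1) (l1 ^+ i).
    by rewrite exprSr E2.
  have El0 : mulm Q n (n + i.+1) (l0 ^+ i.+1) = mulm Q n (n + i) (l0 ^+ i) *m mulm Q (n + i) (n + i.+1) l0.
    by rewrite exprS E1.
  rewrite El0 mulmxA IH -[LHS]mulmxA -E1 // [l0 * _]mulrC E2 // -[LHS]mulmxA [x *m _]mulmxA E.
  by rewrite Ek El1 !mulmxA.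
set chi := char_poly kap; pose N := (size chi).-1.
have chiN : chi`_N = 1 by apply/eqP/char_poly_monic.
pose d := \sum_(i < N.+1) chi`_i *: (l0 ^+ i * l1 ^+ (N - i)).
have hd : d \is N.-homog.
  apply: rpred_sum => i _; apply: rpredZ.
  have := dhomogM (hi i l0 hl0) (hi (N - i)%N l1 hl1).
  by rewrite subnKC // -ltnS.
have xd : x *m mulm Q n (n + N) d = 0.
  have mul_sum (r : seq 'I_N.+1) : mulm Q n (n + N) (\sum_(i <- r) chi`_i *: (l0 ^+ i * l1 ^+ (N - i))) =
      \sum_(i <- r) chi`_i *: mulm Q n (n + N) (l0 ^+ i * l1 ^+ (N - i)).
    elim: r => [|i r IH]; last by rewrite !big_cons mulm_linear IH.
    by rewrite !big_nil mulm_ideal //; apply: hideal0.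
  rewrite mul_sum mulmx_sumr.
  have step (i : 'I_N.+1) : x *m (chi`_i *: mulm Q n (n + N) (l0 ^+ i * l1 ^+ (N - i))) =
      (chi`_i *: kap ^+ i) *m (x *m mulm Q n (n + N) (l1 ^+ N)).
    have le : (i <= N)%N by have := ltn_ord i; lia.
    rewrite -scalemxAr -scalemxAl; congr (_ *: _).
    have E2 (g : S) : g \is i.-homog ->
        mulm Q n (n + N) (l1 ^+ (N - i) * g) = mulm Q n (n + i) g *m mulm Q (n + i) (n + N) (l1 ^+ (N - i)).
      by move=> hg; rewrite (mulmM hQ (d := i)).
    rewrite mulrC E2; last exact: hi.
    rewrite mulmxA pow -!mulmxA -E2; last exact: hi.
    by rewrite -exprD subnK.
  rewrite (eq_bigr _ (fun i _ => step i)) -mulmx_suml.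
  suff -> : \sum_(i < N.+1) chi`_i *: kap ^+ i = 0 by rewrite mul0mx.
  rewrite -[RHS](Cayley_Hamilton kap) -/chi -[in RHS](coefK chi) poly_def linear_sum.
  have -> : size chi = N.+1 by rewrite prednK // size_poly_gt0 monic_neq0 // char_poly_monic.
  by apply: eq_bigr => i _; rewrite linearZ /= rmorphXn /= horner_mx_X.
apply: (row_free_mulKl _ xd); apply: (row_free_mulm_point pQ hd) => //.
exact: binary_form_notin.
Qed.

End PencilOnPoint.

End BinaryForms.

(** * Sections of a curve by a form *)

Section FiniteSections.
Variable K : fieldType.
Local Notation S := {mpoly K[4]}.

Lemma ker_projm (I : set S) t t' d (g : S) m (x : 'M[K]_(m, _)) :
  homogeneous_ideal I -> g \is d.-homog -> t' = (t + d)%N ->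
  x *m projm I (ideal_add_form I g) t' = 0 -> exists y, x = y *m mulm I t t' g.
Proof. by move=> hI hg E; move: x; rewrite E => x; apply: ker_projm_add_form. Qed.

Lemma hilb_section (P : set S) p d (f : S) : curve_point P p -> f \is d.-homog -> ~ P f ->
  exists T, forall t, (T <= t)%N -> hilb (ideal_add_form P f) t = (d * p)%N.
Proof.
move=> cP hf nPf; have pP := curve_point_proj cP; have hP := point_ideal pP.
have [N NP] := curve_point_growth cP; exists (N + d)%N => t le.
have grow s : hilb P (N + s) = (hilb P N + s * p)%N by apply: linear_growthE.
have E := hilb_add_form (t := (t - d)%N) hP hf; rewrite subnK in E; last by lia.
have {}E := E (fun g _ => point_mem_mull pP nPf).
have E1 : hilb P t = (hilb P N + (t - N) * p)%N by rewrite -grow subnKC //; lia.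
have E2 : hilb P (t - d) = (hilb P N + (t - d - N) * p)%N by rewrite -grow subnKC //; lia.
have : ((t - N) * p = (t - d - N) * p + d * p)%N by rewrite -mulnDl; congr (_ * _)%N; lia.
by lia.
Qed.

Lemma row_free_section (P : set S) p d (f l : S) : curve_point P p -> f \is d.-homog ->
  ~ P f -> l \is 1.-homog -> no_common_zero P f l ->
  exists T, forall t, (T <= t)%N -> row_free (mulm (ideal_add_form P f) t t.+1 l).
Proof.
move=> cP hf nPf hl no; have hP := point_ideal (curve_point_proj cP).
have [T TP] := hilb_section cP hf nPf; have [N NP] := no_common_zero_hilb hP hf hl no.
exists (T + N)%N => t le; apply: (@row_free_mulm_hilb _ _ _ _ 1) => //.
- exact: ideal_add_form_homogeneous hf.
- by rewrite addn1.
- by rewrite !TP //; lia.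
- by apply: NP; lia.
Qed.

End FiniteSections.

(** * The fibre product of two curves over a pencil, and its regular elements *)

Section TwoCurves.
Variable K : fieldType.
Local Notation S := {mpoly K[4]}.
Variables (P Q : set S) (p q : nat) (cP : curve_point P p) (cQ : curve_point Q q).
Variables (l0 l1 : S) (hl0 : l0 \is 1.-homog) (hl1 : l1 \is 1.-homog).
Hypotheses (axP : no_common_zero P l0 l1) (axQ : no_common_zero Q l0 l1).
Let pP := curve_point_proj cP.
Let pQ := curve_point_proj cQ.
Let hP := point_ideal pP.
Let hQ := point_ideal pQ.

(* ['M_(hilb P t, hilb Q n)] is the part of bidegree [(t, n)] of [S/P (x) S/Q], and
   [bimul g g'] is the multiplication by [g (x) g']. *)
Local Notation U t n := 'M[K]_(hilb P t, hilb Q n).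

Definition bimul t n t' n' (g g' : S) (x : U t n) : U t' n' :=
  (mulm P t t' g)^T *m x *m mulm Q n n' g'.

Lemma bimul_comp t n d d' t' n' t'' n'' g g' g2 g2' (x : U t n) :
  g \is d.-homog -> g' \is d'.-homog -> t' = (t + d)%N -> n' = (n + d')%N ->
  bimul t'' n'' g2 g2' (bimul t' n' g g' x) = bimul t'' n'' (g2 * g) (g2' * g') x.
Proof.
move=> hg hg' Et En; rewrite /bimul -(mulmM hP t'' g2 hg Et) -(mulmM hQ n'' g2' hg' En).
by rewrite trmx_mul !mulmxA.
Qed.

Lemma bimul_is_linear t n t' n' g g' : linear (@bimul t n t' n' g g').
Proof. by move=> c x y; rewrite /bimul mulmxDr mulmxDl -scalemxAr -scalemxAl. Qed.
HB.instance Definition _ t n t' n' g g' :=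
  GRing.isLinear.Build K (U t n) (U t' n') _ (@bimul t n t' n' g g') (@bimul_is_linear t n t' n' g g').

Lemma bimul_linearl t n t' n' g' (x : U t n) c g1 g2 :
  bimul t' n' (c *: g1 + g2) g' x = c *: bimul t' n' g1 g' x + bimul t' n' g2 g' x.
Proof. by rewrite /bimul mulm_linear linearP /= !mulmxDl -!scalemxAl. Qed.

Lemma bimul_linearr t n t' n' g (x : U t n) c g1 g2 :
  bimul t' n' g (c *: g1 + g2) x = c *: bimul t' n' g g1 x + bimul t' n' g g2 x.
Proof. by rewrite /bimul mulm_linear mulmxDr -scalemxAr. Qed.

(* Multiplication by [l1 (x) m - m (x) l1]: for [m = l0] its cokernel is the fibre product of
   the two curves over the pencil of planes through [l0 = l1 = 0]. *)
Definition wedge m t n (x : U t n) : U t.+1 n.+1 :=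
  bimul t.+1 n.+1 l1 m x - bimul t.+1 n.+1 m l1 x.

Lemma wedge_is_linear m t n : linear (@wedge m t n).
Proof.
move=> c x y; rewrite /wedge (@bimul_is_linear _ _ _ _ l1 m c x y).
by rewrite (@bimul_is_linear _ _ _ _ m l1 c x y) scalerBr opprD addrACA.
Qed.
HB.instance Definition _ m t n :=
  GRing.isLinear.Build K (U t n) (U t.+1 n.+1) _ (@wedge m t n) (@wedge_is_linear m t n).

Lemma wedge_linear t n (x : U t n) c m m' :
  wedge (c *: m + m') x = c *: wedge m x + wedge m' x.
Proof. by rewrite /wedge bimul_linearl bimul_linearr scalerBr opprD addrACA. Qed.

Lemma wedge_bimul m t n t' n' d d' g g' (x : U t n) : m \is 1.-homog ->
  g \is d.-homog -> g' \is d'.-homog -> t' = (t + d)%N -> n' = (n + d')%N ->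
  wedge m (bimul t' n' g g' x) = bimul t'.+1 n'.+1 g g' (wedge m x).
Proof.
move=> hm hg hg' Et En; rewrite /wedge linearB /=.
have e1 : forall k, k.+1 = (k + 1)%N by move=> k; rewrite addn1.
rewrite !(bimul_comp _ _ _ _ _ hg hg' Et En).
rewrite (bimul_comp _ _ _ _ _ hl1 hm (e1 t) (e1 n)) (bimul_comp _ _ _ _ _ hm hl1 (e1 t) (e1 n)).
by rewrite [l1 * g]mulrC [m * g']mulrC [l1 * g']mulrC [m * g]mulrC.
Qed.

Lemma wedge_comm m m' t n (x : U t n) : m \is 1.-homog -> m' \is 1.-homog ->
  wedge m (wedge m' x) = wedge m' (wedge m x).
Proof.
move=> hm hm'; have e1 : forall k, k.+1 = (k + 1)%N by move=> k; rewrite addn1.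
rewrite {2}/wedge linearB /= !(wedge_bimul (d := 1) (d' := 1)) // -/(wedge m' _).
Qed.

(** A right inverse [C] of [A1] converts the pair of rectangular matrices into one square matrix,
    the [kap] of [pencil_torsion_free]. *)
Lemma pencil_injective m n (A1 A0 : 'M[K]_(m, n)) k (x : 'M[K]_(m, hilb Q k)) : row_free A1 ->
  A1^T *m x *m mulm Q k k.+1 l0 = A0^T *m x *m mulm Q k k.+1 l1 -> x = 0.
Proof.
move=> /row_freeP[C A1C] E.
apply: (pencil_torsion_free cQ hl0 hl1 axQ (kap := (A0 *m C)^T)).
have CA : C^T *m A1^T = 1%:M by rewrite -trmx_mul A1C trmx1.
by rewrite -[x in LHS]mul1mx -CA -!mulmxA [A1^T *m (_ *m _)]mulmxA E trmx_mul !mulmxA.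
Qed.

Lemma pencil_injectiver m n (A1 A0 : 'M[K]_(m, n)) k (x : 'M[K]_(m, hilb P k)) : row_free A1 ->
  A1^T *m x *m mulm P k k.+1 l0 = A0^T *m x *m mulm P k k.+1 l1 -> x = 0.
Proof.
move=> /row_freeP[C A1C] E.
apply: (pencil_torsion_free cP hl0 hl1 axP (kap := (A0 *m C)^T)).
have CA : C^T *m A1^T = 1%:M by rewrite -trmx_mul A1C trmx1.
by rewrite -[x in LHS]mul1mx -CA -!mulmxA [A1^T *m (_ *m _)]mulmxA E trmx_mul !mulmxA.
Qed.

Let rfP l t : l \is 1.-homog -> ~ P l -> row_free (mulm P t t.+1 l).
Proof. by move=> hl nl; apply: (row_free_mulm_point pP hl) => //; rewrite addn1. Qed.

Let rfQ l t : l \is 1.-homog -> ~ Q l -> row_free (mulm Q t t.+1 l).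
Proof. by move=> hl nl; apply: (row_free_mulm_point pQ hl) => //; rewrite addn1. Qed.

Let nP1 : ~ P l1. Proof. exact: (pencil_notin1 cP hl0 axP). Qed.
Let nQ1 : ~ Q l1. Proof. exact: (pencil_notin1 cQ hl0 axQ). Qed.

Lemma wedge_inj t n (x : U t n) : wedge l0 x = 0 -> x = 0.
Proof.
move=> /eqP; rewrite /wedge subr_eq0 /bimul => /eqP E.
exact: (pencil_injective (rfP t hl1 nP1) E).
Qed.

Section Large.
Variables (d : nat) (f : S) (hf : f \is d.-homog) (Pf : P f) (nQf : ~ Q f).
Variable (T : nat).
Hypothesis rfQf : forall t, (T <= t)%N -> row_free (mulm (ideal_add_form Q f) t t.+1 l1).
Hypothesis rfP1 : forall t, (T <= t)%N -> row_free (mulm (ideal_add_form P l1) t t.+1 l0).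

(** [1 (x) f] is regular on the cokernel of [wedge l0]: modulo [f] on the second factor, [l1] is
    still injective in large degree, and torsion-freeness of S/P forces [x] to vanish there. So [x]
    is a multiple of [1 (x) f], which cancels modulo the prime [Q]. *)
Lemma wedge_cancel_form t n (x : U t (n + d)) (w : U t.+1 n.+1) : (T <= n)%N ->
  wedge l0 x = w *m mulm Q n.+1 (n + d).+1 f -> exists x', w = wedge l0 x'.
Proof.
move=> le E; set J := ideal_add_form Q f.
have hJ : homogeneous_ideal J by apply: ideal_add_form_homogeneous hf.
have QJ : Q `<=` J by apply: ideal_add_form_sub.
have Jf : J f by apply: ideal_add_form_gen.
set pm := projm Q J.
have E1 : (mulm P t t.+1 l1)^T *m (x *m pm (n + d)%N) *m mulm J (n + d) (n + d).+1 l0 =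
          (mulm P t t.+1 l0)^T *m (x *m pm (n + d)%N) *m mulm J (n + d) (n + d).+1 l1.
  apply/eqP; rewrite -subr_eq0 -!mulmxA !projm_mulm // !mulmxA -mulmxBl.
  by rewrite -/(bimul t.+1 (n + d).+1 l1 l0 x) -/(bimul t.+1 (n + d).+1 l0 l1 x) -/(wedge l0 x) E
     -mulmxA -projm_mulm // mulm_ideal // !mulmx0.
have x0 : x *m pm (n + d)%N = 0.
  apply: trmx_inj; rewrite trmx0.
  apply: (@pencil_injectiver _ _ (mulm J (n + d) (n + d).+1 l1) (mulm J (n + d) (n + d).+1 l0)).
    by apply: rfQf; lia.
  apply: trmx_inj; rewrite !trmx_mul !trmxK !mulmxA in E1 *.
  by rewrite -!mulmxA in E1 *; rewrite E1.
have [y Ey] := ker_projm_add_form hQ hf x0; exists y.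
have rf : row_free (mulm Q n.+1 (n + d).+1 f) by apply: (row_free_mulm_point pQ hf).
apply: (row_free_inj rf); rewrite -E Ey.
have -> : y *m mulm Q n (n + d) f = bimul t (n + d) 1 f y.
  by rewrite /bimul -[1]mpolyC1 mulm_const // trmx1 mul1mx.
rewrite (wedge_bimul y hl0 (dhomog1 _ _) hf) ?addn0 //.
by rewrite /bimul -[1]mpolyC1 mulm_const // trmx1 mul1mx.
Qed.

(** [l1 (x) 1] is regular on the cokernel of [wedge l0]: modulo [l1] on the first factor the wedge
    becomes [- l0 (x) l1], a product of two injective maps in large degree. *)
Lemma wedge_cancel_l1 t n (x : U t.+1 n) (w : U t.+1 n.+1) : (T <= t)%N ->
  wedge l0 x = (mulm P t.+1 t.+2 l1)^T *m w -> exists x' : U t n, w = wedge l0 x'.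
Proof.
move=> le E; set J := ideal_add_form P l1.
have hJ : homogeneous_ideal J by apply: ideal_add_form_homogeneous hl1.
have PJ : P `<=` J by apply: ideal_add_form_sub.
have J1 : J l1 by apply: ideal_add_form_gen.
set pm := projm P J.
have E1 : (mulm J t.+1 t.+2 l0)^T *m ((pm t.+1)^T *m x) *m mulm Q n n.+1 l1 = 0.
  rewrite !mulmxA -trmx_mul projm_mulm // trmx_mul -[_ *m _ *m x]mulmxA -mulmxA.
  rewrite -/(bimul t.+2 n.+1 l0 l1 x).
  have -> : bimul t.+2 n.+1 l0 l1 x = bimul t.+2 n.+1 l1 l0 x - wedge l0 x.
    by rewrite /wedge opprB addrC subrK.
  rewrite E /bimul -mulmxA -mulmxBr mulmxA -trmx_mul -projm_mulm // mulm_ideal //.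
  by rewrite mulmx0 trmx0 mul0mx.
have x0 : (pm t.+1)^T *m x = 0.
  apply: (row_free_trKl (rfP1 (t := t.+1) _)); first by lia.
  exact: (row_free_mulKl (rfQ n hl1 nQ1) E1).
have E2 : x^T *m projm P J t.+1 = 0.
  by apply: trmx_inj; rewrite trmx_mul trmxK trmx0.
have [|y Ey] := ker_projm (t := t) hP hl1 _ E2; first by rewrite addn1.
exists y^T; have Ex : x = (mulm P t t.+1 l1)^T *m y^T by rewrite -trmx_mul -Ey trmxK.
apply/eqP; rewrite -subr_eq0; apply/eqP.
apply: (row_free_trKl (rfP t.+1 hl1 nP1)).
rewrite mulmxBr -E Ex.
have e1 k : k.+1 = (k + 1)%N by rewrite addn1.
have -> : (mulm P t t.+1 l1)^T *m y^T = bimul t.+1 n l1 1 y^T.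
  by rewrite /bimul -[1]mpolyC1 mulm_const // mulmx1.
rewrite (wedge_bimul _ hl0 hl1 (dhomog1 _ _)) ?addn0 //.
by rewrite /bimul -[1]mpolyC1 mulm_const // mulmx1 subrr.
Qed.

(* An element killed by all [l1 (x) m - m (x) l1] is killed by [l1^d (x) f - f (x) l1^d], which
   acts as [l1^d (x) f] because [f] vanishes on the first curve. *)
Lemma wedge_common_kernel t n (y : U t.+1 n.+1) : (T <= t)%N -> (T <= n)%N ->
  (forall m : S, m \is 1.-homog -> exists x, wedge m y = wedge l0 x) ->
  exists x : U t n, y = wedge l0 x.
Proof.
move=> leT leN ker; have e1 k : k.+1 = (k + 1)%N by rewrite addn1.
have hl1e e : l1 ^+ e \is e.-homog by have := form_exp e hl1; rewrite mul1n.
pose good e t' n' (g : S) := exists x : U t' n',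
  bimul t'.+1 n'.+1 (l1 ^+ e) g y - bimul t'.+1 n'.+1 g (l1 ^+ e) y = wedge l0 x.
have good_lin e t' n' c g1 g2 : good e t' n' g1 -> good e t' n' g2 -> good e t' n' (c *: g1 + g2).
  move=> [x1 E1] [x2 E2]; exists (c *: x1 + x2).
  rewrite bimul_linearl bimul_linearr (@wedge_is_linear l0 _ _ c x1 x2) -E1 -E2 scalerBr opprD.
  by rewrite addrACA.
have good0 e t' n' : good e t' n' 0.
  exists 0; rewrite linear0 /bimul (mulm_ideal hP _ _ (hideal0 hP)) (mulm_ideal hQ _ _ (hideal0 hQ)).
  by rewrite trmx0 !mul0mx !mulmx0 subrr.
have claim e : forall t' n' g, t' = (t + e)%N -> n' = (n + e)%N -> g \is e.-homog -> good e t' n' g.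
  elim: e => [|e IH] t' n' g Et En hg.
    rewrite !addn0 in Et En; subst t' n'.
    have -> : g = (g@_0%MM)%:MP.
      apply/mpolyP => m; rewrite mcoeffC; case: (eqVneq m 0%MM) => [->|ne]; first by rewrite mulr1.
      by rewrite mulr0; apply: (dhomog_nemf_coeff hg); rewrite mdeg_eq0.
    exists 0; rewrite linear0 expr0 /bimul -[1]mpolyC1 !mulm_const //.
    by rewrite !tr_scalar_mx !mul_scalar_mx !mul_mx_scalar scale1r scale1r subrr.
  rewrite addnS in Et; rewrite addnS in En; subst t' n'.
  have goodM m g' : m \is 1.-homog -> g' \is e.-homog -> good e.+1 (t + e).+1 (n + e).+1 (m * g').
    move=> hm hg'; have [xm Em] := ker m hm; have [x Ex] := IH _ _ g' erefl erefl hg'.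
    exists (bimul (t + e).+1 (n + e).+1 (l1 ^+ e) g' xm + bimul (t + e).+1 (n + e).+1 m l1 x).
    rewrite linearD /= (wedge_bimul xm hl0 (hl1e e) hg') ?addSn // -Em.
    rewrite (wedge_bimul x hl0 hm hl1) -?e1 // -Ex /wedge !linearB /=.
    rewrite (bimul_comp _ _ _ _ y hl1 hm (e1 _) (e1 _)) (bimul_comp _ _ _ _ y hm hl1 (e1 _) (e1 _)).
    rewrite (bimul_comp _ _ _ _ y (hl1e e) hg') ?addSn // (bimul_comp _ _ _ _ y hg' (hl1e e)) ?addSn //.
    rewrite addrA -[LHS]/(_ - _) exprSr.
    rewrite [m * l1 ^+ e]mulrC [l1 * g']mulrC subrK; congr (_ - _).
      by rewrite [m * g']mulrC.
    by rewrite [l1 * _]mulrC.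
  rewrite [g]mpolyE big_seq; elim/big_rec: _ => [|mm x mg IHx]; first exact: good0.
  apply: good_lin => //; have mm_deg : mdeg mm = e.+1 by apply: (dhomogP _ _ _ hg _ mg).
  have [i mi] : exists i, mm i != 0%N.
    apply: contrapT => /forallNP z; move: mm_deg; rewrite mdegE big1 // => i _.
    by apply/eqP/negPn/negP/z.
  have Emm : mm = (U_(i) + (mm - U_(i)))%MM by rewrite addmC submK // lep1mP.
  rewrite Emm mpolyXD; apply: goodM; first exact: form_X.
  by rewrite dhomogX; move: mm_deg; rewrite {1}Emm mdegD mdeg1 => /eqP; rewrite add1n eqSS.
have [x Ex] := claim d _ _ f erefl erefl hf.
have Efl : bimul (t + d).+1 (n + d).+1 f (l1 ^+ d) y = 0.
  by rewrite /bimul mulm_ideal // trmx0 !mul0mx.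
rewrite Efl subr0 in Ex.
have [x1 Ex1] := wedge_cancel_form leN (esym Ex).
elim: (d) x1 Ex1 => [|e IH] x1 Ex1.
  move: x1 Ex1; rewrite addn0 expr0 -[1]mpolyC1 mulm_const // trmx1 mul1mx => x1 ->.
  by exists x1.
move: x1 Ex1; rewrite addnS => x1 Ex1.
have E2 : (mulm P t.+1 (t + e).+2 (l1 ^+ e.+1))^T *m y =
    (mulm P (t + e).+1 (t + e).+2 l1)^T *m ((mulm P t.+1 (t + e).+1 (l1 ^+ e))^T *m y).
  by rewrite mulmxA -trmx_mul (mulmM hP _ _ (hl1e e)) ?addSn // exprS.
rewrite E2 in Ex1.
have [|x2 Ex2] := wedge_cancel_l1 _ (esym Ex1); first by lia.
exact: IH Ex2.
Qed.

Variables (m2 m3 : S) (hm2 : m2 \is 1.-homog) (hm3 : m3 \is 1.-homog).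
Hypothesis span : forall m : S, m \is 1.-homog -> exists c : K * K * K * K,
  m = c.1.1.1 *: l0 + (c.1.1.2 *: l1 + (c.1.2 *: m2 + c.2 *: m3)).

(** The condition in [wedge_common_kernel] is linear in [m] and automatic for the two forms of the
    pencil: [wedge l1] is zero, and [wedge l0 y] is in the image by definition. *)
Lemma wedge_kernel23 t n (y : U t.+1 n.+1) : (T <= t)%N -> (T <= n)%N ->
  (exists x, wedge m2 y = wedge l0 x) -> (exists x, wedge m3 y = wedge l0 x) ->
  exists x : U t n, y = wedge l0 x.
Proof.
move=> leT leN [x2 E2] [x3 E3]; apply: wedge_common_kernel => // m hm.
have [[[[c0 c1] c2] c3] /= ->] := span hm.
have w1 : wedge l1 y = 0 by rewrite /wedge subrr.
exists (c0 *: y + (c2 *: x2 + c3 *: x3)).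
rewrite wedge_linear [in LHS]wedge_linear w1 scaler0 add0r -[c3 *: m3]addr0 wedge_linear wedge_linear.
have w0 : wedge 0 y = 0.
  by have := wedge_linear y (-1) l0 l0; rewrite scaleN1r addNr scaleN1r addNr.
by rewrite w0 addr0 E2 E3 !(@wedge_is_linear l0) linearZ.
Qed.

(** Independence of eigenvectors for distinct eigenvalues: on the cokernel of [wedge l0], [wedge m2]
    acts on [y i] as [- mu i] times [wedge m3]. Applying [wedge (mu k *: m3 + m2)] to a relation
    kills its last term and leaves one between the [wedge m3 (y i)], one bidegree higher; these are
    nonzero in the cokernel by [wedge_kernel23]. *)
Lemma wedge_eigen k : forall t n (y : 'I_k -> U t.+1 n.+1) (mu : 'I_k -> K),
  (T <= t)%N -> (T <= n)%N -> injective mu ->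
  (forall i, exists x, wedge (mu i *: m3 + m2) (y i) = wedge l0 x) ->
  (forall i (x : U t n), y i <> wedge l0 x) ->
  forall (c : 'I_k -> K) (x : U t n), \sum_i c i *: y i = wedge l0 x -> forall i, c i = 0.
Proof.
elim: k => [|k IH] t n y mu leT leN inj eig nim c x Ec; first by case.
pose w (i : 'I_k) := widen_ord (leqnSn k) i.
pose mk := mu ord_max *: m3 + m2.
have hmk : mk \is 1.-homog by apply: rpredD => //; apply: rpredZ.
have cw : forall i, c (w i) * (mu ord_max - mu (w i)) = 0.
  have [e eP] := choice eig.
  apply: (IH t.+1 n.+1 (fun i => wedge m3 (y (w i))) (fun i => mu (w i)) _ _ _ _ _
     (fun i => c (w i) * (mu ord_max - mu (w i)))
     (wedge mk x - \sum_i c i *: e i)) => //.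
  - by rewrite ltnW.
  - by rewrite ltnW.
  - by move=> i j /inj /(congr1 val) /= E; apply: val_inj.
  - move=> i; exists (wedge m3 (e (w i))).
    rewrite wedge_comm //; last by apply: rpredD => //; apply: rpredZ.
    by rewrite eP wedge_comm.
  - move=> i x' E; have [|x'' Ex] := @wedge_kernel23 t n (y (w i)) leT leN _ (ex_intro _ x' E).
      exists (e (w i) - mu (w i) *: x'); rewrite linearB linearZ /= -E -eP wedge_linear.
      by rewrite addrC addKr.
    by apply: (nim (w i) x'').
  - rewrite linearB /= wedge_comm // -Ec linear_sum linear_sum /= -sumrB.
    rewrite [RHS]big_ord_recr /= linearZ /= linearZ /= -eP -/mk subrr addr0.
    apply: eq_bigr => i _; rewrite !linearZ /= -eP /mk !wedge_linear -scalerDr.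
    by rewrite opprD addrACA subrr addr0 -scalerBl scalerA.
have c0 i : c (w i) = 0.
  have /eqP := cw i; rewrite mulf_eq0 => /orP[/eqP//|].
  rewrite subr_eq0 => /eqP /inj /(congr1 val) /= E.
  by have := ltn_ord i; rewrite -E ltnn.
have cmax : c ord_max = 0.
  have [//|ne] := eqVneq (c ord_max) 0.
  case: (nim ord_max ((c ord_max)^-1 *: x)); rewrite linearZ /= -Ec big_ord_recr /=.
  by rewrite big1 => [|i _]; rewrite ?c0 ?scale0r // add0r scalerA mulVf // scale1r.
move=> i; case: (unliftP ord_max i) => [j ->|->//].
by rewrite -(c0 j); congr c; apply: val_inj; rewrite /= /bump leqNgt ltn_ord.
Qed.

Hypothesis Kinf : injective (fun n : nat => n%:R : K).

(** If every [mu] failed, the scalars [0, 1, 2, ...] would give more independent eigenvectors than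
    the dimension of one bidegree allows. *)
Lemma wedge_regular t n : (T <= t)%N -> (T <= n)%N ->
  exists mu : K, forall y : U t.+1 n.+1,
    (exists x, wedge (mu *: m3 + m2) y = wedge l0 x) -> exists x : U t n, y = wedge l0 x.
Proof.
move=> leT leN; apply: contrapT => /forallNP none.
have bad (i : nat) : exists y : U t.+1 n.+1,
    (exists x, wedge (i%:R *: m3 + m2) y = wedge l0 x) /\ forall x : U t n, y <> wedge l0 x.
  have /existsNP[y /not_implyP[ey ny]] := none i%:R; exists y; split=> // x E.
  by apply: ny; exists x.
have [y yP] := choice bad; pose u := (hilb P t.+1 * hilb Q n.+1)%N.
pose M : 'M[K]_(u.+1, u) := \matrix_i mxvec (y i).
have : row_free M.
  rewrite -kermx_eq0; apply/eqP/row_matrixP => r; rewrite row0; set v := row r _.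
  have : v *m M = 0 by apply/sub_kermxP; apply: row_sub.
  rewrite mulmx_sum_row => E; apply/rowP => i; rewrite [RHS]mxE.
  apply: (@wedge_eigen u.+1 t n (fun i => y i) (fun i => i%:R) leT leN _ _ _ (fun i => v 0 i) 0).
  - by move=> i1 i2 /Kinf; apply: val_inj.
  - by move=> j; case: (yP j).
  - by move=> j; case: (yP j).
  - rewrite linear0; apply: (can_inj mxvecK); rewrite linear0 linear_sum -[RHS]E.
    by apply: eq_bigr => j _; rewrite linearZ /= rowK.
by rewrite /row_free => /eqP E; have := rank_leq_col M; rewrite E ltnn.
Qed.

(** Koszul complex of the two wedges, from bidegree [(t, n)] through two copies of [(t.+1, n.+1)] to
    [(t.+2, n.+2)]: exactness in the middle bounds the final cokernel by a second difference, and
    [tau] factors through that cokernel. *)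
Lemma wedge_dim t n : (T <= t)%N -> (T <= n)%N -> exists mu : K,
  forall D (tau : {linear U t.+2 n.+2 -> 'rV[K]_D}),
    (forall v, exists x, tau x = v) ->
    (forall x : U t.+1 n.+1, tau (wedge l0 x) = 0) ->
    (forall x : U t.+1 n.+1, tau (wedge (mu *: m3 + m2) x) = 0) ->
  (D + (hilb P t.+1 * hilb Q n.+1).*2 <= hilb P t.+2 * hilb Q n.+2 + hilb P t * hilb Q n)%N.
Proof.
move=> leT leN; have [mu reg] := wedge_regular leT leN; exists mu => D tau sur tau0 taum.
set m := mu *: m3 + m2; have hm : m \is 1.-homog by apply: rpredD => //; apply: rpredZ.
set u0 := (hilb P t * hilb Q n)%N; set u1 := (hilb P t.+1 * hilb Q n.+1)%N.
set u2 := (hilb P t.+2 * hilb Q n.+2)%N.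
pose L0 : 'M[K]_(u1, u2) := lin_mx (@wedge l0 t.+1 n.+1).
pose Lm : 'M[K]_(u1, u2) := lin_mx (@wedge m t.+1 n.+1).
pose G := col_mx L0 Lm.
pose H : 'M[K]_(u0, u1 + u1) := row_mx (- lin_mx (@wedge m t n)) (lin_mx (@wedge l0 t n)).
(* In a relation [(y1, y2)] the choice of [mu] puts [y2] in the image of [wedge l0]; injectivity of
   [wedge l0] then determines [y1]. *)
have kerG : (kermx G <= H)%MS.
  apply/row_subP => r; set v := row r _.
  have : v *m G = 0 by apply/sub_kermxP; apply: row_sub.
  rewrite -[v]hsubmxK mul_row_col -[lsubmx v]vec_mxK -[rsubmx v]vec_mxK.
  set y1 := vec_mx (lsubmx v); set y2 := vec_mx (rsubmx v).
  rewrite !mul_vec_lin -linearD /= => /(congr1 vec_mx); rewrite mxvecK linear0 => E.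
  have [|w Ew] := reg y2.
    by exists (- y1); rewrite linearN /=; apply/eqP; rewrite -addr_eq0 addrC -E eqxx.
  have Ey1 : y1 = - wedge m w.
    apply/eqP; rewrite -subr_eq0 opprK; apply/eqP; apply: wedge_inj.
    by rewrite linearD /= [wedge l0 (wedge m w)]wedge_comm // -Ew -E.
  apply/submxP; exists (mxvec w); rewrite mul_mx_row mulmxN !mul_vec_lin Ey1 Ew.
  by rewrite linearN.
have rG : (u1 + u1 <= \rank G + u0)%N.
  have := mxrank_ker G; have := mxrankS kerG; have := rank_leq_row H.
  by have := rank_leq_row G; lia.
pose Tm : 'M[K]_(u2, D) := \matrix_(i, j) tau (vec_mx (delta_mx 0 i)) 0 j.
have TmE x : mxvec x *m Tm = tau x.
  rewrite -[X in tau X]mxvecK.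
  exact: (mul_row_lin (tau \o vec_mx : {linear 'rV[K]_u2 -> 'rV[K]_D})).
have rT : \rank Tm = D.
  apply/eqP; rewrite -/(row_full Tm) -sub1mx; apply/row_subP => i; rewrite row1.
  by have [x Ex] := sur (delta_mx 0 i); apply/submxP; exists (mxvec x); rewrite TmE Ex.
have GT : G *m Tm = 0.
  rewrite /G mul_col_mx; apply/eqP; rewrite col_mx_eq0; apply/andP; split; apply/eqP/row_matrixP => i.
    rewrite row_mul rowE row0 -[delta_mx 0 i]vec_mxK mul_vec_lin TmE; exact: tau0.
  rewrite row_mul rowE row0 -[delta_mx 0 i]vec_mxK mul_vec_lin TmE; exact: taum.
by have := mulmx0_rank_max GT; rewrite rT; lia.
Qed.

End Large.
End TwoCurves.

(** * The Bezout bound for bilinear functions *)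

Section BilinearForms.
Variable K : fieldType.
Hypothesis Kinf : injective (fun n : nat => n%:R : K).
Local Notation S := {mpoly K[4]}.
Variables (P Q : set S) (p q : nat) (cP : curve_point P p) (cQ : curve_point Q q).
Variables (l0 l1 : S) (hl0 : l0 \is 1.-homog) (hl1 : l1 \is 1.-homog).
Hypotheses (axP : no_common_zero P l0 l1) (axQ : no_common_zero Q l0 l1).
Let pP := curve_point_proj cP.
Let pQ := curve_point_proj cQ.
Let hP := point_ideal pP.
Let hQ := point_ideal pQ.
Local Notation U t n := 'M[K]_(hilb P t, hilb Q n).

(** A linear map out of S/P (x) S/Q without reference to bidegrees; [induced] restricts it to one of
    them. *)
Record bilinear_mod h (b : S -> S -> 'rV[K]_h) : Prop := BilinearMod {
  bilinl : forall g c f f', b (c *: f + f') g = c *: b f g + b f' g;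
  bilinr : forall f c g g', b f (c *: g + g') = c *: b f g + b f g';
  bilin_idealP : forall f g, P f -> b f g = 0;
  bilin_idealQ : forall f g, Q g -> b f g = 0 }.

Section Induced.
Variables (h : nat) (b : S -> S -> 'rV[K]_h) (hb : bilinear_mod b).

Lemma bilin_suml (I : finType) (F : I -> S) (c : I -> K) g :
  b (\sum_i c i *: F i) g = \sum_i c i *: b (F i) g.
Proof.
elim/big_rec2: _ => [|i x y _ <-]; last exact: bilinl.
by apply: (bilin_idealP hb); apply: hideal0.
Qed.

Lemma bilin_sumr (I : finType) (F : I -> S) (c : I -> K) f :
  b f (\sum_i c i *: F i) = \sum_i c i *: b f (F i).
Proof.
elim/big_rec2: _ => [|i x y _ <-]; last exact: bilinr.
by apply: (bilin_idealQ hb); apply: hideal0.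
Qed.

Lemma bilin_modl f f' g : P (f - f') -> b f g = b f' g.
Proof.
move=> Pff; rewrite -[f](subrK f') -[f - f']scale1r (bilinl hb) (bilin_idealP hb) //.
by rewrite scaler0 add0r.
Qed.

Lemma bilin_modr f g g' : Q (g - g') -> b f g = b f g'.
Proof.
move=> Qgg; rewrite -[g](subrK g') -[g - g']scale1r (bilinr hb) (bilin_idealQ hb) //.
by rewrite scaler0 add0r.
Qed.

Definition induced t n (x : U t n) : 'rV[K]_h :=
  \sum_i \sum_j x i j *: b (lft P t (delta_mx 0 i)) (lft Q n (delta_mx 0 j)).

Lemma induced_is_linear t n : linear (@induced t n).
Proof.
move=> c x y; rewrite /induced scaler_sumr -big_split; apply: eq_bigr => i _ /=.
rewrite scaler_sumr -big_split; apply: eq_bigr => j _ /=.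
by rewrite !mxE scalerDl scalerA.
Qed.
HB.instance Definition _ t n :=
  GRing.isLinear.Build K (U t n) 'rV[K]_h _ (@induced t n) (@induced_is_linear t n).

Lemma induced_lft t n (u : 'rV[K]_(hilb P t)) (v : 'rV[K]_(hilb Q n)) :
  induced (u^T *m v) = b (lft P t u) (lft Q n v).
Proof.
rewrite [u in RHS]row_sum_delta [v in RHS]row_sum_delta !linear_sum /=.
under [X in b X _]eq_bigr do rewrite linearZ /=.
under [X in b _ X]eq_bigr do rewrite linearZ /=.
rewrite bilin_suml; apply: eq_bigr => i _; rewrite bilin_sumr scaler_sumr.
by apply: eq_bigr => j _; rewrite !mxE big_ord1 !mxE scalerA.
Qed.

Lemma induced_crd t n f g : f \is t.-homog -> g \is n.-homog ->
  induced ((crd P t f)^T *m crd Q n g) = b f g.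
Proof.
move=> hf hg; rewrite induced_lft.
rewrite -(bilin_modl _ (crdK_mod hP hf)).
by rewrite -(bilin_modr _ (crdK_mod hQ hg)).
Qed.

Lemma induced_wedge m t n (x : U t n) : m \is 1.-homog ->
  (forall f g, b (l1 * f) (m * g) = b (m * f) (l1 * g)) -> induced (wedge l1 m x) = 0.
Proof.
move=> hm bm; rewrite [x]matrix_sum_delta linear_sum linear_sum big1 // => i _ /=.
rewrite linear_sum linear_sum big1 // => j _ /=.
rewrite !linearZ /=.
have -> : delta_mx i j = (delta_mx 0 i : 'rV[K]_(hilb P t))^T *m (delta_mx 0 j : 'rV[K]_(hilb Q n)) :> U t n.
  by rewrite trmx_delta mul_delta_mx.
suff -> : induced (wedge l1 m ((delta_mx 0 i : 'rV[K]_(hilb P t))^T *m (delta_mx 0 j : 'rV[K]_(hilb Q n)) : U t n)) = 0 by rewrite scaler0.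
have E g g' : bimul t.+1 n.+1 g g' ((delta_mx 0 i : 'rV[K]_(hilb P t))^T *m (delta_mx 0 j : 'rV[K]_(hilb Q n)) : U t n) =
   (crd P t.+1 (g * lft P t (delta_mx 0 i)))^T *m crd Q n.+1 (g' * lft Q n (delta_mx 0 j)).
  by rewrite /bimul !mulmxA -trmx_mul -mulmxA !mulmE.
have hM k (I : set S) (hI : homogeneous_ideal I) (l : S) v :
    l \is 1.-homog -> l * lft I k v \is k.+1.-homog.
  by move=> hl; exact: (dhomogM hl (lft_form hI v)).
rewrite /wedge linearB /= !E !induced_crd; try exact: hM.
by rewrite bm subrr.
Qed.

End Induced.

Variables (d : nat) (f0 : S) (hf0 : f0 \is d.-homog) (Pf0 : P f0) (nQf0 : ~ Q f0).
Hypothesis noQ : no_common_zero Q f0 l1.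
Variables (m2 m3 : S) (hm2 : m2 \is 1.-homog) (hm3 : m3 \is 1.-homog).
Hypothesis span : forall m : S, m \is 1.-homog -> exists c : K * K * K * K,
  m = c.1.1.1 *: l0 + (c.1.1.2 *: l1 + (c.1.2 *: m2 + c.2 *: m3)).

Let P1 := ideal_add_form P l1.
Let Q1 := ideal_add_form Q l1.

(** Such tensors die in S/(P, l1) (x) S/(Q, l1), the excess locus where [l1] vanishes in both
    factors. If [b] is onto already on them, its rank adds to the [p * q] dimensions of that
    locus. *)
Definition boundary_free t n (x : U t n) := (projm P P1 t)^T *m x *m projm Q Q1 n = 0.

(** [mu] is fixed before [b], so [b] may be constructed from [mu], as the tangent argument
    requires. *)
Theorem bezout_bilinear : exists T, forall t n, (T <= t)%N -> (T <= n)%N -> exists mu : K,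
  forall h (b : S -> S -> 'rV[K]_h), bilinear_mod b ->
    (forall f g, b (l1 * f) (l0 * g) = b (l0 * f) (l1 * g)) ->
    (forall f g, b (l1 * f) ((mu *: m3 + m2) * g) = b ((mu *: m3 + m2) * f) (l1 * g)) ->
    (forall v, exists2 x : U t n, induced b x = v & boundary_free x) -> (h <= p * q)%N.
Proof.
have nP1 : ~ P l1 := pencil_notin1 cP hl0 axP.
have nQ1 : ~ Q l1 := pencil_notin1 cQ hl0 axQ.
have hP1 : homogeneous_ideal P1 by apply: ideal_add_form_homogeneous hl1.
have hQ1 : homogeneous_ideal Q1 by apply: ideal_add_form_homogeneous hl1.
have PP1 : P `<=` P1 by apply: ideal_add_form_sub.
have QQ1 : Q `<=` Q1 by apply: ideal_add_form_sub.
have P1l : P1 l1 by apply: ideal_add_form_gen.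
have Q1l : Q1 l1 by apply: ideal_add_form_gen.
have [T1 rfQf] := row_free_section cQ hf0 nQf0 hl1 noQ.
have [T2 rfP1] := row_free_section cP hl1 nP1 hl0 (no_common_zero_sym axP).
have [T3 hilbP1] := hilb_section cP hl1 nP1.
have [T4 hilbQ1] := hilb_section cQ hl1 nQ1.
have [T5 growP] := curve_point_growth cP; have [T6 growQ] := curve_point_growth cQ.
pose T := (T1 + T2 + T3 + T4 + T5 + T6)%N.
exists T.+2 => -[//|[//|t]] -[//|[//|n]] leT leN; rewrite !ltnS in leT leN.
have [||mu dimle] := wedge_dim cP cQ hl0 hl1 axP axQ hf0 Pf0 nQf0 (T := T) _ _ hm2 hm3 span Kinf leT leN.
- by move=> s le; apply: rfQf; rewrite /T in le; lia.
- by move=> s le; apply: rfP1; rewrite /T in le; lia.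
exists mu => h b hb b0 bm sur.
(* Restriction to the excess locus paired with [b]: both kill the two wedges, so [wedge_dim] bounds
   [p * q + h]. *)
pose tau (x : U t.+2 n.+2) :=
  row_mx (mxvec ((projm P P1 t.+2)^T *m x *m projm Q Q1 n.+2)) (induced b x).
have ltau : linear tau.
  move=> c x y; rewrite /tau mulmxDr mulmxDl -scalemxAr -scalemxAl !linearP /=.
  by rewrite scale_row_mx add_row_mx.
pose Ltau := GRing.isLinear.Build _ _ _ _ tau ltau.
have bdry m (x : U t.+1 n.+1) : (projm P P1 t.+2)^T *m wedge l1 m x *m projm Q Q1 n.+2 = 0.
  rewrite /wedge /bimul mulmxBr mulmxBl -!mulmxA.
  rewrite -[mulm Q _ _ l1 *m _]projm_mulm // [mulm Q1 _ _ l1]mulm_ideal // !mulmx0 subr0.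
  by rewrite mulmxA -trmx_mul -projm_mulm // [mulm P1 _ _ l1]mulm_ideal // mulmx0 trmx0 mul0mx.
have : (hilb P1 t.+2 * hilb Q1 n.+2 + h + (hilb P t.+1 * hilb Q n.+1).*2 <=
    hilb P t.+2 * hilb Q n.+2 + hilb P t * hilb Q n)%N.
  apply: (dimle _ (HB.pack_for {linear U t.+2 n.+2 -> 'rV[K]_(hilb P1 t.+2 * hilb Q1 n.+2 + h)} tau Ltau)) => /= [v|x|x].
  - have /row_fullP[C CP] := row_full_projm hP hP1 PP1 t.+2.
    have /row_fullP[C' CQ'] := row_full_projm hQ hQ1 QQ1 n.+2.
    pose x1 : U t.+2 n.+2 := C^T *m vec_mx (lsubmx v) *m C'.
    have [x2 E2 f2] := sur (rsubmx v - induced b x1).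
    exists (x1 + x2); rewrite /tau mulmxDr mulmxDl f2 addr0 linearD /= E2 addrC subrK.
    rewrite /x1 !mulmxA -trmx_mul CP trmx1 mul1mx -mulmxA CQ' mulmx1 vec_mxK.
    exact: hsubmxK.
  - by rewrite /tau bdry linear0 induced_wedge // row_mx0.
  - rewrite /tau bdry linear0 induced_wedge ?row_mx0 //.
    by apply: rpredD => //; apply: rpredZ.
(* With linear Hilbert functions [H] and [G] the bound is [(H + 2 p)(G + 2 q) - 2 (H + p)(G + q) + H
   G = 2 p q], of which [p q] is taken by the excess locus. *)
have -> : hilb P1 t.+2 = p by rewrite hilbP1 ?mul1n //; rewrite /T in leT; lia.
have -> : hilb Q1 n.+2 = q by rewrite hilbQ1 ?mul1n //; rewrite /T in leN; lia.
rewrite [hilb P t.+2]growP; last by rewrite /T in leT; lia.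
rewrite [hilb P t.+1]growP; last by rewrite /T in leT; lia.
rewrite [hilb Q n.+2]growQ; last by rewrite /T in leN; lia.
rewrite [hilb Q n.+1]growQ; last by rewrite /T in leN; lia.
by nia.
Qed.

End BilinearForms.

(** * Choice of coordinates *)

Section CoordinateChoice.
Variable K : fieldType.
Hypothesis Kinf : injective (fun n : nat => n%:R : K).
Local Notation S := {mpoly K[4]}.

Lemma form1_lform (m : S) : m \is 1.-homog -> exists v, m = lform v.
Proof.
move=> hm; exists (\row_i m@_U_(i)); apply/mpolyP => mu.
have [mu1|ne] := eqVneq (mdeg mu) 1%N; last first.
  by rewrite (dhomog_nemf_coeff hm ne) (dhomog_nemf_coeff (form_lform _) ne).
have /mdeg1P[i /eqP ->] : mdeg mu == 1%N by rewrite mu1.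
rewrite /lform raddf_sum (bigD1 i) //= mcoeffZ mxE mcoeffXU eqxx mulr1 big1 ?addr0 // => j ne.
by rewrite mcoeffZ mcoeffXU (negPf ne) mulr0.
Qed.

Lemma complete_pencil (v0 v1 : 'rV[K]_4) : row_free (col_mx v0 v1) ->
  exists u2 u3 : 'rV[K]_4, forall v : 'rV[K]_4, exists c : K * K * K * K,
    v = c.1.1.1 *: v0 + (c.1.1.2 *: v1 + (c.1.2 *: u2 + c.2 *: u3)).
Proof.
move=> rf; pose A := col_mx v0 v1.
have rA : \rank A = 2 by apply/eqP.
have rC : \rank (A^C)%MS = 2 by rewrite mxrank_compl rA.
pose N : 'M[K]_(2, 4) := castmx (rC, erefl) (row_base (A^C)%MS).
have NE : (N :=: A^C)%MS.
  exact: eqmx_trans (eqmx_cast _ _) (eq_row_base _).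
exists (row 0 N), (row 1 N) => v.
have : (v <= A + N)%MS.
  by rewrite (adds_eqmx (eqmx_refl A) NE); apply: submx_full; apply: addsmx_compl_full.
case/sub_addsmxP => -[a b] /= ->.
exists (a 0 0, a 0 1, b 0 0, b 0 1) => /=.
rewrite [a *m A]mulmx_sum_row [b *m N]mulmx_sum_row !big_ord_recl !big_ord0 !addr0.
rewrite -addrA.
have r0 (i : 'I_(1 + 1)) : i = lshift 1 (ord0 : 'I_1) -> row i A = v0.
  by move=> ->; rewrite -row_usubmx col_mxKu; apply/rowP => j; rewrite mxE ord1.
have r1 (i : 'I_(1 + 1)) : i = rshift 1 (ord0 : 'I_1) -> row i A = v1.
  by move=> ->; rewrite -row_dsubmx col_mxKd; apply/rowP => j; rewrite mxE ord1.
rewrite r0 ?r1; try exact: val_inj.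
by congr (_ + (_ + (_ + _))); congr (_ *: _); [congr (a _ _)|congr (b _ _)|congr row]; apply: val_inj.
Qed.

Lemma section_points (P : set S) p d (f : S) : curve_point P p -> f \is d.-homog -> ~ P f ->
  exists k (z : 'I_k -> set S), (forall i, proj_point (z i)) /\
    (forall w, proj_point w -> P `<=` w -> w f -> exists i, z i = w).
Proof.
move=> cP hf nf; have hP := point_ideal (curve_point_proj cP).
set J := ideal_add_form P f.
have hJ : homogeneous_ideal J by apply: ideal_add_form_homogeneous hf.
have [T TP] := hilb_section cP hf nf.
have [||k [z [_ _ zJ zall]]] := @finite_points _ J (d * p)%N hJ.
- by move=> t; exists (maxn t T); rewrite ?TP //; lia.
- move=> w w' [pw Jw] [pw' _]; apply: (curve_point_max cP) => //.
    by apply: subset_trans Jw; apply: ideal_add_form_sub.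
  by move=> E; apply: nf; rewrite -E; apply: Jw; apply: ideal_add_form_gen.
exists k, z; split=> [i|w pw Pw wf]; first by case: (zJ i).
by apply: zall; split=> //; apply: ideal_add_form_min => //; apply: point_ideal.
Qed.

(** Three finite sets of points have to be avoided: those of [P] and of [Q] on [l0], and those of
    [Q] on [f]. *)
Lemma choose_pencil (P Q : set S) p q d (f l0 : S) : curve_point P p -> curve_point Q q ->
  f \is d.-homog -> ~ Q f -> l0 \is 1.-homog -> ~ P l0 -> ~ Q l0 ->
  exists v1 : 'rV[K]_4, [/\ no_common_zero P l0 (lform v1), no_common_zero Q l0 (lform v1)
    & no_common_zero Q f (lform v1)].
Proof.
move=> cP cQ hf nQf hl0 nP0 nQ0.
have [k1 [z1 [pz1 all1]]] := section_points cP hl0 nP0.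
have [k2 [z2 [pz2 all2]]] := section_points cQ hl0 nQ0.
have [k3 [z3 [pz3 all3]]] := section_points cQ hf nQf.
pose z (i : 'I_(k1 + (k2 + k3))) := match fintype.split i with
  | inl i1 => z1 i1
  | inr i' => match fintype.split i' with inl i2 => z2 i2 | inr i3 => z3 i3 end end.
have pz i : proj_point (z i) by rewrite /z; case: fintype.split => // i'; case: fintype.split.
have [v1 nv1] := avoid_lform Kinf (fun i => point_ideal (pz i)) (fun i => lform_notin (pz i)).
exists v1; split=> w pw sub wf.
- have [i <-] := all1 w pw sub wf; have := nv1 (unsplit (inl i)).
  by rewrite /z unsplitK.
- have [i <-] := all2 w pw sub wf; have := nv1 (unsplit (inr (unsplit (inl i)))).
  by rewrite /z unsplitK unsplitK.
- have [i <-] := all3 w pw sub wf; have := nv1 (unsplit (inr (unsplit (inr i)))).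
  by rewrite /z unsplitK unsplitK.
Qed.

Lemma pencil_span (P : set S) p (v0 v1 : 'rV[K]_4) : curve_point P p ->
  no_common_zero P (lform v0) (lform v1) ->
  exists u2 u3 : 'rV[K]_4, forall m : S, m \is 1.-homog -> exists c : K * K * K * K,
    m = c.1.1.1 *: lform v0 + (c.1.1.2 *: lform v1 + (c.1.2 *: lform u2 + c.2 *: lform u3)).
Proof.
move=> cP ax; have [|u2 [u3 uP]] := complete_pencil (v0 := v0) (v1 := v1); last first.
  exists u2, u3 => m /form1_lform[v ->]; have [c ->] := uP v; exists c.
  by rewrite !linearD !linearZ.
have n0 := pencil_notin0 cP (form_lform v1) ax.
rewrite -kermx_eq0; apply/eqP/row_matrixP => i; rewrite row0; set c := row i _.
have : c *m col_mx v0 v1 = 0 by apply/sub_kermxP; apply: row_sub.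
rewrite -[c]hsubmxK mul_row_col.
set a := lsubmx c; set b := rsubmx c; rewrite [a]mx11_scalar [b]mx11_scalar !mul_scalar_mx => E.
have El : a 0 0 *: lform v0 + b 0 0 *: lform v1 = 0 by rewrite -!linearZ -linearD /= E linear0.
have b0 : b 0 0 = 0.
  apply: contrapT => /eqP b0; have [w [pw Pw w0]] := pencil_point cP (form_lform v0).
  have hw := point_ideal pw; apply: (ax w pw Pw w0).
  have -> : lform v1 = (- (b 0 0)^-1 * a 0 0) *: lform v0.
    apply: (scalerI b0); rewrite scalerA mulrA mulrN mulfV // mulN1r scaleNr.
    by apply/eqP; rewrite -addr_eq0 addrC El.
  exact: hideal_scale.
have a0 : a 0 0 = 0.
  apply: contrapT => /eqP a0; apply: n0; move: El; rewrite b0 scale0r addr0 => El.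
  have -> : lform v0 = 0 by apply: (scalerI a0); rewrite El scaler0.
  exact: (hideal0 (point_ideal (curve_point_proj cP))).
by rewrite a0 b0 !raddf0 row_mx0.
Qed.

Lemma forms_span (X : set S) d e : subspace_set X ->
  (forall f g, f \is d.-homog -> g \is e.-homog -> X (f * g)) ->
  forall F, F \is (d + e)%N.-homog -> X F.
Proof.
move=> [X0 Xlin] Xfg F hF.
have mono : forall a' b' (m : 'X_{1..4}), mdeg m = (a' + b')%N ->
    exists m1 m2 : 'X_{1..4}, [/\ m = (m1 + m2)%MM, mdeg m1 = a' & mdeg m2 = b'].
  elim=> [|a' IH] b' m mm; first by exists 0%MM, m; rewrite add0m mdeg0.
  have [i mi] : exists i, m i != 0%N.
    apply: contrapT => /forallNP z; move: mm; rewrite mdegE big1 // => i _.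
    by apply/eqP/negPn/negP/z.
  have Em : m = (U_(i) + (m - U_(i)))%MM by rewrite addmC submK // lep1mP.
  have [|m1 [m2 [E1 d1 d2]]] := IH b' (m - U_(i))%MM.
    by move: mm; rewrite {1}Em mdegD mdeg1; lia.
  exists (U_(i) + m1)%MM, m2; split=> //; first by rewrite {1}Em E1 addmA.
  by rewrite mdegD mdeg1 d1.
rewrite [F]mpolyE big_seq; elim/big_rec: _ => [//|m x mF Xx]; apply: Xlin => //.
have mm : mdeg m = (d + e)%N by apply: (dhomogP _ _ _ hF _ mF).
have [m1 [m2 [-> d1 d2]]] := mono d e m mm.
by rewrite mpolyXD; apply: Xfg; rewrite dhomogX; apply/eqP.
Qed.

Lemma hilb_eq_forms (I J : set S) t f : homogeneous_ideal I -> homogeneous_ideal J ->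
  I `<=` J -> hilb I t = hilb J t -> f \is t.-homog -> J f -> I f.
Proof.
move=> hI hJ IJ E hf Jf; apply/(crd_eq0 hI hf).
have rf : row_free (projm I J t).
  by have /eqP rk := row_full_projm hI hJ IJ t; apply/eqP; rewrite rk; exact: esym E.
by apply: (row_free_mulKl rf); rewrite -crd_projm // crd_ideal.
Qed.

End CoordinateChoice.

(** * The Bezout bound for the intersection of two curves *)

Section Attained.
Variable K : fieldType.
Hypothesis Kinf : injective (fun n : nat => n%:R : K).
Local Notation S := {mpoly K[4]}.
Variables (P Q : set S) (p q : nat) (cP : curve_point P p) (cQ : curve_point Q q).
Variables (l1 : S) (hl1 : l1 \is 1.-homog) (h : nat) (b : S -> S -> 'rV[K]_h).
Hypothesis hb : bilinear_mod P Q b.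
Let hP := point_ideal (curve_point_proj cP).
Let hQ := point_ideal (curve_point_proj cQ).

Definition attained t n v :=
  exists2 x : 'M[K]_(hilb P t, hilb Q n), induced b x = v & boundary_free l1 x.

Lemma attained_linear t n c v w : attained t n v -> attained t n w -> attained t n (c *: v + w).
Proof.
move=> [x Ex fx] [y Ey fy]; exists (c *: x + y); first by rewrite induced_is_linear Ex Ey.
by rewrite /boundary_free mulmxDr mulmxDl -scalemxAr -scalemxAl fx fy scaler0 addr0.
Qed.

Lemma attained0 t n : attained t n 0.
Proof.
exists 0; last by rewrite /boundary_free mulmx0 mul0mx.
by rewrite /induced big1 // => i _; rewrite big1 // => j _; rewrite mxE scale0r.
Qed.

(** A factor [l1] on one side makes a decomposable tensor boundary free. *)
Lemma attained_l t n f g : f \is t.-homog -> g \is n.-homog -> attained t.+1 n (b (l1 * f) g).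
Proof.
move=> hf hg; have hlf : l1 * f \is t.+1.-homog by exact: (dhomogM hl1 hf).
exists ((crd P t.+1 (l1 * f))^T *m crd Q n g); first exact: (induced_crd cP cQ hb).
have hP1 := ideal_add_form_homogeneous hP hl1.
rewrite /boundary_free mulmxA -trmx_mul -crd_projm //; last exact: ideal_add_form_sub.
by rewrite (crd_ideal hP1) ?trmx0 ?mul0mx //; apply: (hidealMr hP1); apply: ideal_add_form_gen.
Qed.

Lemma attained_r t n f g : f \is t.-homog -> g \is n.-homog -> attained t n.+1 (b f (l1 * g)).
Proof.
move=> hf hg; have hlg : l1 * g \is n.+1.-homog by exact: (dhomogM hl1 hg).
exists ((crd P t f)^T *m crd Q n.+1 (l1 * g)); first exact: (induced_crd cP cQ hb).
have hQ1 := ideal_add_form_homogeneous hQ hl1.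
rewrite /boundary_free -mulmxA -mulmxA -crd_projm //; last exact: ideal_add_form_sub.
by rewrite (crd_ideal hQ1) ?mulmx0 //; apply: (hidealMr hQ1); apply: ideal_add_form_gen.
Qed.

End Attained.

Section BezoutBound.
Variable K : fieldType.
Hypothesis Kinf : injective (fun n : nat => n%:R : K).
Local Notation S := {mpoly K[4]}.

(** [P + Q] contains [f] and [Q], and [Q], [f], [l1] have no common zero; so in large degree
    multiplication by [l1] is onto S/(P + Q). *)
Lemma ideal_add_span (P Q : set S) d (f l1 : S) : homogeneous_ideal P -> homogeneous_ideal Q ->
  f \is d.-homog -> P f -> l1 \is 1.-homog -> no_common_zero Q f l1 ->
  exists N, forall t F, (N <= t)%N -> F \is t.+1.-homog ->
    exists G, G \is t.-homog /\ ideal_add P Q (F - l1 * G).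
Proof.
move=> hP hQ hf Pf hl1 no; have hJ := ideal_add_homogeneous hP hQ.
have hQf := ideal_add_form_homogeneous hQ hf.
have [N NP] := no_common_zero_hilb hQ hf hl1 no.
exists N => t F le hF.
have [a [c [Qa E]]] : ideal_add_form (ideal_add_form Q f) l1 F.
  apply: (hilb_eq0_forms _ (NP t.+1 _) hF); last by lia.
  exact: ideal_add_form_homogeneous hl1.
exists (pihomog mdeg t c); split; first exact: pihomogP.
have -> : F - l1 * pihomog mdeg t c = pihomog mdeg t.+1 a.
  have := congr1 (pihomog mdeg t.+1) E; rewrite (pihomog_dE hF) pihomogD.
  have -> : pihomog mdeg t.+1 (c * l1) = l1 * pihomog mdeg t c.
    by rewrite mulrC; exact: (pihomog_mull t c hl1).
  by move=> {1}->; rewrite addrK.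
apply: hideal_pihomog => //; apply: (ideal_add_form_min hJ _ _ Qa).
  exact: ideal_add_subr.
exact: ideal_add_subl.
Qed.

(** [bezout_bilinear] for the multiplication S/P x S/Q -> S/(P + Q), for which moving a factor
    across is commutativity. It is onto on boundary-free tensors because every class of large degree
    is a multiple of [l1]. *)
Theorem bezout_hilb (P Q : set S) p q : curve_point P p -> curve_point Q q -> ~ P `<=` Q ->
  exists N, forall t, (N <= t)%N -> (hilb (ideal_add P Q) t <= p * q)%N.
Proof.
move=> cP cQ nPQ; have pP := curve_point_proj cP; have pQ := curve_point_proj cQ.
have hP := point_ideal pP; have hQ := point_ideal pQ.
have [d [f [hf Pf nQf]]] := not_subset_form hQ hP nPQ.
pose W (i : 'I_2) := if i == 0 then P else Q.
have hW i : proj_point (W i) by rewrite /W; case: ifP.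
have [v0 nv0] := avoid_lform Kinf (fun i => point_ideal (hW i)) (fun i => lform_notin (hW i)).
have nP0 : ~ P (lform v0) by have := nv0 0.
have nQ0 : ~ Q (lform v0) by have := nv0 1.
have hl0 := form_lform v0.
have [v1 [axP axQ noQ]] := choose_pencil Kinf cP cQ hf nQf hl0 nP0 nQ0.
set l1 := lform v1 in axP axQ noQ.
have hl1 : l1 \is 1.-homog := form_lform v1; have [u2 [u3 span]] := pencil_span cP axP.
have [T TP] := bezout_bilinear Kinf cP cQ hl0 hl1 axP axQ hf Pf nQf noQ (form_lform u2) (form_lform u3) span.
have [N NP] := ideal_add_span hP hQ hf Pf hl1 noQ.
have hJ := ideal_add_homogeneous hP hQ.
exists (T + T + N).+2 => t le.
(* The bidegree [(T.+1, n)] has total degree [t]; the factor [l1] uses up one degree of the first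
   entry, which leaves [T]. *)
pose n := (t - T.+1)%N; have En : t = (T.+1 + n)%N by rewrite /n; lia.
have [||mu muP] := TP T.+1 n; [by lia|by rewrite /n; lia|].
have PJ := @ideal_add_subl K P Q hQ; have QJ := @ideal_add_subr K P Q hP.
pose b (x y : S) : 'rV[K]_(hilb (ideal_add P Q) t) := crd (ideal_add P Q) t (x * y).
have hb : bilinear_mod P Q b.
  split=> [g c x y|g c x y|x y Px|x y Qy]; rewrite /b.
  - by rewrite mulrDl -scalerAl linearP.
  - by rewrite mulrDr -scalerAr linearP.
  - by rewrite crd_ideal //; apply: hidealMr => //; apply: PJ.
  - by rewrite crd_ideal //; apply: hidealM => //; apply: QJ.
apply: (muP _ b hb) => [x y|x y|v].
- by rewrite /b; congr (crd _ _ _); ring.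
- by rewrite /b; congr (crd _ _ _); ring.
have hF := lft_form hJ v; set F := lft _ t v in hF.
have [||G [hG JG]] := NP t.-1 F; [by lia|by rewrite prednK //; lia|].
have -> : v = crd (ideal_add P Q) t (l1 * G).
  by rewrite -[v](lftK hJ) -/F; apply/eqP; rewrite -subr_eq0 -linearB /= crd_ideal.
apply: (@forms_span K [set G | @attained K P Q l1 _ b T.+1 n (crd _ t (l1 * G))] T n) => //.
- split=> /=; first by rewrite mulr0 linear0; apply: attained0.
  by move=> c x y Ax Ay; rewrite mulrDr -scalerAr linearP; apply: attained_linear.
- move=> x y hx hy /=; rewrite mulrA; apply: (attained_l cP cQ hl1 hb) => //.
- by have -> : (T + n = t.-1)%N by rewrite /n; lia.
Qed.

End BezoutBound.

(** * Rational points, derivatives and tangent directions *)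

Section RationalPoints.
Variable K : fieldType.
Local Notation S := {mpoly K[4]}.
Local Notation hc := (pihomog mdeg).
Implicit Types (P : set S) (f g : S) (zeta v : 'rV[K]_4).

Definition ev zeta f : K := f.@[fun i => zeta 0 i].
Definition dev v zeta f : K := \sum_i v 0 i * ev zeta f^`M(i).

(* Restriction to the affine line through [zeta]: the form [f] of degree [d] becomes
   [ev zeta f *: 'X^d]. *)
Definition cone_res zeta f : {poly K} :=
  (map_mpoly polyC f).@[fun i => zeta 0 i *: 'X].

(** The restriction takes values in the domain [{poly K}], which makes primality immediate. Its
    coefficients are the values at [zeta] of the homogeneous components. *)
Definition pt zeta : set S := [set f | cone_res zeta f = 0].

Lemma evD zeta f g : ev zeta (f + g) = ev zeta f + ev zeta g. Proof. exact: mevalD. Qed.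
Lemma evM zeta f g : ev zeta (f * g) = ev zeta f * ev zeta g. Proof. exact: mevalM. Qed.
Lemma evZ zeta c f : ev zeta (c *: f) = c * ev zeta f. Proof. exact: mevalZ. Qed.
Lemma ev0 zeta : ev zeta 0 = 0. Proof. exact: meval0. Qed.
Lemma ev1 zeta : ev zeta 1 = 1. Proof. exact: meval1. Qed.
Lemma evX zeta i : ev zeta 'X_i = zeta 0 i. Proof. exact: mevalXU. Qed.
Lemma evXn zeta f n : ev zeta (f ^+ n) = ev zeta f ^+ n. Proof. exact: rmorphXn. Qed.
Lemma ev_sum zeta (T : Type) (r : seq T) (Pr : pred T) (F : T -> S) :
  ev zeta (\sum_(i <- r | Pr i) F i) = \sum_(i <- r | Pr i) ev zeta (F i).
Proof. exact: raddf_sum. Qed.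

Lemma ev_lform zeta v : ev zeta (lform v) = \sum_i v 0 i * zeta 0 i.
Proof. by rewrite ev_sum; apply: eq_bigr => i _; rewrite evZ evX. Qed.

Lemma cone_resD zeta f g : cone_res zeta (f + g) = cone_res zeta f + cone_res zeta g.
Proof. by rewrite /cone_res !raddfD. Qed.
Lemma cone_resM zeta f g : cone_res zeta (f * g) = cone_res zeta f * cone_res zeta g.
Proof. by rewrite /cone_res !rmorphM. Qed.
Lemma cone_res_sum zeta (T : Type) (r : seq T) (Pr : pred T) (F : T -> S) :
  cone_res zeta (\sum_(i <- r | Pr i) F i) = \sum_(i <- r | Pr i) cone_res zeta (F i).
Proof.
elim/big_rec2: _ => [|i x y _ <-]; last exact: cone_resD.
by rewrite /cone_res !raddf0.
Qed.

Lemma cone_res_form zeta d f : f \is d.-homog -> cone_res zeta f = ev zeta f *: 'X^d.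
Proof.
move=> hf; rewrite [f]mpolyE cone_res_sum ev_sum scaler_suml.
rewrite big_seq [RHS]big_seq; apply: eq_bigr => m mf.
have md : mdeg m = d by apply: (dhomogP _ _ _ hf).
rewrite /cone_res /ev map_mpolyZ map_mpolyX !mevalZ !mevalX.
have -> : \prod_(i < 4) (zeta 0 i *: 'X) ^+ m i = (\prod_(i < 4) zeta 0 i ^+ m i) *: 'X^(mdeg m) :> {poly K}.
  rewrite mdegE; elim/big_rec3: _ => [|i x y n _ ->]; first by rewrite expr0 scale1r.
  by rewrite exprZn -scalerAl -scalerAr scalerA exprD.
by rewrite mul_polyC scalerA md.
Qed.

Lemma cone_res_coef zeta d f : (cone_res zeta f)`_d = ev zeta (hc d f).
Proof.
have [n En] := sum_pihomog f; have [n' large] := pihomog_large f.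
have [k [Ek lek]] : exists k, f = \sum_(i < k) hc i f /\ (d < k)%N.
  exists (n + d.+1)%N; split; last by lia.
  rewrite big_split_ord /= -En big1 ?addr0 // => i _.
  by rewrite {1}En pihomog_trunc ltnNge leq_addr.
rewrite {1}Ek cone_res_sum coef_sum (bigD1 (Ordinal lek)) //= big1 => [|i ne].
  by rewrite (cone_res_form _ (pihomogP mdeg d f)) coefZ coefXn eqxx mulr1 addr0.
rewrite (cone_res_form _ (pihomogP mdeg i f)) coefZ coefXn.
have -> : (d == i) = false by apply: contraNF ne => /eqP E; apply/eqP/val_inj.
by rewrite mulr0.
Qed.

Lemma pt_form zeta d f : f \is d.-homog -> pt zeta f <-> ev zeta f = 0.
Proof.
move=> hf; rewrite /pt /= (cone_res_form _ hf); split=> [|->]; last by rewrite scale0r.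
by move/eqP; rewrite scaler_eq0 (negPf (monic_neq0 (monicXn K d))) orbF => /eqP.
Qed.

Lemma pt_pihomog zeta d f : pt zeta f -> ev zeta (hc d f) = 0.
Proof. by move=> E; rewrite -cone_res_coef E coef0. Qed.

Lemma pt_ideal zeta : homogeneous_ideal (pt zeta).
Proof.
split; rewrite /pt /=.
- by rewrite /cone_res !raddf0.
- by move=> f g Ef Eg; rewrite cone_resD Ef Eg addr0.
- by move=> f g Eg; rewrite cone_resM Eg mulr0.
- by move=> f d E; apply: (proj2 (pt_form _ (pihomogP mdeg d f))); apply: pt_pihomog.
Qed.

Lemma pt_point zeta i : zeta 0 i != 0 -> proj_point (pt zeta).
Proof.
move=> zi; split; first exact: pt_ideal.
- by move/(pt_form _ (dhomog1 _ _)); rewrite ev1 => /eqP; rewrite oner_eq0.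
- by move=> f g; rewrite /pt /= cone_resM => /eqP; rewrite mulf_eq0 => /orP[] /eqP ->; [left|right].
- by exists i => /(pt_form _ (form_X _ i)); rewrite evX => /eqP; rewrite (negPf zi).
Qed.

Lemma pt_ev zeta f : pt zeta f -> ev zeta f = 0.
Proof.
move=> ptf; have [n En] := sum_pihomog f; rewrite En ev_sum.
by apply: big1 => i _; apply: pt_pihomog.
Qed.

Lemma form_expand d f : f \is d.-homog -> exists (s : seq 'X_{1..4}) (c : 'X_{1..4} -> K),
  f = \sum_(m <- s) c m *: 'X_[m] /\ {in s, forall m, mdeg m = d}.
Proof.
move=> hf; exists (msupp f), (fun m => f@_m); split; first exact: mpolyE.
by move=> m mf; apply: (dhomogP _ _ _ hf).
Qed.

(** Modulo these linear forms every variable is a multiple of ['X_i], so a form is determined by its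
    value at [zeta]. *)
Lemma form_mod_variables (J : set S) zeta i : homogeneous_ideal J -> zeta 0 i = 1 ->
  (forall j, J ('X_j - zeta 0 j *: 'X_i)) ->
  forall d f, f \is d.-homog -> J (f - ev zeta f *: 'X_i ^+ d).
Proof.
move=> hJ zi Jv d f hf.
have mono : forall e (m : 'X_{1..4}), mdeg m = e -> J ('X_[m] - ev zeta 'X_[m] *: 'X_i ^+ e).
  elim=> [|e IH] m mm.
    have /eqP -> : m == 0%MM by rewrite -mdeg_eq0 mm.
    by rewrite mpolyX0 ev1 scale1r expr0 subrr; apply: hideal0.
  have [j mj] : exists j, m j != 0%N.
    apply: contrapT => /forallNP z; move: mm; rewrite mdegE big1 // => j _.
    by apply/eqP/negPn/negP/z.
  have Em : m = (U_(j) + (m - U_(j)))%MM by rewrite addmC submK // lep1mP.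
  have mm' : mdeg (m - U_(j))%MM = e by move: mm; rewrite {1}Em mdegD mdeg1; lia.
  rewrite Em mpolyXD evM evX exprS; set x := 'X_[_ - _]; have Jx := IH _ mm'.
  have -> : 'X_j * x - (zeta 0 j * ev zeta x) *: ('X_i * 'X_i ^+ e) =
      'X_j * (x - ev zeta x *: 'X_i ^+ e) + (ev zeta x *: 'X_i ^+ e) * ('X_j - zeta 0 j *: 'X_i).
    rewrite -!mul_mpolyC mpolyCM; ring.
  by apply: hidealD => //; apply: hidealM.
have [s [c [-> hs]]] := form_expand hf.
rewrite ev_sum scaler_suml -sumrB big_seq.
apply: hideal_sum => // m mf; rewrite evZ -scalerA -scalerBr; apply: hideal_scale => //.
by apply: mono; apply: hs.
Qed.

(** A power of a variable outside [z] embeds degree 1 into degree [t], so modulo [z] the variables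
    are proportional; their ratios to ['X_i] are the coordinates of [zeta]. *)
Lemma rational_point (z : set S) t : proj_point z -> (0 < t)%N -> hilb z t = 1%N ->
  exists zeta i, zeta 0 i = 1 /\ z = pt zeta.
Proof.
move=> pz t0 h1; have hz := point_ideal pz; have [i ni] := point_relevant pz.
have hX1 : hilb z 1 = 1%N.
  have rf : row_free (mulm z 1 t ('X_i ^+ t.-1)).
    apply: (row_free_mulm_point pz (form_Xn K i t.-1)); first by rewrite add1n prednK.
    exact: point_notinX.
  have := rank_leq_col (mulm z 1 t ('X_i ^+ t.-1)); move/eqP: rf => ->.
  by rewrite h1; have := hilb_point_gt0 1 pz; lia.
have prop (u w : 'rV[K]_(hilb z 1)) : u != 0 -> exists c, w = c *: u.
  move: (hilb z 1) hX1 u w => n -> u w nz.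
  have u0 : u 0 0 != 0 by apply: contraNneq nz => u0; apply/eqP/rowP => j; rewrite ord1 mxE.
  by exists (w 0 0 / u 0 0); apply/rowP => j; rewrite ord1 mxE divfK.
have crdi : crd z 1 'X_i != 0 by apply/eqP => /(crd_eq0 hz (form_X _ i)).
have [c cP] := choice (fun j => prop _ (crd z 1 'X_j) crdi).
have zc j : z ('X_j - c j *: 'X_i).
  apply/(crd_eq0 hz (t := 1)); last by rewrite linearB linearZ /= -cP subrr.
  by apply: rpredB; [apply: form_X|apply: rpredZ; apply: form_X].
pose zeta : 'rV[K]_4 := \row_j c j.
have ci : c i = 1.
  apply: contrapT => /eqP ne; apply: ni; rewrite -(scalerK (a := 1 - c i) _ 'X_i); last first.
    by rewrite subr_eq0 eq_sym.
  by apply: hideal_scale => //; rewrite scalerBl scale1r.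
have zi : zeta 0 i = 1 by rewrite mxE.
have mod d f : f \is d.-homog -> z (f - ev zeta f *: 'X_i ^+ d).
  by apply: form_mod_variables => // j; rewrite mxE.
exists zeta, i; split=> //; apply/seteqP; split=> f.
  move=> zf; apply: (hideal_forms (pt_ideal zeta)) => d.
  apply: (proj2 (pt_form _ (pihomogP mdeg d f))); apply: contrapT => /eqP ne.
  have zfd : z (hc d f) by apply: hideal_pihomog.
  apply: (point_notinX pz (n := d) ni).
  rewrite -(scalerK ne ('X_i ^+ d)); apply: hideal_scale => //.
  have := hideal_sub hz zfd (mod _ _ (pihomogP mdeg d f)).
  by rewrite opprB addrCA subrr addr0.
move=> ptf; apply: (hideal_forms hz) => d.
have := mod _ _ (pihomogP mdeg d f).
have -> : ev zeta (hc d f) = 0.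
  exact: pt_pihomog.
by rewrite scale0r subr0.
Qed.

Lemma dev_linear v zeta c f g : dev v zeta (c *: f + g) = c * dev v zeta f + dev v zeta g.
Proof.
rewrite /dev mulr_sumr -big_split; apply: eq_bigr => i _ /=.
by rewrite linearP /= evD evZ; ring.
Qed.

Lemma devM v zeta f g :
  dev v zeta (f * g) = dev v zeta f * ev zeta g + ev zeta f * dev v zeta g.
Proof.
rewrite /dev mulr_suml mulr_sumr -big_split; apply: eq_bigr => i _ /=.
by rewrite mderivM evD !evM; ring.
Qed.

Lemma dev_linearl c v v' zeta f : dev (c *: v + v') zeta f = c * dev v zeta f + dev v' zeta f.
Proof.
rewrite /dev mulr_sumr -big_split; apply: eq_bigr => i _ /=.
by rewrite !mxE; ring.
Qed.

Lemma devX v zeta i : dev v zeta 'X_i = v 0 i.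
Proof.
rewrite /dev (bigD1 i) //= big1 ?addr0 => [|j ne].
  rewrite mderivX mnm1E eqxx scale1r; have -> : (U_(i) - U_(i) = 0 :> 'X_{1..4})%MM.
    by apply/mnmP => k; rewrite mnmBE subnn mnm0E.
  by rewrite mpolyX0 ev1 mulr1.
by rewrite mderivX mnm1E eq_sym (negPf ne) scale0r ev0 mulr0.
Qed.

Lemma dev0 v zeta : dev v zeta 0 = 0.
Proof. by rewrite /dev big1 // => i _; rewrite mderiv0 ev0 mulr0. Qed.

Lemma devD v zeta f g : dev v zeta (f + g) = dev v zeta f + dev v zeta g.
Proof. by have := dev_linear v zeta 1 f g; rewrite scale1r mul1r. Qed.

Lemma devZ v zeta c f : dev v zeta (c *: f) = c * dev v zeta f.
Proof. by have := dev_linear v zeta c f 0; rewrite dev0 !addr0. Qed.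

Lemma dev_sum v zeta (T : Type) (r : seq T) (Pr : pred T) (F : T -> S) :
  dev v zeta (\sum_(i <- r | Pr i) F i) = \sum_(i <- r | Pr i) dev v zeta (F i).
Proof. by elim/big_rec2: _ => [|i x y _ <-]; rewrite ?dev0 ?devD. Qed.

Lemma dev_lform v zeta u : dev v zeta (lform u) = \sum_i u 0 i * v 0 i.
Proof. by rewrite dev_sum; apply: eq_bigr => i _; rewrite devZ devX. Qed.

Lemma dev_euler zeta d f : f \is d.-homog -> dev zeta zeta f = d%:R * ev zeta f.
Proof.
move=> hf.
have mono : forall e (m : 'X_{1..4}), mdeg m = e -> dev zeta zeta 'X_[m] = e%:R * ev zeta 'X_[m].
  elim=> [|e IH] m mm.
    have /eqP -> : m == 0%MM by rewrite -mdeg_eq0 mm.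
    rewrite mpolyX0 mul0r -[LHS]addr0 /dev addr0 big1 // => i _.
    by rewrite -mpolyC1 mderivC ev0 mulr0.
  have [j mj] : exists j, m j != 0%N.
    apply: contrapT => /forallNP z; move: mm; rewrite mdegE big1 // => j _.
    by apply/eqP/negPn/negP/z.
  have Em : m = (U_(j) + (m - U_(j)))%MM by rewrite addmC submK // lep1mP.
  have mm' : mdeg (m - U_(j))%MM = e by move: mm; rewrite {1}Em mdegD mdeg1; lia.
  rewrite Em mpolyXD devM evM evX devX IH // -natr1; ring.
have [s [c [-> hs]]] := form_expand hf.
rewrite dev_sum ev_sum mulr_sumr big_seq [RHS]big_seq.
by apply: eq_bigr => m mf; rewrite devZ evZ (mono d) ?hs //; ring.
Qed.

Lemma pt_dev_self zeta f : pt zeta f -> dev zeta zeta f = 0.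
Proof.
move=> ptf; have [n En] := sum_pihomog f; rewrite En dev_sum; apply: big1 => i _.
by rewrite (dev_euler _ (pihomogP mdeg i f)) (pt_pihomog _ ptf) mulr0.
Qed.

Lemma rowspace_of_set n (X : set 'rV[K]_n) : X 0 ->
  (forall c (u w : 'rV[K]_n), X u -> X w -> X (c *: u + w)) ->
  exists G : 'M[K]_n, forall w : 'rV[K]_n, (w <= G)%MS <-> X w.
Proof.
move=> X0 Xlin.
pose p r := `[< exists G : 'M[K]_n, (forall w : 'rV_n, (w <= G)%MS -> X w) /\ \rank G = r >].
have ex : exists r, p r.
  by exists 0%N; apply/asboolP; exists 0; rewrite mxrank0; split=> // w; rewrite submx0 => /eqP ->.
have bnd r : p r -> (r <= n)%N by move=> /asboolP [G [_ <-]]; apply: rank_leq_row.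
case: (ex_maxnP ex bnd) => r /asboolP [G [GX rG]] maxr; exists G => w; split; first exact: GX.
move=> Xw; apply: contrapT => nGw.
have : p (\rank (w + G)%MS).
  apply/asboolP; exists (w + G)%MS; split=> // x /sub_addsmxP[[a b] /= ->].
  rewrite [a]mx11_scalar mul_scalar_mx; apply: Xlin => //.
  by apply: GX; apply: submxMl.
move=> /maxr; rewrite -rG leqNgt => /negP; apply.
apply: rank_ltmx; rewrite ltmxE addsmxSr /=; apply/negP => sub; apply: nGw.
exact: submx_trans (addsmxSl _ _) sub.
Qed.

Lemma zero_homogeneous_ideal : homogeneous_ideal [set (0 : S)].
Proof.
split=> //= [f g -> ->|f g ->|f d ->]; rewrite ?addr0 ?mulr0 //.
exact: pihomog0.
Qed.

(* If the differentials at [zeta] of the elements of [P] spanned the cotangent space, Cramer's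
   rule would put the whole maximal ideal of [zeta] inside [P]. *)
Lemma exists_tangent P zeta i : proj_point P -> zeta 0 i = 1 -> P `<=` pt zeta -> pt zeta <> P ->
  exists v, [/\ v 0 i = 0, v != 0 & forall f, P f -> dev v zeta f = 0].
Proof.
move=> pP zi Pz ne; have hP := point_ideal pP.
pose y (j : 'I_3) : S := 'X_(lift i j) - zeta 0 (lift i j) *: 'X_i.
have hy j : y j \is 1.-homog by apply: rpredB; [|apply: rpredZ]; apply: form_X.
have evy j : ev zeta (y j) = 0 by rewrite /y evD -scaleNr evZ !evX zi mulr1 addrN.
pose Y0 := ideal_add_form [set (0 : S)] (y 0).
pose Y1 := ideal_add_form Y0 (y 1); pose Y2 := ideal_add_form Y1 (y (inord 2)).
have hY0 : homogeneous_ideal Y0 by apply: ideal_add_form_homogeneous (hy 0); apply: zero_homogeneous_ideal.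
have hY1 : homogeneous_ideal Y1 by apply: ideal_add_form_homogeneous (hy 1).
have hY2 : homogeneous_ideal Y2 by apply: ideal_add_form_homogeneous (hy _).
have o2 : inord 2 = lift ord0 (lift ord0 ord0) :> 'I_3 by apply: val_inj; rewrite /= inordK.
have Yy j : Y2 (y j).
  have : j = 0 \/ j = 1 \/ j = inord 2.
    case: j => -[|[|[|//]]] lt; [left|right; left|right; right]; apply: val_inj => //=.
    by rewrite inordK.
  case=> [->|[->|->]]; last exact: ideal_add_form_gen.
    by apply: ideal_add_form_sub; apply: ideal_add_form_sub; apply: ideal_add_form_gen; apply: zero_homogeneous_ideal.
  by apply: ideal_add_form_sub; apply: ideal_add_form_gen.
have Yvar j : Y2 ('X_j - zeta 0 j *: 'X_i).
  case: (unliftP i j) => [j' ->|->]; first exact: Yy.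
  by rewrite zi scale1r subrr; apply: hideal0.
have ptY f : pt zeta f -> exists h : 'I_3 -> S, f = \sum_j h j * y j.
  move=> ptf; have : Y2 f.
    apply: (hideal_forms hY2) => d.
    have := form_mod_variables hY2 zi Yvar (pihomogP mdeg d f).
    have -> : ev zeta (hc d f) = 0.
      exact: pt_pihomog.
    by rewrite scale0r subr0.
  case=> _ [b2 [[_ [b1 [[_ [b0 [-> ->]]] ->]]] ->]].
  exists (fun j => nth 0 [:: b0; b1; b2] j).
  rewrite !big_ord_recl big_ord0 /= addr0 add0r o2 -addrA.
  by congr (_ + (_ * y _ + _)); apply: val_inj.
pose H : set 'rV[K]_3 := [set w | exists h : 'I_3 -> S,
  P (\sum_j h j * y j) /\ w = \row_j ev zeta (h j)].
have [||G GH] := @rowspace_of_set 3 H.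
- exists (fun=> 0); split; last by apply/rowP => j; rewrite !mxE ev0.
  rewrite big1 => [|j _]; last by rewrite mul0r.
  exact: hideal0.
- move=> c u w [h [Ph ->]] [h' [Ph' ->]]; exists (fun j => c *: h j + h' j); split.
    have -> : \sum_j (c *: h j + h' j) * y j = c *: (\sum_j h j * y j) + \sum_j h' j * y j.
      by rewrite scaler_sumr -big_split; apply: eq_bigr => j _; rewrite mulrDl -scalerAl.
    by apply: hidealD => //; apply: hideal_scale.
  by apply/rowP => j; rewrite !mxE evD evZ.
have [full|nfull] := boolP (row_full G).
  have get (j : 'I_3) : exists h : 'I_3 -> S, P (\sum_l h l * y l) /\ forall l, ev zeta (h l) = (j == l)%:R.
    have [|h [Ph Eh]] := proj1 (GH (delta_mx 0 j)); first exact: submx_full.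
    exists h; split=> // l; move/rowP: Eh => /(_ l); rewrite !mxE eqxx /= eq_sym => <-.
    by rewrite eq_sym.
  have [h hP'] := choice get.
  pose M : 'M[S]_3 := \matrix_(j, l) h j l; pose ys : 'cV[S]_3 := \col_j y j.
  have Pdet j : P (\det M * y j).
    have -> : \det M * y j = ((\adj M *m M) *m ys) j 0.
      by rewrite mul_adj_mx mul_scalar_mx !mxE.
    rewrite -mulmxA mxE; apply: hideal_sum => // l _; apply: hidealM => //.
    have [Pl _] := hP' l; rewrite mxE.
    by under eq_bigr do rewrite !mxE.
  have detn : ~ P (\det M).
    move=> /Pz /pt_ev; rewrite /ev -det_map_mx.
    have -> : map_mx (meval (fun i0 => zeta 0 i0)) M = 1%:M.
      by apply/matrixP => j l; rewrite !mxE; case: (hP' j) => _ E; exact: E.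
    by rewrite det1 => /eqP; rewrite oner_eq0.
  case: ne; apply/seteqP; split=> // f /ptY[g ->].
  apply: hideal_sum => // j _; apply: hidealM => //.
  exact: (point_mem_mull pP detn (Pdet j)).
have cok : cokermx G != 0.
  apply: contra nfull => /eqP c0; rewrite -sub1mx submxE c0 mulmx0 //.
have [j cj] : exists j, col j (cokermx G) != 0.
  apply: contrapT => /forallNP all; case/eqP: cok; apply/matrixP => a b.
  have /negP := all b; rewrite negbK => /eqP /colP /(_ a); by rewrite !mxE.
pose u : 'cV[K]_3 := col j (cokermx G).
pose v : 'rV[K]_4 := \row_k if unlift i k is Some l then u l 0 else 0.
have vl l : v 0 (lift i l) = u l 0 by rewrite mxE liftK.
have vi : v 0 i = 0 by rewrite mxE unlift_none.
exists v; split=> //.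
  apply: contraNneq cj => v0; apply/eqP/colP => l; have := vl l.
  by rewrite v0 !mxE => <-.
move=> f Pf; have [h Ef] := ptY f (Pz f Pf).
have Hh : H (\row_l ev zeta (h l)) by exists h; rewrite -Ef.
have /submxP[D ED] := proj2 (GH _) Hh.
have E0 : (\row_l ev zeta (h l)) *m u = 0.
  by rewrite ED /u colE -mulmxA [G *m _]mulmxA mulmx_coker mul0mx mulmx0.
rewrite Ef dev_sum; have := congr1 (fun A : 'M_1 => A 0 0) E0.
rewrite /= !mxE => {2}<-; apply: eq_bigr => l _.
rewrite devM evy mulr0 add0r mxE; congr (_ * _).
by rewrite /y devD -scaleNr devZ !devX vi mulr0 addr0 vl.
Qed.

End RationalPoints.

(** * Orthogonality in four-dimensional space *)

Section LinearAlgebra.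
Variable K : fieldType.
Local Notation S := {mpoly K[4]}.

Definition dot (u v : 'rV[K]_4) : K := \sum_i u 0 i * v 0 i.

Lemma dotE (u v : 'rV[K]_4) : (u *m v^T) 0 0 = dot u v.
Proof. by rewrite mxE; apply: eq_bigr => i _; rewrite mxE. Qed.

Lemma dotC u v : dot u v = dot v u.
Proof. by apply: eq_bigr => i _; rewrite mulrC. Qed.

Lemma dot_linearr u c v w : dot u (c *: v + w) = c * dot u v + dot u w.
Proof.
by rewrite /dot mulr_sumr -big_split; apply: eq_bigr => i _ /=; rewrite !mxE; ring.
Qed.

Lemma dot0r u : dot u 0 = 0.
Proof. by rewrite /dot big1 // => i _; rewrite mxE mulr0. Qed.

Lemma dotDr u v w : dot u (v + w) = dot u v + dot u w.
Proof. by have := dot_linearr u 1 v w; rewrite scale1r mul1r. Qed.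

Lemma dotZr u c v : dot u (c *: v) = c * dot u v.
Proof. by have := dot_linearr u c v 0; rewrite dot0r !addr0. Qed.

Lemma exists_orthogonal (u v w : 'rV[K]_4) :
  exists r, [/\ r != 0, dot u r = 0, dot v r = 0 & dot w r = 0].
Proof.
pose M := col_mx u (col_mx v w).
have : kermx M^T != 0.
  rewrite kermx_eq0 /row_free; apply/eqP => E.
  by have := rank_leq_col M^T; rewrite E.
case/rowV0Pn => r /sub_kermxP rM nr; exists r; split=> //.
- have : r *m u^T = 0.
    by move: rM; rewrite /M tr_col_mx mul_mx_row => /(congr1 lsubmx); rewrite row_mxKl linear0.
  by rewrite dotC -dotE => ->; rewrite mxE.
- have : r *m v^T = 0.
    move: rM; rewrite /M tr_col_mx mul_mx_row => /(congr1 rsubmx).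
    by rewrite row_mxKr tr_col_mx mul_mx_row => /(congr1 lsubmx); rewrite row_mxKl !linear0.
  by rewrite dotC -dotE => ->; rewrite mxE.
- have : r *m w^T = 0.
    move: rM; rewrite /M tr_col_mx mul_mx_row => /(congr1 rsubmx).
    by rewrite row_mxKr tr_col_mx mul_mx_row => /(congr1 rsubmx); rewrite row_mxKr !linear0.
  by rewrite dotC -dotE => ->; rewrite mxE.
Qed.

Lemma dependent_in_plane (h x0 x1 x2 x3 : 'rV[K]_4) : h != 0 ->
  dot h x0 = 0 -> dot h x1 = 0 -> dot h x2 = 0 -> dot h x3 = 0 ->
  exists c0 c1 c2 c3, (c0, c1, c2, c3) <> (0, 0, 0, 0) /\
    c0 *: x0 + c1 *: x1 + c2 *: x2 + c3 *: x3 = 0.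
Proof.
move=> nh e0 e1 e2 e3.
pose X (i : 'I_4) := nth 0 [:: x0; x1; x2; x3] i.
pose M : 'M[K]_4 := \matrix_i X i.
have hM : h *m M^T = 0.
  apply/rowP => i; rewrite !mxE.
  have -> : \sum_j h 0 j * M^T j i = dot h (X i) by apply: eq_bigr => j _; rewrite !mxE.
  by case: i => -[|[|[|[|//]]]].
have nf : ~~ row_free M^T.
  by apply/negP => rf; case/eqP: nh; apply: (row_free_mulKl rf hM).
have : kermx M != 0.
  rewrite kermx_eq0; apply: contra nf; rewrite -!row_leq_rank mxrank_tr //.
case/rowV0Pn => c /sub_kermxP cM nc.
exists (c 0 ord0), (c 0 (lift ord0 ord0)), (c 0 (lift ord0 (lift ord0 ord0))),
  (c 0 (lift ord0 (lift ord0 (lift ord0 ord0)))); split.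
  case=> c0 c1 c2 c3; case/eqP: nc; apply/rowP => i; rewrite [RHS]mxE.
  case: (unliftP ord0 i) => [j ->|->//].
  case: (unliftP ord0 j) => [l ->|->//].
  case: (unliftP ord0 l) => [n ->|->//].
  by rewrite (ord1 n).
move: cM; rewrite mulmx_sum_row !big_ord_recl big_ord0 addr0 !rowK /X /=.
by rewrite !addrA.
Qed.

End LinearAlgebra.

(** * Two curves meeting in the greatest possible number of points *)

Section PointsOfPair.
Variable K : fieldType.
Hypothesis Kinf : injective (fun n : nat => n%:R : K).
Local Notation S := {mpoly K[4]}.
Local Notation hc := (pihomog mdeg).
Variables (P Q : set S) (p q : nat) (cP : curve_point P p) (cQ : curve_point Q q).
Hypotheses (nPQ : ~ P `<=` Q) (nQP : ~ Q `<=` P).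
Variables (k : nat) (z : 'I_k -> set S) (zinj : injective z).
Hypotheses (zP : forall i, zeros P (z i)) (zQ : forall i, zeros Q (z i)).
Let pP := curve_point_proj cP.
Let pQ := curve_point_proj cQ.
Let hP := point_ideal pP.
Let hQ := point_ideal pQ.
Let pz i : proj_point (z i). Proof. by case: (zP i). Qed.
Let hz i : homogeneous_ideal (z i) := point_ideal (pz i).
Local Notation J := (ideal_add P Q).
Let hJ : homogeneous_ideal J := ideal_add_homogeneous hP hQ.
Let PJ : P `<=` J. Proof. exact: ideal_add_subl. Qed.
Let QJ : Q `<=` J. Proof. exact: ideal_add_subr. Qed.

Lemma pair_point_ne i : z i <> P.
Proof. by move=> E; apply: nQP; rewrite -E; case: (zQ i). Qed.

Lemma pair_points_incomparable i j : i != j -> ~ z j `<=` z i.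
Proof.
move=> ne sub; case/eqP: ne; apply: zinj.
by apply: (curve_point_max cP) sub => //; [case: (zP j)|apply: pair_point_ne].
Qed.

Lemma pair_zeros i : zeros J (z i).
Proof. by split=> //; apply: ideal_add_min => //; [case: (zP i)|case: (zQ i)]. Qed.

Lemma sum_hilb_points_ge t : (k <= \sum_(i < k) hilb (z i) t)%N.
Proof.
rewrite -[X in (X <= _)%N]card_ord -sum1_card; apply: leq_sum => i _.
exact: hilb_point_gt0.
Qed.

Lemma pair_points_le : (k <= p * q)%N.
Proof.
have [N NP] := bezout_hilb Kinf cP cQ nPQ.
have [d dP] := points_hilb_sum hJ pair_zeros pair_points_incomparable.
apply: leq_trans (NP (N + d)%N _); last by lia.
exact: leq_trans (sum_hilb_points_ge _) (dP N).
Qed.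

Section Maximal.
Hypothesis kpq : k = (p * q)%N.

Lemma pair_hilb : exists T, forall t, (T <= t)%N -> hilb J t = k.
Proof.
have [N NP] := bezout_hilb Kinf cP cQ nPQ.
have [d dP] := points_hilb_sum hJ pair_zeros pair_points_incomparable.
exists (N + d)%N => t le; apply/eqP; rewrite eqn_leq {1}kpq NP /=; last by lia.
apply: leq_trans (sum_hilb_points_ge (t - d)) _.
by apply: leq_trans (dP _) _; rewrite subnK //; lia.
Qed.

(** The Hilbert functions of the [k] points are each at least 1 and in some degree sum to at most
    [k], so each of them equals 1 there. *)
Lemma pair_point_rational i : exists (zeta : 'rV[K]_4) j, zeta 0 j = 1 /\ z i = pt zeta.
Proof.
have [N NP] := bezout_hilb Kinf cP cQ nPQ.
have [d dP] := points_hilb_sum hJ pair_zeros pair_points_incomparable.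
apply: (@rational_point K (z i) N.+1) => //.
have := leq_trans (dP N.+1) (NP (N.+1 + d)%N _); rewrite -kpq => /(_ _); move=> H.
have {}H : (\sum_(i < k) hilb (z i) N.+1 <= k)%N by apply: H; lia.
have {}H : (hilb (z i) N.+1 + \sum_(j < k | j != i) hilb (z j) N.+1 <= k)%N.
  by move: H; rewrite (bigD1 i).
have le1 : (k.-1 <= \sum_(j < k | j != i) hilb (z j) N.+1)%N.
  have -> : k.-1 = #|predC1 i| by rewrite cardC1 card_ord.
  by rewrite -sum1_card; apply: leq_sum => j _; apply: hilb_point_gt0.
have gt0 := hilb_point_gt0 N.+1 (pz i).
move: (\sum_(j < k | _) _)%N H le1 => s H le1; lia.
Qed.

(** The ideal [Z] of all the points contains [J], and its Hilbert function is at least [k], which is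
    that of [J] in large degree; the two ideals therefore agree there. *)
Lemma pair_vanishing : exists T, forall t F, (T <= t)%N -> F \is t.-homog ->
  (forall i, z i F) -> J F.
Proof.
pose Z : set S := [set f | forall i, z i f].
have hZ : homogeneous_ideal Z.
  split=> [i|f g Zf Zg i|f g Zg i|f d Zf i].
  - exact: hideal0.
  - by apply: hidealD.
  - by apply: hidealM.
  - exact: hideal_pihomog.
have JZ : J `<=` Z by move=> f Jf i; case: (pair_zeros i) => _; apply.
have zZ i : zeros Z (z i) by split=> // f; apply.
have [d dP] := points_hilb_sum hZ zZ pair_points_incomparable.
have [T TP] := pair_hilb; exists (T + d)%N => t F le hF ZF.
apply: (hilb_eq_forms hJ hZ JZ _ hF ZF); apply/eqP; rewrite eqn_leq (hilb_le hJ hZ JZ) andbT.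
rewrite TP; last by lia.
apply: leq_trans (sum_hilb_points_ge (t - d)) _.
by apply: leq_trans (dP _) _; rewrite subnK //; lia.
Qed.

Lemma pair_separator i : exists d c, [/\ c \is d.-homog, ~ z i c & forall j, j != i -> z j c].
Proof.
have [d [c cP']] := separating_forms pz pair_points_incomparable.
by exists d, (c i); case: (cP' i).
Qed.

(* A tangent direction [v] of [X] at a point of the intersection cannot lie in a plane that
   contains the other curve but not [X]: the plane would meet [X] in too many points. *)
Lemma plane_section_contradiction (X : set S) x (l : S) (v zeta : 'rV[K]_4) :
  curve_point X x -> X `<=` J -> (x <= k)%N -> l \is 1.-homog -> ~ X l -> J l ->
  (forall f, X f -> dev v zeta f = 0) -> (forall f, X f -> ev zeta f = 0) ->
  ev zeta l = 0 -> dev v zeta l = 0 ->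
  (exists T, forall t, (T <= t)%N -> exists F, [/\ F \is t.-homog, J F & dev v zeta F <> 0]) -> False.
Proof.
move=> cX XJ lex hl nXl Jl dX eX el dl [T TP].
have hX := point_ideal (curve_point_proj cX).
have hXl : homogeneous_ideal (ideal_add_form X l) by apply: ideal_add_form_homogeneous hl.
have [T1 hilbXl] := hilb_section cX hl nXl; have [T2 hilbJ] := pair_hilb.
pose t := (T + T1 + T2)%N; have [|F [hF JF nF]] := TP t; first by rewrite /t; lia.
have sub : ideal_add_form X l `<=` J by apply: ideal_add_form_min.
apply: nF; have [] : ideal_add_form X l F.
  apply: (hilb_eq_forms hXl hJ sub _ hF JF).
  apply/eqP; rewrite eqn_leq (hilb_le hXl hJ sub) andbT hilbXl ?hilbJ ?mul1n //; rewrite /t; lia.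
move=> a [c [Xa ->]]; rewrite devD devM dX // el dl !mulr0 !addr0 //.
Qed.

(** [F] is a linear form through [zeta] times a form that vanishes at the other points and not at
    [zeta]. The condition on [v] says that the linear form has a nonzero derivative along [v]. *)
Lemma transversal_form i j0 (zeta v : 'rV[K]_4) j : z i = pt zeta -> zeta 0 j0 = 1 ->
  v 0 j != zeta 0 j * v 0 j0 ->
  exists T, forall t, (T <= t)%N -> exists F, [/\ F \is t.-homog, forall i', z i' F,
    ev zeta F = 0 & dev v zeta F != 0].
Proof.
move=> zi z1 nv; have [d [c [hc0 nc cz]]] := pair_separator i.
exists (1 + d)%N => t le; pose y : S := 'X_j - zeta 0 j *: 'X_j0.
have hy : y \is 1.-homog by apply: rpredB; [|apply: rpredZ]; apply: form_X.
have ey : ev zeta y = 0 by rewrite /y evD -scaleNr evZ !evX z1 mulr1 addrN.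
pose F := y * (c * 'X_j0 ^+ (t - (1 + d))).
have hF : F \is t.-homog.
  have := dhomogM hy (dhomogM hc0 (form_Xn K j0 (t - (1 + d)))).
  by have -> : (1 + (d + (t - (1 + d))) = t)%N by lia.
have eF : ev zeta F = 0 by rewrite evM ey mul0r.
exists F; split; [exact: hF| |exact: eF|].
  move=> i'; have [->|ne] := eqVneq i' i; first by rewrite zi; apply: (proj2 (pt_form _ hF)).
  by apply: (hidealM (hz i')); apply: (hidealMr (hz i')); apply: cz.
rewrite devM ey mul0r addr0 evM evXn evX z1 expr1n mulr1 mulf_neq0 //.
  by rewrite /y devD -scaleNr devZ !devX mulNr subr_eq0.
by apply/eqP => /(proj2 (pt_form zeta hc0)); rewrite -zi.
Qed.

Lemma dev0v (zeta : 'rV[K]_4) f : dev 0 zeta f = 0.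
Proof. by rewrite /dev big1 // => i _; rewrite mxE mul0r. Qed.

Opaque ev dev pt ideal_add crd pihomog hilb lform lft ideal_add_form.

Theorem coplanar_pair : exists h : 'rV[K]_4, [/\ h != 0, P (lform h) & Q (lform h)].
Proof.
have k0 : (0 < k)%N.
  by rewrite kpq muln_gt0 (curve_point_pos cP) (curve_point_pos cQ).
pose i0 := Ordinal k0.
have [zeta [j0 [zj0 zE]]] := pair_point_rational i0.
have Pz : P `<=` pt zeta by rewrite -zE; case: (zP i0).
have Qz : Q `<=` pt zeta by rewrite -zE; case: (zQ i0).
have nPz : pt zeta <> P by rewrite -zE; apply: pair_point_ne.
have nQz : pt zeta <> Q by move=> E; apply: nPQ; rewrite -E.
have [vP [vP0 nvP tP]] := exists_tangent pP zj0 Pz nPz.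
have [vQ [vQ0 nvQ tQ]] := exists_tangent pQ zj0 Qz nQz.
(* The candidate plane passes through [zeta] and contains both tangent directions there. *)
have [h [nh hz0 hvP hvQ]] := exists_orthogonal zeta vP vQ.
rewrite dotC in hz0; rewrite dotC in hvP; rewrite dotC in hvQ.
have elh : ev zeta (lform h) = 0 by rewrite ev_lform -/(dot h zeta).
have dlh v : dev v zeta (lform h) = dot h v by rewrite dev_lform.
have hl0 := form_lform h.
have /rV0Pn[jP njP] := nvP; have /rV0Pn[jQ njQ] := nvQ.
have ntP : vP 0 jP != zeta 0 jP * vP 0 j0 by rewrite vP0 mulr0.
have ntQ : vQ 0 jQ != zeta 0 jQ * vQ 0 j0 by rewrite vQ0 mulr0.
have [TV vanish] := pair_vanishing.
have testF (v : 'rV[K]_4) j : v 0 j != zeta 0 j * v 0 j0 -> exists T, forall t, (T <= t)%N ->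
    exists F, [/\ F \is t.-homog, J F & dev v zeta F <> 0].
  move=> nv; have [T TP] := transversal_form zE zj0 nv; exists (TV + T)%N => t le.
  have [|F [hF ZF _ nF]] := TP t; first by clear -le; lia.
  exists F; split; [exact: hF|apply: (vanish t F _ hF ZF); clear -le; lia|exact: (elimN eqP nF)].
(* If neither curve lay in the plane, [lform h] could serve as [l0] of the pencil; this choice makes
   the tangent vectors and [r] below dependent. *)
have nPQ0 : P (lform h) \/ Q (lform h).
  apply: contrapT => /not_orP[nP0 nQ0].
  have [d [f [hf Pf nQf]]] := not_subset_form hQ hP nPQ.
  have [v1 [axP axQ noQ]] := choose_pencil Kinf cP cQ hf nQf hl0 nP0 nQ0.
  set l1 := lform v1 in axP axQ noQ; have hl1 : l1 \is 1.-homog by apply: form_lform.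
  have [u2 [u3 span]] := pencil_span cP axP.
  have [T TP] := bezout_bilinear Kinf cP cQ hl0 hl1 axP axQ hf Pf nQf noQ (form_lform u2) (form_lform u3) span.
  have [N NP] := ideal_add_span hP hQ hf Pf hl1 noQ.
  have [TJ hilbJ] := pair_hilb.
  have [TPt testP] := transversal_form zE zj0 ntP.
  have [TQt testQ] := transversal_form zE zj0 ntQ.
  pose B := (T + N + TJ + TPt + TQt + TV).+1.
  have [||mu muP] := TP B.+1 B.+1; [by rewrite /B; clear; lia|by rewrite /B; clear; lia|].
  set m := mu *: lform u3 + lform u2 in muP.
  have Em : m = lform (mu *: u3 + u2) by rewrite /m linearP.
  (* [r] is the common zero of [l0], [l1] and [m]. Since [l0] is [lform h], the vectors [zeta],
     [vP], [vQ] and [r] all lie in the three-dimensional space orthogonal to [h], whence a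
     relation. *)
  have [r [nr hr0 hr1 hr2]] := exists_orthogonal h v1 (mu *: u3 + u2).
  have [c0 [c1 [c2 [c3 [nc Ec]]]]] := dependent_in_plane nh hz0 hvP hvQ hr0.
  have el1E : ev zeta l1 = dot v1 zeta by rewrite ev_lform.
  have el1 : ev zeta l1 != 0.
    apply/eqP => e1; apply: (axP (pt zeta) _ Pz).
    - by apply: (pt_point (i := j0)); rewrite zj0 oner_neq0.
    - exact: (proj2 (pt_form zeta hl0)).
    - exact: (proj2 (pt_form zeta hl1)).
  (* Otherwise [zeta] and [r] alone would be dependent, but [l1] vanishes at [r] and not at
     [zeta]. *)
  have c12 : c1 != 0 \/ c2 != 0.
    apply: contrapT => /not_orP[/negP/negPn/eqP e1 /negP/negPn/eqP e2].
    have Er : c0 *: zeta + c3 *: r = 0 by rewrite -Ec e1 e2 !scale0r !addr0.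
    have e0 : c0 = 0.
      have := congr1 (dot v1) Er; rewrite dotDr !dotZr hr1 mulr0 addr0 dot0r => /eqP.
      rewrite mulf_eq0 => /orP[/eqP//|]; rewrite -el1E => e1'.
      by move: el1; rewrite e1'.
    have e3 : c3 = 0.
      by move: Er => /eqP; rewrite e0 scale0r add0r scaler_eq0 (negPf nr) orbF => /eqP.
    by apply: nc; rewrite e0 e1 e2 e3.
  (* The relation is split into a part tangent to [P] and a part tangent to [Q]. The multiple of
     [zeta] is harmless in [wP]: by Euler's relation it kills forms vanishing at [zeta]. *)
  pose wP := c1 *: vP + c0 *: zeta; pose wQ := - c2 *: vQ.
  have wPQ : wP - wQ = - c3 *: r.
    by rewrite /wP /wQ !scaleNr opprK; apply/eqP; rewrite -addr_eq0 [c1 *: vP + _]addrC Ec.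
  have dP f0 : P f0 -> dev wP zeta f0 = 0.
    move=> Pf0; rewrite /wP dev_linearl tP // mulr0 add0r.
    have := dev_linearl c0 zeta 0 zeta f0; rewrite addr0 => ->.
    rewrite pt_dev_self ?mulr0 ?add0r; last exact: Pz.
    exact: dev0v.
  have devZl c v f0 : dev (c *: v) zeta f0 = c * dev v zeta f0.
    rewrite -[c *: v]addr0 dev_linearl -[RHS]addr0; congr (_ + _).
    exact: dev0v.
  have dQ f0 : Q f0 -> dev wQ zeta f0 = 0 by move=> Qf0; rewrite devZl tQ // mulr0.
  have eP f0 : P f0 -> ev zeta f0 = 0 by move/Pz/pt_ev.
  have eQ f0 : Q f0 -> ev zeta f0 = 0 by move/Qz/pt_ev.
  (* The derivative of [f0 (x) g0] along [(wP, wQ)]; it kills [l1 (x) m - m (x) l1] because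
     [wP - wQ] is a multiple of [r], on which both [l1] and [m] vanish. *)
  pose psi f0 g0 := dev wP zeta f0 * ev zeta g0 + ev zeta f0 * dev wQ zeta g0.
  pose nn := (B.+1 + B.+1)%N.
  pose b f0 g0 : 'rV[K]_(hilb J nn + 1) := row_mx (crd J nn (f0 * g0)) (const_mx (psi f0 g0)).
  have hb : bilinear_mod P Q b.
    split=> [g0 c x y|g0 c x y|x y Px|x y Qy]; rewrite /b.
    - rewrite scale_row_mx add_row_mx mulrDl -scalerAl linearP; congr row_mx.
      by apply/rowP => i; rewrite !mxE /psi dev_linear evD evZ; ring.
    - rewrite scale_row_mx add_row_mx mulrDr -scalerAr linearP; congr row_mx.
      by apply/rowP => i; rewrite !mxE /psi dev_linear evD evZ; ring.
    - rewrite (crd_ideal hJ); last exact: (hidealMr hJ _ (PJ Px)).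
      rewrite /psi (dP _ Px) (eP _ Px) !mul0r addr0.
      by apply/rowP => i; rewrite !mxE; case: splitP => j _; rewrite mxE.
    - rewrite (crd_ideal hJ); last exact: (hidealM hJ _ (QJ Qy)).
      rewrite /psi (dQ _ Qy) (eQ _ Qy) !mulr0 addr0.
      by apply/rowP => i; rewrite !mxE; case: splitP => j _; rewrite mxE.
  have wdiff u : dot u r = 0 -> dot u wP = dot u wQ.
    move=> ur; have := congr1 (dot u) wPQ; rewrite dotZr ur mulr0 -scaleN1r dotDr dotZr mulN1r.
    by move/eqP; rewrite subr_eq0 => /eqP.
  have symm (u : 'rV[K]_4) : dot u r = 0 ->
      forall x y, b (l1 * x) (lform u * y) = b (lform u * x) (l1 * y).
    move=> ur x y; rewrite /b; congr row_mx; first by congr (crd _ _ _); ring.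
    congr const_mx; rewrite /psi !devM !evM.
    have d1 w : dev w zeta l1 = dot v1 w by rewrite dev_lform.
    have du w : dev w zeta (lform u) = dot u w by rewrite dev_lform.
    rewrite !d1 !du (wdiff _ ur) (wdiff _ hr1); ring.
  have bound : (hilb J nn + 1 <= p * q)%N.
    apply: (muP _ b hb) => [||v].
    - exact: symm.
    - by rewrite Em; apply: symm.
    pose att := @attained K P Q l1 _ b B.+1 B.+1.
    have attlin := @attained_linear K P Q l1 _ b B.+1 B.+1.
    (* The extra coordinate alone is attained: a transversal form [F] of high degree lies in [J], so
       the first block vanishes, while its derivative along [vP] or [vQ] does not. Which side
       carries [F] depends on which of [c1] and [c2] is nonzero. *)
    have att1 : exists2 s, s != 0 & att (row_mx 0 (const_mx s)).
      have evXj n : ev zeta ('X_j0 ^+ n) = 1 by rewrite evXn evX zj0 expr1n.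
      have killJ (x y : S) : (x \is B.-homog /\ y \is B.+1.-homog) \/ (x \is B.+1.-homog /\ y \is B.-homog) ->
          (forall i, z i (x * y)) -> crd J nn (l1 * x * y) = 0.
        move=> hxy Zxy; apply: (crd_ideal hJ); rewrite -mulrA; apply: (hidealM hJ).
        have hxy' : x * y \is (B + B).+1.-homog.
          by case: hxy => -[hx hy]; have := dhomogM hx hy; rewrite ?addnS ?addSn.
        by apply: (vanish (B + B).+1 _ _ hxy' Zxy); rewrite /B; clear; lia.
      case: c12 => nc12.
        have [|F [hF ZF eF nF]] := testP B; first by rewrite /B; clear; lia.
        exists (psi (l1 * F) ('X_j0 ^+ B.+1)); last first.
          have := attained_l cP cQ hl1 hb hF (form_Xn K j0 B.+1).
          rewrite /b killJ //; first by left; split=> //; apply: form_Xn.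
          by move=> i; apply: hidealMr.
        rewrite /psi devM evM eF evXj !(mulr0, mul0r, mulr1, add0r, addr0).
        by rewrite mulf_neq0 // /wP dev_linearl devZl (pt_dev_self) ?mulr0 ?addr0 ?mulf_neq0 //; rewrite -zE.
      have [|F [hF ZF eF nF]] := testQ B; first by rewrite /B; clear; lia.
      exists (psi ('X_j0 ^+ B.+1) (l1 * F)); last first.
        have := attained_r cP cQ hl1 hb (form_Xn K j0 B.+1) hF.
        rewrite /b [_ * (l1 * _)]mulrC killJ //; first by left; split=> //; apply: form_Xn.
        by move=> i; apply: hidealMr.
      rewrite /psi devM evM eF evXj !(mulr0, mul0r, mul1r, add0r, addr0).
      by rewrite mulf_neq0 // /wQ devZl mulf_neq0 // oppr_eq0.
    have [s1 ns1 As1] := att1.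
    have hF := lft_form hJ (lsubmx v); set F := lft _ nn _ in hF.
    have [||G [hG JG]] := NP nn.-1 F; [by rewrite /nn /B; clear; lia|by rewrite prednK // /nn; clear; lia|].
    have EF : lsubmx v = crd J nn (l1 * G).
      by rewrite -[LHS](lftK hJ) -/F; apply/eqP; rewrite -subr_eq0 -linearB /= crd_ideal.
    (* Any class is attained together with some uncontrolled extra coordinate [s], which a multiple
       of the vector from [att1] then corrects. *)
    have [s As] : exists s, att (row_mx (crd J nn (l1 * G)) (const_mx s)).
      apply: (@forms_span K [set G | exists s, att (row_mx (crd J nn (l1 * G)) (const_mx s))] B B.+1) => //.
      - split=> /=.
          exists 0; rewrite mulr0 linear0.
          have -> : row_mx 0 (const_mx 0) = 0 :> 'rV[K]_(hilb J nn + 1).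
            by rewrite -[RHS]row_mx0; congr row_mx; apply/rowP => i; rewrite !mxE.
          exact: attained0.
        move=> c x y [s Ax] [s' Ay]; exists (c * s + s').
        have := attlin c _ _ Ax Ay; rewrite scale_row_mx add_row_mx -linearP /=.
        rewrite -[l1 * (_ + _)]/(l1 * (c *: x + y)) mulrDr -scalerAr.
        by congr (att (row_mx _ _)); apply/rowP => i; rewrite !mxE.
      - move=> x y hx hy /=; exists (psi (l1 * x) y); rewrite mulrA.
        exact: (attained_l cP cQ hl1 hb).
    have := attlin ((rsubmx v 0 0 - s) / s1) _ _ As1 As.
    rewrite scale_row_mx add_row_mx scaler0 add0r -EF.
    suff -> : ((rsubmx v 0 0 - s) / s1) *: const_mx s1 + const_mx s = rsubmx v by rewrite hsubmxK.
    by apply/rowP => i; rewrite !mxE ord1 divfK // subrK.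
  by move: bound; rewrite hilbJ -?kpq; [clear; lia|rewrite /nn /B; clear; lia].
have q0 := curve_point_pos cQ; have p0 := curve_point_pos cP.
have [P0|nP0] := pselect (P (lform h)).
  have [Q0|nQ0] := pselect (Q (lform h)); first by exists h.
  exfalso; apply: (plane_section_contradiction (X := Q) (x := q) (l := lform h) (v := vQ) (zeta := zeta)) => //.
  - by rewrite kpq leq_pmull.
  - exact: PJ.
  - by move=> f /Qz /pt_ev.
  - by rewrite dlh.
  - by apply: (testF _ jQ).
have Q0 : Q (lform h) by case: nPQ0.
exfalso; apply: (plane_section_contradiction (X := P) (x := p) (l := lform h) (v := vP) (zeta := zeta)) => //.
- by rewrite kpq leq_pmulr.
- exact: QJ.
- by move=> f /Pz /pt_ev.
- by rewrite dlh.
- by apply: (testF _ jP).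
Qed.

End Maximal.
End PointsOfPair.

(** * Lines, and finite unions of curves *)

Section LinesAndCurves.
Variable K : fieldType.
Local Notation S := {mpoly K[4]}.
Local Notation hc := (pihomog mdeg).

Lemma form0_const (f : S) : f \is 0.-homog -> exists c, f = c%:MP.
Proof.
move=> hf; exists f@_0%MM; apply/mpolyP => m; rewrite mcoeffC.
case: (eqVneq m 0%MM) => [->|ne]; first by rewrite mulr1.
by rewrite (dhomog_nemf_coeff hf) ?mulr0 // mdeg_eq0.
Qed.

Lemma lform_inj : injective (@lform K).
Proof.
move=> u v E; apply/rowP => i; have := congr1 (fun f : S => f@_U_(i)) E.
have coef w : (lform w)@_U_(i) = w 0 i.
  rewrite /lform raddf_sum (bigD1 i) //= big1 ?addr0 => [|j ne].
    by rewrite mcoeffZ mcoeffX eqxx mulr1.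
  by rewrite mcoeffZ mcoeffXU (negPf ne) mulr0.
by rewrite !coef.
Qed.

Lemma ideal2_lform (u v w : 'rV[K]_4) : ideal2 (lform u) (lform v) (lform w) ->
  exists c d, w = c *: u + d *: v.
Proof.
case=> [f [g E]].
have E1 : lform w = hc 0 f * lform u + hc 0 g * lform v.
  rewrite -(pihomog_dE (form_lform w)) E pihomogD.
  by rewrite ![_ * lform _]mulrC -!(pihomog_mull 0 _ (form_lform _)) !addn0.
have [c Ec] := form0_const (pihomogP mdeg 0 f).
have [d Ed] := form0_const (pihomogP mdeg 0 g).
exists c, d; apply: lform_inj; rewrite E1 Ec Ed !mul_mpolyC.
by rewrite linearD !linearZ.
Qed.

Lemma ideal2E (f g : S) : ideal2 f g = ideal_add_form (ideal_add_form [set 0] f) g.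
Proof.
apply/seteqP; split=> [h [u [v ->]]|h [x [v [[y [u [-> ->]]] ->]]]].
  by exists (u * f), v; split=> //; exists 0, u; rewrite add0r.
by exists u, v; rewrite add0r.
Qed.

Lemma ideal2_homogeneous (u v : 'rV[K]_4) : homogeneous_ideal (ideal2 (lform u) (lform v)).
Proof.
rewrite ideal2E; do 2!(apply: ideal_add_form_homogeneous (form_lform _)).
exact: zero_homogeneous_ideal.
Qed.

Lemma ideal2_min (I : set S) f g : homogeneous_ideal I -> I f -> I g -> ideal2 f g `<=` I.
Proof. by move=> hI If Ig _ [u [v ->]]; apply: hidealD => //; apply: hidealM. Qed.

Lemma ideal2_l (f g : S) : ideal2 f g f.
Proof. by exists 1, 0; rewrite mul1r mul0r addr0. Qed.

Lemma ideal2_r (f g : S) : ideal2 f g g.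
Proof. by exists 0, 1; rewrite mul1r mul0r add0r. Qed.

Lemma hilb0_le1 (I : set S) : homogeneous_ideal I -> (hilb I 0 <= 1)%N.
Proof.
move=> hI; apply: (@hilb_le_span K I hI 0 1 (fun=> 1)) => [_|f hf]; first exact: dhomog1.
have [c ->] := form0_const hf; exists (fun=> c).
by rewrite big_ord1 -mul_mpolyC mulr1 subrr; apply: hideal0.
Qed.

Lemma hilb_le_line (u v : 'rV[K]_4) t : row_free (col_mx u v) ->
  (hilb (ideal2 (lform u) (lform v)) t <= t.+1)%N.
Proof.
move=> rf; have [u2 [u3 span]] := complete_pencil rf.
have hI := ideal2_homogeneous u v; set I := ideal2 _ _ in hI *.
pose I1 := ideal_add_form I (lform u2); pose I2 := ideal_add_form I1 (lform u3).
have hI1 : homogeneous_ideal I1 by apply: ideal_add_form_homogeneous (form_lform _).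
have hI2 : homogeneous_ideal I2 by apply: ideal_add_form_homogeneous (form_lform _).
have II1 : I `<=` I1 by apply: ideal_add_form_sub.
have I12 : I1 `<=` I2 by apply: ideal_add_form_sub.
have I2X (i : 'I_4) : I2 'X_i.
  have [c Ec] := span (delta_mx 0 i); rewrite -lform_delta Ec !linearD !linearZ /=.
  apply: hidealD => //; first by apply: hideal_scale => //; apply/I12/II1/ideal2_l.
  apply: hidealD => //; first by apply: hideal_scale => //; apply/I12/II1/ideal2_r.
  apply: hidealD => //; apply: hideal_scale => //; last exact: ideal_add_form_gen.
  exact/I12/ideal_add_form_gen.
have h2 s : hilb I2 s.+1 = 0%N.
  apply: hilb_eq0 => // f hf; apply: contrapT => nf.
  by have [i []] := variable_notin hI2 hf nf.
have h1 s : (hilb I1 s <= 1)%N.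
  elim: s => [|s IH]; first exact: hilb0_le1.
  by have := hilb_le_add s hI1 (form_lform u3); rewrite addn1 -/I2 h2; move: IH; clear; lia.
elim: t => [|t IH]; first exact: hilb0_le1.
have := hilb_le_add t hI (form_lform u2); rewrite addn1 -/I1.
by move: (h1 t.+1) IH; clear; lia.
Qed.

(** The Hilbert function of a curve is at least [t.+1] and that of the line is at most [t.+1], so
    the two ideals agree in every degree. *)
Lemma line_of_forms (P : set S) p (u v : 'rV[K]_4) : curve_point P p ->
  row_free (col_mx u v) -> P (lform u) -> P (lform v) ->
  P = ideal2 (lform u) (lform v) /\ p = 1%N.
Proof.
move=> cP rf Pu Pv; have hP := point_ideal (curve_point_proj cP).
have hI := ideal2_homogeneous u v; have IP := ideal2_min hP Pu Pv.
have [w [pw Pw ne]] := curve_point_nonclosed cP.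
have hilbP t : hilb P t = t.+1.
  apply/eqP; rewrite eqn_leq (hilb_nonclosed _ (curve_point_proj cP) pw Pw ne) andbT.
  exact: leq_trans (hilb_le hI hP IP t) (hilb_le_line t rf).
split; last first.
  by have [N NP] := curve_point_growth cP; have := NP N (leqnn N); rewrite !hilbP; clear; lia.
apply/seteqP; split=> // f Pf; apply: (hideal_forms hI) => d.
apply: (hilb_eq_forms hI hP IP _ (pihomogP mdeg d f)); last exact: hideal_pihomog.
apply/eqP; rewrite eqn_leq (hilb_le hI hP IP) hilbP andbT; exact: hilb_le_line.
Qed.

Definition has_line_forms (P : set S) :=
  exists u v : 'rV[K]_4, [/\ row_free (col_mx u v), P (lform u) & P (lform v)].

Lemma row_free_pair (u v : 'rV[K]_4) :
  (forall c d, c *: u + d *: v = 0 -> c = 0 /\ d = 0) -> row_free (col_mx u v).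
Proof.
move=> ind; rewrite -kermx_eq0; apply/rowV0P => r /sub_kermxP.
rewrite -[r]hsubmxK mul_row_col [lsubmx r]mx11_scalar [rsubmx r]mx11_scalar !mul_scalar_mx.
by case/ind => -> ->; apply/rowP => i; rewrite !mxE; case: splitP => j _; rewrite !mxE mul0rn.
Qed.

Lemma row_free_pairP (u v : 'rV[K]_4) c d : row_free (col_mx u v) ->
  c *: u + d *: v = 0 -> c = 0 /\ d = 0.
Proof.
move=> rf E; have E0 : row_mx c%:M d%:M *m col_mx u v = 0 *m col_mx u v.
  by rewrite mul_row_col !mul_scalar_mx E mul0mx.
have /eq_row_mx : row_mx c%:M d%:M = row_mx 0 0 :> 'rV_(1 + 1).
  by rewrite row_mx0; apply: row_free_inj E0.
case=> /(congr1 (fun M : 'M_1 => M 0 0)) + /(congr1 (fun M : 'M_1 => M 0 0)).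
by rewrite !mxE eqxx !mulr1n.
Qed.

Lemma not_row_free_pair (u v : 'rV[K]_4) : u != 0 -> ~~ row_free (col_mx u v) ->
  exists c, v = c *: u.
Proof.
move=> nu nf; apply: contrapT => none; case/negP: nf; apply: row_free_pair => c d E.
have d0 : d = 0.
  apply/eqP/negPn/negP => nd; apply: none; exists (- (d^-1 * c)).
  rewrite scaleNr -scalerA; apply: (scalerI nd).
  by rewrite scalerN scalerA divff // scale1r; apply/eqP; rewrite -addr_eq0 addrC E.
move/eqP: E; rewrite d0 scale0r addr0 scaler_eq0 (negPf nu) orbF => /eqP ->.
by [].
Qed.

Lemma curve_point_sub (P Q : set S) p q : curve_point P p -> curve_point Q q ->
  P `<=` Q -> Q = P.
Proof.
move=> cP cQ PQ; apply: contrapT => ne.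
have [w [pw Qw nw]] := curve_point_nonclosed cQ; apply: nw.
exact: (curve_point_max cP (curve_point_proj cQ) pw PQ ne Qw).
Qed.

(** If no [Q j] lay in [w], the product of elements of the [Q j] outside [w] would lie in all of
    them but not in the prime [w]. *)
Lemma prime_bigcap (T : finType) (D : pred T) (Q : T -> set S) w : proj_point w ->
  (forall j, homogeneous_ideal (Q j)) ->
  [set f | forall j, D j -> Q j f] `<=` w -> exists2 j, D j & Q j `<=` w.
Proof.
move=> pw hQ sub; apply: contrapT => none.
have ex j : exists f, D j -> Q j f /\ ~ w f.
  have [Dj|nD] := boolP (D j); last by exists 0.
  have /existsNP[f /not_implyP[Qf nf]] : ~ Q j `<=` w by move=> Qw; apply: none; exists j.
  by exists f.
pose f j := projT1 (cid (ex j)); have fP j := projT2 (cid (ex j)) : D j -> Q j (f j) /\ ~ w (f j).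
have /(point_prod pw)[j Dj wj] : w (\prod_(j | D j) f j).
  by apply: sub => j Dj; rewrite (bigD1 j) //=; apply: hidealMr => //; case: (fP j Dj).
by case: (fP j Dj).
Qed.

Lemma curve_point_dimension (P : set S) p : curve_point P p -> dimension P 1.
Proof.
move=> cP; have pP := curve_point_proj cP; split.
  have [w [pw Pw ne]] := curve_point_nonclosed cP.
  exists (fun i => if i is 0%N then P else w); split=> [[|i] _|[|i] //= _].
  + by split.
  + by split.
  + by split=> // wP; apply: ne; apply/seteqP.
case=> C [zC ltC].
have [p1 P1] := zC 1%N isT; have [p2 P2] := zC 2%N isT; have [p0 P0] := zC 0%N isT.
have [s01 n01] := ltC 0%N isT; have [s12 n12] := ltC 1%N isT.
apply: n12; rewrite -(curve_point_max cP p1 p2 P1 _ s12) // => E.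
by apply: n01; rewrite E.
Qed.

Lemma reduced_curve_bigcap (T : finType) (D : pred T) (Q : T -> set S) (q : T -> nat) j0 :
  (forall j, curve_point (Q j) (q j)) -> D j0 ->
  reduced_curve [set f | forall j, D j -> Q j f].
Proof.
move=> cQ D0; have pQ j := curve_point_proj (cQ j); have hQ j := point_ideal (pQ j).
split.
- split=> [j _|f g If Ig j Dj|f g Ig j Dj|f d If j Dj].
  + exact: hideal0.
  + by apply: hidealD => //; [apply: If|apply: Ig].
  + by apply: hidealM => //; apply: Ig.
  + by apply: hideal_pihomog => //; apply: If.
- by move/(_ j0 D0); apply: (point_proper (pQ j0)).
- move=> f IX j Dj; have [i ni] := point_relevant (pQ j).
  exact: (point_mem_mull (pQ j) ni (IX i j Dj)).
- by move=> f n In j Dj; apply: (point_exp (pQ j) (In j Dj)).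
move=> P [[pP IP] minP]; have [j Dj QP] := prime_bigcap pP hQ IP.
have <- : Q j = P.
  apply: minP => //; split; first exact: pQ.
  by move=> f; apply.
exact: curve_point_dimension (cQ j).
Qed.

Lemma reduced_curveI (A B : set S) : reduced_curve A -> reduced_curve B ->
  reduced_curve (A `&` B).
Proof.
move=> cA cB; have hA := curve_ideal cA; have hB := curve_ideal cB; split.
- split=> [|f g [Af Bf] [Ag Bg]|f g [Ag Bg]|f d [Af Bf]]; split;
    by [apply: hideal0|apply: hidealD|apply: hidealM|apply: hideal_pihomog].
- by case=> /(curve_proper cA).
- by move=> f IX; split; [apply: (curve_saturated cA)|apply: (curve_saturated cB)] => i; case: (IX i).
- by move=> f n [An Bn]; split; [apply: (curve_radical cA An)|apply: (curve_radical cB Bn)].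
move=> P [[pP IP] minP].
have [AP|nA] := pselect (A `<=` P).
  by apply: (curve_pure_dim1 cA); split=> // P' [pP' AP'] PP'; apply: minP => //; split=> // f [/AP'].
have [BP|nB] := pselect (B `<=` P).
  by apply: (curve_pure_dim1 cB); split=> // P' [pP' BP'] PP'; apply: minP => //; split=> // f [_ /BP'].
have [d [f [_ Af nf]]] := not_subset_form (point_ideal pP) hA nA.
have [e [g [_ Bg ng]]] := not_subset_form (point_ideal pP) hB nB.
case: (point_notinM pP nf ng); apply: IP; split; first exact: hidealMr.
exact: hidealM.
Qed.

End LinesAndCurves.

(** * The grid of components *)

Section Grid.
Variable K : fieldType.
Hypothesis Kinf : injective (fun n : nat => n%:R : K).
Local Notation S := {mpoly K[4]}.

(* What remains of two curves of degrees [a] and [b] meeting in [a * b] points: [P] and [Q]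
   enumerate their components. *)
Record grid k l (P : 'I_k -> set S) (p : 'I_k -> nat) (Q : 'I_l -> set S) (q : 'I_l -> nat) :
    Prop := Grid {
  grid_left : forall i, curve_point (P i) (p i);
  grid_right : forall j, curve_point (Q j) (q j);
  grid_injl : injective P;
  grid_injr : injective Q;
  grid_notinl : forall i j, ~ P i `<=` Q j;
  grid_notinr : forall i j, ~ Q j `<=` P i;
  grid_points : forall i j, exists z : 'I_(p i * q j) -> set S,
    injective z /\ forall s, zeros (P i) (z s) /\ zeros (Q j) (z s);
  grid_unique : forall i i' j j' w, zeros (P i) w -> zeros (P i') w ->
    zeros (Q j) w -> zeros (Q j') w -> i = i' /\ j = j' }.

Lemma grid_sym k l (P : 'I_k -> set S) p (Q : 'I_l -> set S) q : grid P p Q q -> grid Q q P p.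
Proof.
case=> cP cQ iP iQ nPQ nQP pts uniq; split=> //.
  move=> j i; rewrite mulnC; have [z [zi zz]] := pts i j.
  by exists z; split=> // s; case: (zz s).
by move=> j j' i i' w Qj Qj' Pi Pi'; case: (uniq i i' j j' w).
Qed.

Lemma sum_leq_eq (T : finType) (F G : T -> nat) : (forall x, F x <= G x)%N ->
  (\sum_x G x <= \sum_x F x)%N -> forall x, F x = G x.
Proof.
move=> le; have H := @leqif_sum T predT (fun x => F x == G x) F G.
have {H}[le1 E] := H (fun x _ => leqif_eq (le x)).
move=> le2 x; have : (\sum_x F x)%N == (\sum_x G x)%N by rewrite eqn_leq le1.
by rewrite E => /forallP/(_ x)/eqP.
Qed.

(** Count incidences between common points and pairs of components. Each point lies on at least one
    pair, each pair carries at most [p i * q j] points, and the degrees sum to at most [a] and [b];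
    so [m] is bounded by [a * b] through a chain of inequalities, and [m = a * b] makes all of them
    equalities. *)
Theorem grid_of_curves A B a b m : reduced_curve A -> curve_degree A a ->
  reduced_curve B -> curve_degree B b -> (forall X, component A X -> ~ component B X) ->
  (zeros A `&` zeros B #= `I_m)%card -> m = (a * b)%N ->
  exists k l (P : 'I_k -> set S) p (Q : 'I_l -> set S) q,
  [/\ grid P p Q q, (\sum_i p i = a)%N /\ (\sum_j q j = b)%N,
      forall f, A f <-> forall i, P i f & forall f, B f <-> forall j, Q j f].
Proof.
move=> cA dA cB dB ncc card_AB m_eq.
have [k [P [p [[injP compP] cP sumP AP]]]] := curve_components Kinf cA dA.
have [l [Q [q [[injQ compQ] cQ sumQ BQ]]]] := curve_components Kinf cB dB.
have nPQ i j : P i <> Q j.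
  move=> E; apply: (ncc (P i)); first by apply/compP; exists i.
  by rewrite E; apply/compQ; exists j.
have ncPQ i j : ~ P i `<=` Q j by move/(curve_point_sub (cP i) (cQ j)) => E; apply: (nPQ i j).
have ncQP i j : ~ Q j `<=` P i by move/(curve_point_sub (cQ j) (cP i)); apply: nPQ.
have pos (C : set S) n (R : 'I_n -> set S) (r : 'I_n -> nat) : reduced_curve C ->
    (forall X, component C X <-> exists i, R i = X) -> (forall i, curve_point (R i) (r i)) ->
    (0 < \sum_i r i)%N.
  move=> cC compR cR; have [X [zX _]] := curve_point_notin cC (curve_proper cC).
  have [X' [/compR[i _] _]] := component_below zX.
  by rewrite (bigD1 i) //= addn_gt0 (curve_point_pos (cR i)).
(* Positivity is what recovers [a] and [b] separately from the equality of products at the end. *)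
have a0 := pos _ _ _ _ cA compP cP; have b0 := pos _ _ _ _ cB compQ cQ.
have /card_set_bijP[f [fZ finj fsurj]] : (`I_m #= zeros A `&` zeros B)%card by rewrite card_eq_sym.
pose z (s : 'I_m) := f s.
have zZ s : (zeros A `&` zeros B) (z s) by apply: fZ; apply: (ltn_ord s).
have zinj : injective z.
  by move=> s s' E; apply/val_inj/finj => //; apply/mem_set; apply: ltn_ord.
have zsurj w : (zeros A `&` zeros B) w -> exists s, z s = w.
  by case/fsurj => n lt <-; exists (Ordinal lt).
have pz s : proj_point (z s) by case: (zZ s) => -[].
pose inc s (x : 'I_k * 'I_l) := `[< P x.1 `<=` z s >] && `[< Q x.2 `<=` z s >].
have incP s x : reflect (zeros (P x.1) (z s) /\ zeros (Q x.2) (z s)) (inc s x).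
  apply: (iffP andP) => [[/asboolP Px /asboolP Qx]|[[_ Px] [_ Qx]]]; first by split; split.
  by split; apply/asboolP.
pose n x := #|[pred s | inc s x]|; pose c s := #|[pred x | inc s x]|.
have sum_nc : (\sum_x n x = \sum_s c s)%N.
  under eq_bigr do rewrite /n -sum1_card big_mkcond /=.
  under [RHS]eq_bigr do rewrite /c -sum1_card big_mkcond /=.
  exact: exchange_big.
have n_pts x : exists y : 'I_(n x) -> set S,
    injective y /\ forall s, zeros (P x.1) (y s) /\ zeros (Q x.2) (y s).
  exists (fun s => z (enum_val s)); split=> [s s' /zinj/enum_val_inj//|s].
  exact/incP/(enum_valP s).
have n_le x : (n x <= p x.1 * q x.2)%N.
  have [y [yinj yz]] := n_pts x.
  exact: (pair_points_le Kinf (cP x.1) (cQ x.2) (ncPQ _ _) (ncQP _ _) yinj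
    (fun s => (yz s).1) (fun s => (yz s).2)).
have c_ge s : (1 <= c s)%N.
  have [[_ Az] [_ Bz]] := zZ s.
  have subP : [set g | forall i, predT i -> P i g] `<=` z s.
    by move=> g Pg; apply: Az; apply/AP => i; apply: Pg.
  have subQ : [set g | forall i, predT i -> Q i g] `<=` z s.
    by move=> g Qg; apply: Bz; apply/BQ => i; apply: Qg.
  have [i _ Pi] := prime_bigcap (pz s) (fun i => point_ideal (curve_point_proj (cP i))) subP.
  have [j _ Qj] := prime_bigcap (pz s) (fun i => point_ideal (curve_point_proj (cQ i))) subQ.
  by apply/card_gt0P; exists (i, j); apply/incP; split; split.
have sum_pq : (\sum_x p x.1 * q x.2 = (\sum_i p i) * (\sum_j q j))%N.
  rewrite big_distrl /= -(pair_bigA _ (fun i j => p i * q j)%N) /=.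
  by apply: eq_bigr => i _; rewrite big_distrr.
have le_pq : ((\sum_i p i) * (\sum_j q j) <= a * b)%N by apply: leq_mul.
have le_n : (\sum_x n x <= (\sum_i p i) * (\sum_j q j))%N by rewrite -sum_pq; apply: leq_sum.
have ge_m : (m <= \sum_s c s)%N.
  by rewrite -[X in (X <= _)%N]card_ord -sum1_card; apply: leq_sum.
have nE x : n x = (p x.1 * q x.2)%N.
  apply: (sum_leq_eq n_le); rewrite sum_pq sum_nc; apply: leq_trans ge_m; rewrite m_eq.
  exact: le_pq.
have cE s : 1%N = c s.
  apply: (sum_leq_eq c_ge); rewrite -sum_nc; apply: (leq_trans le_n); apply: (leq_trans le_pq).
  by rewrite -m_eq sum1_card card_ord.
exists k, l, P, p, Q, q; split=> //.
  split=> // [i j|i i' j j' w Pi Pi' Qj Qj'].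
    by have := n_pts (i, j); rewrite nE.
  have pw : proj_point w by case: Pi.
  have [|s Es] := zsurj w.
    by split; split=> // g; [move/AP => Pg; case: Pi => _|move/BQ => Qg; case: Qj => _]; apply.
  have /card_le1_eqP/(_ (i, j) (i', j')) uniq : (c s <= 1)%N by rewrite -cE.
  suff [-> ->] : (i, j) = (i', j') by [].
  by symmetry; apply: uniq; apply/incP; rewrite Es.
have : ((\sum_i p i) * (\sum_j q j) = a * b)%N.
  by apply/eqP; rewrite eqn_leq le_pq -m_eq (leq_trans ge_m) // -sum_nc.
move: sumP sumQ a0 b0; clear; nia.
Qed.

Lemma grid_coplanar k l (P : 'I_k -> set S) p (Q : 'I_l -> set S) q i j : grid P p Q q ->
  exists h : 'rV[K]_4, [/\ h != 0, P i (lform h) & Q j (lform h)].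
Proof.
case=> cP cQ _ _ nPQ nQP pts _; have [z [zinj zz]] := pts i j.
exact: (coplanar_pair Kinf (cP i) (cQ j) (nPQ i j) (nQP i j) zinj
  (fun s => (zz s).1) (fun s => (zz s).2) erefl).
Qed.

(* A plane not containing [P i] meets it in at most [p i] points, whereas the components
   [Q j] lying in that plane meet [P i] in [p i * q j] points each. *)
Lemma grid_plane k l (P : 'I_k -> set S) p (Q : 'I_l -> set S) q (D : {pred 'I_l})
    (h : 'rV[K]_4) i : grid P p Q q ->
  (forall j, j \in D -> Q j (lform h)) -> (1 < \sum_(j in D) q j)%N -> P i (lform h).
Proof.
move=> [cP cQ _ _ _ nQP pts uniq] QD gt1; apply: contrapT => nP.
have hP := point_ideal (curve_point_proj (cP i)).
have hJ := ideal_add_form_homogeneous hP (form_lform h); set J := ideal_add_form _ _ in hJ.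
have [T TP] := hilb_section (cP i) (form_lform h) nP.
pose z j := projT1 (cid (pts i j)).
have zP j : injective (z j) /\ forall s, zeros (P i) (z j s) /\ zeros (Q j) (z j s).
  exact: projT2 (cid (pts i j)).
pose X := {j : {j | j \in D} & 'I_(p i * q (val j))}.
pose y (x : 'I_#|{: X}|) := z (val (tag (enum_val x))) (tagged (enum_val x)).
have yJ x : zeros J (y x).
  rewrite /y; case: (enum_val x) => -[j Dj] s /=; have [[pz Pz] [_ Qz]] := (zP j).2 s.
  by split=> //; apply: ideal_add_form_min => //; [apply: point_ideal|apply/Qz/QD].
have ysub x x' : x != x' -> ~ y x' `<=` y x.
  move=> ne sub; have [py Jy] := yJ x'; have [py' _] := yJ x.
  have Py : P i `<=` y x' by apply: subset_trans Jy; apply: ideal_add_form_sub.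
  have E : y x = y x'.
    apply: (curve_point_max (cP i)) sub => // E; apply: nP; rewrite -E; apply: Jy.
    exact: ideal_add_form_gen.
  case/eqP: ne; apply/enum_val_inj; move: E; rewrite /y.
  case: (enum_val x) => -[j Dj] s; case: (enum_val x') => -[j' Dj'] s' /= E.
  have [zi zj] := (zP j).2 s; have [zi' zj'] := (zP j').2 s'.
  have Ej : j = j' by rewrite E in zi zj; have [] := uniq i i j j' _ zi zi zj zj'.
  move: Dj' s' E zi' zj'; rewrite -Ej => Dj' s' /(zP j).1 -> _ _.
  by have -> : Dj = Dj' by apply: bool_irrelevance.
have [d dP] := points_hilb_sum hJ yJ ysub.
have cardX : #|{: X}| = (p i * \sum_(j in D) q j)%N.
  rewrite card_tagged sumnE big_map big_enum /= big_distrr /=.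
  under eq_bigr do rewrite card_ord.
  by rewrite [RHS]big_sub; apply: eq_big.
have le1 : (#|{: X}| <= hilb J (T + d))%N.
  apply: leq_trans (dP T); rewrite -[X in (X <= _)%N]card_ord -sum1_card; apply: leq_sum => x _.
  by apply: hilb_point_gt0; case: (yJ x).
move: le1; rewrite TP ?leq_addr // mul1n cardX; have := curve_point_pos (cP i).
by move: gt1; clear; nia.
Qed.

Lemma submx_lform (I : set S) (u v w : 'rV[K]_4) : homogeneous_ideal I ->
  I (lform u) -> I (lform v) -> (w <= col_mx u v)%MS -> I (lform w).
Proof.
move=> hI Iu Iv /submxP[r ->]; rewrite -[r]hsubmxK mul_row_col.
rewrite [lsubmx r]mx11_scalar [rsubmx r]mx11_scalar !mul_scalar_mx linearD !linearZ /=.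
by apply: hidealD => //; apply: hideal_scale.
Qed.

Lemma point_two_lines w (u v u' v' : 'rV[K]_4) : proj_point w ->
  w (lform u) -> w (lform v) -> w (lform u') -> w (lform v') ->
  ~~ row_free (col_mx (col_mx u v) (col_mx u' v')).
Proof.
move=> pw wu wv wu' wv'; apply/negP => rf; have [x []] := lform_notin pw.
have hw := point_ideal pw; have : (x <= col_mx (col_mx u v) (col_mx u' v'))%MS.
  by apply: submx_full; rewrite /row_full; apply: rf.
rewrite -addsmxE => /sub_addsmxP[[r r'] /= ->]; rewrite linearD.
by apply: hidealD => //;
  [apply: (submx_lform hw wu wv)|apply: (submx_lform hw wu' wv')]; apply: submxMl.
Qed.

(** Two two-dimensional spaces of linear forms whose sum is not everything intersect: meeting lines
    are coplanar. *)
Lemma common_form (u v u' v' : 'rV[K]_4) :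
  row_free (col_mx u v) -> row_free (col_mx u' v') ->
  ~~ row_free (col_mx (col_mx u v) (col_mx u' v')) ->
  exists h : 'rV[K]_4, [/\ h != 0, (h <= col_mx u v)%MS & (h <= col_mx u' v')%MS].
Proof.
move=> rf rf' nf; suff : (col_mx u v :&: col_mx u' v')%MS != 0.
  by case/rowV0Pn => h; rewrite sub_capmx => /andP[]; exists h.
rewrite -mxrank_eq0; have := mxrank_sum_cap (col_mx u v) (col_mx u' v').
rewrite (eqP rf) (eqP rf'); apply: contra_eqN => /eqP ->; rewrite addn0.
by apply: contraNneq nf => E; rewrite /row_free -addsmxE E.
Qed.

(** A component [P i] that is not a line lies in only one plane, which by coplanarity of pairs
    contains every [Q j]. Two meeting lines [P i] and [P i'] span a plane holding degree at least 2
    of the left curve, so again every [Q j], by [grid_plane]. A plane containing every [Q j]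
    contains every [P i] too. *)
Lemma grid_plane_or_skew k l (P : 'I_k -> set S) p (Q : 'I_l -> set S) q :
  grid P p Q q -> (1 < \sum_i p i)%N -> (1 < \sum_j q j)%N ->
  (exists h : 'rV[K]_4, [/\ h != 0, forall i, P i (lform h) & forall j, Q j (lform h)]) \/
  (forall i, has_line_forms (P i)) /\
  (forall i i', i != i' -> disjoint_subschemes (P i) (P i')).
Proof.
move=> G p2 q2; have hP i := point_ideal (curve_point_proj (grid_left G i)).
have hQ j := point_ideal (curve_point_proj (grid_right G j)).
have [|np] := pselect (exists h : 'rV[K]_4,
  [/\ h != 0, forall i, P i (lform h) & forall j, Q j (lform h)]); first by left.
have tail (h : 'rV[K]_4) : h != 0 -> ~ forall j, Q j (lform h).
  move=> nh Qh; apply: np; exists h; split=> // i.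
  by apply: (grid_plane (D := predT) i G) => // j _; apply: Qh.
have lines i : has_line_forms (P i).
  apply: contrapT => nline.
  have [j0] : exists j0 : 'I_l, true.
    by apply: contrapT => /forallNP none; move: q2; rewrite big1 // => j; case: (none j).
  have [h [nh Ph _]] := grid_coplanar i j0 G => _.
  apply: (tail h nh) => j; have [h' [nh' Ph' Qh']] := grid_coplanar i j G.
  have [|c ->] := @not_row_free_pair K h' h nh'.
    by apply/negP => rf; apply: nline; exists h', h.
  by rewrite linearZ; apply: hideal_scale.
right; split=> // i i' ne; apply/seteqP; split=> // w [[pw Pw] [_ Pw']]; apply: contrapT => _.
have [u [v [rf Pu Pv]]] := lines i; have [u' [v' [rf' Pu' Pv']]] := lines i'.
have [|h [nh hi hi']] := common_form rf rf'.
  by apply: (point_two_lines pw); [apply: Pw|apply: Pw|apply: Pw'|apply: Pw'].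
apply: (tail h nh) => j; apply: (grid_plane (D := pred2 i i') j (grid_sym G)).
  by move=> x /orP[] /eqP ->; [apply: submx_lform hi|apply: submx_lform hi'].
rewrite (bigD1 i) ?inE ?eqxx //= (bigD1 i') ?inE ?eqxx ?orbT 1?eq_sym ?ne //=.
have := curve_point_pos (grid_left G i); have := curve_point_pos (grid_left G i').
by clear; lia.
Qed.

End Grid.

(** * From the grid to plane curves or skew lines *)

Section Assembly.
Variable K : fieldType.
Hypothesis Kinf : injective (fun n : nat => n%:R : K).
Local Notation S := {mpoly K[4]}.
Variables (k l : nat) (P : 'I_k -> set S) (p : 'I_k -> nat).
Variables (Q : 'I_l -> set S) (q : 'I_l -> nat) (G : grid P p Q q).
Variables (A B : set S).
Hypotheses (AP : forall f, A f <-> forall i, P i f) (BQ : forall f, B f <-> forall j, Q j f).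
Let cP := grid_left G.
Let cQ := grid_right G.
Let hP i : homogeneous_ideal (P i) := point_ideal (curve_point_proj (cP i)).
Let hQ j : homogeneous_ideal (Q j) := point_ideal (curve_point_proj (cQ j)).

(** Here [A] is a single component [P i0], and those of [B] are grouped by the plane they share with
    it. Groups in different planes can meet only on [A], where [grid_unique] forbids it. *)
Lemma grid_single : (\sum_i p i = 1)%N -> disjoint_union_of_plane_curves_coplanar_with A B.
Proof.
move=> p1.
have [i0 all0] : exists i0 : 'I_k, forall i, i = i0.
  have [i0] : exists i0 : 'I_k, true.
    by apply: contrapT => /forallNP none; move: p1; rewrite big1 // => i; case: (none i).
  move=> _; exists i0 => i; apply/eqP/negPn/negP => ne; move: p1.
  rewrite (bigD1 i0) //= (bigD1 i) //=.
  by have := curve_point_pos (cP i); have := curve_point_pos (cP i0); clear; lia.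
have AP0 : A = P i0.
  apply/seteqP; split=> f; first by move/AP.
  by move=> Pf; apply/AP => i; rewrite (all0 i).
pose h j := projT1 (cid (grid_coplanar Kinf i0 j G)).
have hj j : [/\ h j != 0, P i0 (lform (h j)) & Q j (lform (h j))].
  exact: projT2 (cid (grid_coplanar Kinf i0 j G)).
(* [<<h j>>%MS] is a canonical generator of the row space of [h j], so proportional equations of one
   plane become equal. *)
pose T := undup [seq <<h j>>%MS | j <- enum 'I_l].
have memT j : <<h j>>%MS \in T by rewrite mem_undup; apply: map_f; rewrite mem_enum.
pose D (c : 'I_(size T)) : pred 'I_l := fun j => <<h j>>%MS == nth 0 T c.
have exD c : exists j, D c j.
  have : nth 0 T c \in T by apply: mem_nth.
  by rewrite mem_undup => /mapP[j _ E]; exists j; rewrite /D E.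
have Dh c j j' : D c j -> D c j' -> Q j' (lform (h j)).
  move=> /eqP Dj /eqP Dj'; have : (h j <= h j')%MS by rewrite -genmxE Dj -Dj' genmxE.
  by case/sub_rVP => s ->; rewrite linearZ; apply: hideal_scale => //; case: (hj j').
exists (size T), (fun c => [set f | forall j, D c j -> Q j f]); split; [|split; [|split]].
- move=> c; have [j Dj] := exD c; split; first exact: (reduced_curve_bigcap cQ Dj).
  exists (h j); split; first by case: (hj j).
  by move=> j' Dj'; apply: Dh Dj Dj'.
- move=> c c' ne; apply/seteqP; split=> // w [[pw Cw] [_ Cw']].
  have [j Dj Qw] := prime_bigcap pw hQ Cw; have [j' Dj' Qw'] := prime_bigcap pw hQ Cw'.
  have nD : <<h j>>%MS != <<h j'>>%MS.
    by rewrite (eqP Dj) (eqP Dj') nth_uniq // undup_uniq.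
  have [nh Ph Qh] := hj j; have [nh' Ph' Qh'] := hj j'.
  (* Two distinct planes through [P i0] intersect exactly in it, so it is a line containing [w]. *)
  have rf : row_free (col_mx (h j) (h j')).
    apply/negPn/negP => /(not_row_free_pair nh)[s Es]; case/eqP: nD.
    apply/genmxP; rewrite Es; apply/andP; split; last exact: scalemx_sub.
    have ns : s != 0 by apply: contra nh' => /eqP s0; rewrite Es s0 scale0r.
    by apply/sub_rVP; exists s^-1; rewrite scalerA mulVf // scale1r.
  have [EP _] := line_of_forms (cP i0) rf Ph Ph'.
  have Pw : P i0 `<=` w.
    by rewrite EP; apply: ideal2_min; [apply: point_ideal|apply: Qw|apply: Qw'].
  have zP : zeros (P i0) w by split.
  have [_ E] := grid_unique G zP zP (conj pw Qw) (conj pw Qw').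
  by case/eqP: nD; rewrite E.
- apply/seteqP; split=> f.
    by move/BQ => Qf c _ j _; apply: Qf.
  move=> Cf; apply/BQ => j; have lt : (index <<h j>>%MS T < size T)%N by rewrite index_mem.
  by apply: (Cf (Ordinal lt) Logic.I j); rewrite /D /= nth_index.
- move=> c; have [j Dj] := exD c; have [nh Ph Qh] := hj j; exists (h j); split; split=> //.
    by rewrite AP0.
  by move=> j' Dj'; apply: Dh Dj Dj'.
Qed.

Lemma union_of_skew_components :
  (forall i, has_line_forms (P i)) -> (forall i i', i != i' -> disjoint_subschemes (P i) (P i')) ->
  union_of_skew_lines A.
Proof.
move=> lines disj; exists k, P; split; [|split=> //].
  move=> i; have [u [v [rf Pu Pv]]] := lines i; exists u, v; split=> //.
  by case: (line_of_forms (cP i) rf Pu Pv).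
apply/seteqP; split=> f; first by move/AP => Pf i _; apply: Pf.
by move=> Pf; apply/AP => i; apply: Pf.
Qed.

End Assembly.

Lemma grid_plane_or_skew_lines (K : fieldType) (Kinf : injective (fun n : nat => n%:R : K))
    k l (P : 'I_k -> set {mpoly K[4]}) p (Q : 'I_l -> set {mpoly K[4]}) q (A B : set {mpoly K[4]}) :
  grid P p Q q -> reduced_curve A -> reduced_curve B ->
  (forall f, A f <-> forall i, P i f) -> (forall f, B f <-> forall j, Q j f) ->
  (1 < \sum_i p i)%N -> (1 < \sum_j q j)%N ->
  plane_curve (A `&` B) \/ union_of_skew_lines A /\ union_of_skew_lines B.
Proof.
move=> G cA cB AP BQ p2 q2.
have plane (h : 'rV[K]_4) : h != 0 -> (forall i, P i (lform h)) -> (forall j, Q j (lform h)) ->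
    plane_curve (A `&` B).
  move=> nh Ph Qh; split; first exact: reduced_curveI.
  by exists h; split=> //; split; [apply/AP|apply/BQ].
have [[h [nh Ph Qh]]|[linesP disjP]] := grid_plane_or_skew Kinf G p2 q2.
  by left; apply: plane Qh.
have [[h [nh Qh Ph]]|[linesQ disjQ]] := grid_plane_or_skew Kinf (grid_sym G) q2 p2.
  by left; apply: plane Qh.
right; split; first exact: (union_of_skew_components G AP linesP disjP).
exact: (union_of_skew_components (grid_sym G) BQ linesQ disjQ).
Qed.

(** * Skew lines and rulings *)

Section SkewLines.
Variable K : fieldType.
Local Notation S := {mpoly K[4]}.

Lemma submx_coll m1 m2 n (X : 'M[K]_(m1, n)) (Y : 'M[K]_(m2, n)) : (X <= col_mx X Y)%MS.
Proof. by rewrite -addsmxE addsmxSl. Qed.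

Lemma submx_colr m1 m2 n (X : 'M[K]_(m1, n)) (Y : 'M[K]_(m2, n)) : (Y <= col_mx X Y)%MS.
Proof. by rewrite -addsmxE addsmxSr. Qed.

Lemma line_submx (u v w : 'rV[K]_4) : ideal2 (lform u) (lform v) (lform w) ->
  (w <= col_mx u v)%MS.
Proof.
case/ideal2_lform => c [d ->]; apply: addmx_sub; apply: scalemx_sub.
  exact: submx_coll.
exact: submx_colr.
Qed.

Lemma dependent_lforms (P : set S) p (u v w : 'rV[K]_4) : curve_point P p ->
  P (lform u) -> P (lform v) -> P (lform w) ->
  exists a b c, (a, b, c) != (0, 0, 0) /\ a *: u + b *: v + c *: w = 0.
Proof.
move=> cP Pu Pv Pw; have [rf|nf] := boolP (row_free (col_mx u v)).
  have [EP _] := line_of_forms cP rf Pu Pv; rewrite EP in Pw.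
  have [c [d ->]] := ideal2_lform Pw; exists c, d, (-1).
  by rewrite !xpair_eqE oppr_eq0 oner_eq0 andbF scaleN1r subrr.
have [u0|nu] := eqVneq u 0.
  by exists 1, 0, 0; rewrite !xpair_eqE oner_eq0 u0 !scale0r scaler0 !addr0.
have [c ->] := not_row_free_pair nu nf; exists c, (-1), 0.
by rewrite !xpair_eqE oppr_eq0 oner_eq0 andbF scaleN1r subrr scale0r addr0.
Qed.

(** If the four forms were dependent, a kernel vector [zeta] would be a rational point on both
    lines. *)
Lemma disjoint_row_free (u v u' v' : 'rV[K]_4) :
  disjoint_subschemes (ideal2 (lform u) (lform v)) (ideal2 (lform u') (lform v')) ->
  row_free (col_mx (col_mx u v) (col_mx u' v')).
Proof.
move=> disj; apply/negPn/negP => nf; pose N : 'M[K]_4 := col_mx (col_mx u v) (col_mx u' v').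
have {}nf : ~~ row_free N by [].
have : kermx N^T != 0.
  by rewrite kermx_eq0; move: nf; rewrite /row_free mxrank_tr.
case/rowV0Pn => zeta /sub_kermxP zN nz.
have /rV0Pn[i zi] := nz.
have vanish (x : 'rV[K]_4) : (x <= N)%MS -> pt zeta (lform x).
  case/submxP => D Ex; apply: (proj2 (pt_form zeta (form_lform x))).
  have E : zeta *m x^T = 0 by rewrite Ex trmx_mul mulmxA zN mul0mx.
  by rewrite ev_lform -/(dot x zeta) dotC -dotE E mxE.
have le1 : (col_mx u v <= N)%MS by exact: (submx_coll (col_mx u v) (col_mx u' v')).
have le2 : (col_mx u' v' <= N)%MS by exact: (submx_colr (col_mx u v) (col_mx u' v')).
have pz := pt_point zi.
have : (zeros (ideal2 (lform u) (lform v)) `&` zeros (ideal2 (lform u') (lform v'))) (pt zeta).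
  split; split=> //; apply: ideal2_min; first [exact: pt_ideal|apply: vanish].
  - by apply: submx_trans le1; apply: submx_coll.
  - by apply: submx_trans le1; apply: submx_colr.
  - by apply: submx_trans le2; apply: submx_coll.
  - by apply: submx_trans le2; apply: submx_colr.
by rewrite disj.
Qed.

Lemma skew_lines_no_common (P Q : set S) p q (h : 'rV[K]_4) : curve_point P p -> curve_point Q q ->
  has_line_forms P -> has_line_forms Q -> disjoint_subschemes P Q ->
  P (lform h) -> Q (lform h) -> h = 0.
Proof.
move=> cP cQ [u [v [rf Pu Pv]]] [u' [v' [rf' Qu Qv]]].
have [-> _] := line_of_forms cP rf Pu Pv; have [-> _] := line_of_forms cQ rf' Qu Qv.
move=> /disjoint_row_free rfN /line_submx hu /line_submx hu'.
have : (h <= col_mx u v :&: col_mx u' v')%MS by rewrite sub_capmx hu.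
suff /eqP -> : (col_mx u v :&: col_mx u' v')%MS == 0 by rewrite submx0 => /eqP.
rewrite -mxrank_eq0; have := mxrank_sum_cap (col_mx u v) (col_mx u' v').
by rewrite (eqP rf) (eqP rf') addsmxE (eqP rfN); clear; lia.
Qed.

Definition independent4 (m0 m1 m2 m3 : 'rV[K]_4) := forall a b c d : K,
  a *: m0 + b *: m1 + c *: m2 + d *: m3 = 0 -> [/\ a = 0, b = 0, c = 0 & d = 0].

Lemma independent4_swap m0 m1 m2 m3 : independent4 m0 m1 m2 m3 -> independent4 m0 m2 m1 m3.
Proof.
move=> ind a b c d E; have [] // := ind a c b d.
by rewrite -E; apply/rowP => i; rewrite !mxE; ring.
Qed.

(** The forms of two skew lines span all linear forms, so each of the two equations of the third
    line is a difference of a form of [P0] and one of [P1]; these four pieces are the frame. Their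
    independence uses that no nonzero form vanishes on two of the lines. *)
Lemma skew_frame (P0 P1 P2 : set S) p0 p1 p2 :
  curve_point P0 p0 -> curve_point P1 p1 -> curve_point P2 p2 ->
  has_line_forms P0 -> has_line_forms P1 -> has_line_forms P2 ->
  disjoint_subschemes P0 P1 -> disjoint_subschemes P0 P2 -> disjoint_subschemes P1 P2 ->
  exists m0 m1 m2 m3, [/\ independent4 m0 m1 m2 m3, P0 (lform m0) /\ P0 (lform m1),
    P1 (lform m2) /\ P1 (lform m3) & P2 (lform (m0 - m2)) /\ P2 (lform (m1 - m3))].
Proof.
move=> c0 c1 c2 L0 L1 L2 d01 d02 d12.
have com01 := skew_lines_no_common c0 c1 L0 L1 d01.
have com02 := skew_lines_no_common c0 c2 L0 L2 d02.
have com12 := skew_lines_no_common c1 c2 L1 L2 d12.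
have h0 := point_ideal (curve_point_proj c0); have h1 := point_ideal (curve_point_proj c1).
have h2 := point_ideal (curve_point_proj c2).
have [u [v [rf0 Pu Pv]]] := L0; have [u' [v' [rf1 Pu' Pv']]] := L1.
have [w [w' [rf2 Pw Pw']]] := L2.
have rfN : row_free (col_mx (col_mx u v) (col_mx u' v')).
  apply: disjoint_row_free; have [<- _] := line_of_forms c0 rf0 Pu Pv.
  by have [<- _] := line_of_forms c1 rf1 Pu' Pv'.
have split_form x : exists a b, [/\ x = a - b, P0 (lform a) & P1 (lform b)].
  have : (x <= col_mx (col_mx u v) (col_mx u' v'))%MS by apply: submx_full; apply: rfN.
  rewrite -addsmxE => /sub_addsmxP[[r r'] /= ->].
  exists (r *m col_mx u v), (- (r' *m col_mx u' v')); rewrite opprK; split=> //.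
    by apply: (submx_lform h0 Pu Pv); apply: submxMl.
  by rewrite linearN; apply: hideal_opp => //; apply: (submx_lform h1 Pu' Pv'); apply: submxMl.
have [m0 [m2 [Ew Pm0 Pm2]]] := split_form w; have [m1 [m3 [Ew' Pm1 Pm3]]] := split_form w'.
have comb (P : set S) a b x y : homogeneous_ideal P -> P (lform x) -> P (lform y) ->
    P (lform (a *: x + b *: y)).
  by move=> hP Px Py; rewrite linearD !linearZ; apply: hidealD => //; apply: hideal_scale.
exists m0, m1, m2, m3; split=> //; last by rewrite -Ew -Ew'.
move=> a b c d E.
have E01 : a *: m0 + b *: m1 = (- c) *: m2 + (- d) *: m3.
  by apply/eqP; rewrite !scaleNr -opprD -addr_eq0 addrA E.
have z1 : a *: m0 + b *: m1 = 0.
  by apply: com01; [exact: comb|rewrite E01; exact: comb].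
have z2 : (- c) *: m2 + (- d) *: m3 = 0 by rewrite -E01.
have e1 : a *: w + b *: w' = (- a) *: m2 + (- b) *: m3.
  by rewrite Ew Ew' -[LHS]subr0 -z1; apply/rowP => i; rewrite !mxE; ring.
have e2 : (- c) *: w + (- d) *: w' = (- c) *: m0 + (- d) *: m1.
  by rewrite Ew Ew' -[LHS]addr0 -z2; apply/rowP => i; rewrite !mxE; ring.
have [-> ->] : a = 0 /\ b = 0.
  by apply: (row_free_pairP rf2); apply: com12; [rewrite e1; exact: comb|exact: comb].
have [] : - c = 0 /\ - d = 0.
  by apply: (row_free_pairP rf2); apply: com02; [rewrite e2; exact: comb|exact: comb].
by move=> /eqP; rewrite oppr_eq0 => /eqP -> /eqP; rewrite oppr_eq0 => /eqP ->.
Qed.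

(* Coordinates [(m0, m1, m2, m3) = (c_0 e_0, c_0 e_1, c_1 e_0, c_1 e_1)] on decomposable tensors. *)
Definition seg (m0 m1 m2 m3 : 'rV[K]_4) (c e : K * K) : 'rV[K]_4 :=
  (c.1 * e.1) *: m0 + (c.1 * e.2) *: m1 + (c.2 * e.1) *: m2 + (c.2 * e.2) *: m3.

Lemma seg_swap m0 m1 m2 m3 c e : seg m0 m1 m2 m3 c e = seg m0 m2 m1 m3 e c.
Proof. by apply/rowP => i; rewrite !mxE; ring. Qed.

Definition det2 (x y : K * K) := x.1 * y.2 - x.2 * y.1.

Lemma pair_zero (c : K * K) : c != (0, 0) -> forall s, s * c.1 = 0 -> s * c.2 = 0 -> s = 0.
Proof.
case: c => a b; rewrite xpair_eqE negb_and => /orP[] nz s /= E1 E2; apply/eqP.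
  by move/eqP: E1; rewrite mulf_eq0 (negPf nz) orbF.
by move/eqP: E2; rewrite mulf_eq0 (negPf nz) orbF.
Qed.

(** Three linear forms on a curve are dependent, here three tensors [c_i (x) e_i] with pairwise
    independent [e_i]. The relation forces [c1] and [c2] to be proportional, and then [c1 (x) e1]
    and [c1 (x) e2] span all [c1 (x) e]. *)
Lemma ruling_form (P : set S) p m0 m1 m2 m3 c0 c1 c2 e0 e1 e2 : curve_point P p ->
  independent4 m0 m1 m2 m3 -> c0 != (0, 0) -> c1 != (0, 0) -> c2 != (0, 0) ->
  det2 e0 e1 != 0 -> det2 e0 e2 != 0 -> det2 e1 e2 != 0 ->
  P (lform (seg m0 m1 m2 m3 c0 e0)) -> P (lform (seg m0 m1 m2 m3 c1 e1)) ->
  P (lform (seg m0 m1 m2 m3 c2 e2)) ->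
  exists2 c, c != (0, 0) & forall e, P (lform (seg m0 m1 m2 m3 c e)).
Proof.
move=> cP ind n0 n1 n2 d01 d02 d12 P0 P1 P2.
have hP := point_ideal (curve_point_proj cP).
have [s0 [s1 [s2 [ns E]]]] := dependent_lforms cP P0 P1 P2.
have [E11 E12 E21 E22] : [/\ s0 * (c0.1 * e0.1) + s1 * (c1.1 * e1.1) + s2 * (c2.1 * e2.1) = 0,
    s0 * (c0.1 * e0.2) + s1 * (c1.1 * e1.2) + s2 * (c2.1 * e2.2) = 0,
    s0 * (c0.2 * e0.1) + s1 * (c1.2 * e1.1) + s2 * (c2.2 * e2.1) = 0 &
    s0 * (c0.2 * e0.2) + s1 * (c1.2 * e1.2) + s2 * (c2.2 * e2.2) = 0].
  by apply: ind; rewrite -E; apply/rowP => i; rewrite !mxE; ring.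
(* Contracting the relation with the vector orthogonal to [e0] removes its first term; [F1] and [F2]
   are the coordinates of the remaining relation between [c1] and [c2]. *)
have F1 : s1 * det2 e0 e1 * c1.1 + s2 * det2 e0 e2 * c2.1 = 0.
  have -> : s1 * det2 e0 e1 * c1.1 + s2 * det2 e0 e2 * c2.1 =
    e0.1 * (s0 * (c0.1 * e0.2) + s1 * (c1.1 * e1.2) + s2 * (c2.1 * e2.2)) -
    e0.2 * (s0 * (c0.1 * e0.1) + s1 * (c1.1 * e1.1) + s2 * (c2.1 * e2.1)) by rewrite /det2; ring.
  by rewrite E11 E12 !mulr0 subrr.
have F2 : s1 * det2 e0 e1 * c1.2 + s2 * det2 e0 e2 * c2.2 = 0.
  have -> : s1 * det2 e0 e1 * c1.2 + s2 * det2 e0 e2 * c2.2 =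
    e0.1 * (s0 * (c0.2 * e0.2) + s1 * (c1.2 * e1.2) + s2 * (c2.2 * e2.2)) -
    e0.2 * (s0 * (c0.2 * e0.1) + s1 * (c1.2 * e1.1) + s2 * (c2.2 * e2.1)) by rewrite /det2; ring.
  by rewrite E21 E22 !mulr0 subrr.
have ns2 : s2 != 0.
  apply/eqP => z2; have z1 : s1 * det2 e0 e1 = 0.
    by apply: (pair_zero n1); [rewrite -[RHS]F1|rewrite -[RHS]F2]; rewrite z2 !mul0r addr0.
  have {}z1 : s1 = 0 by move/eqP: z1; rewrite mulf_eq0 (negPf d01) orbF => /eqP.
  move: E11 E12 E21 E22; rewrite z1 z2 !mul0r !addr0 !mulrA => E11 E12 E21 E22.
  have ne0 : e0 != (0, 0).
    by apply: contra d01 => /eqP ->; rewrite /det2 !mul0r subrr.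
  have z0 : s0 = 0 by apply: (pair_zero n0); apply: (pair_zero ne0).
  by move: ns; rewrite z0 z1 z2 eqxx.
pose lam := - (s1 * det2 e0 e1) / (s2 * det2 e0 e2).
have nd : s2 * det2 e0 e2 != 0 by rewrite mulf_neq0.
have Ec1 : c2.1 = lam * c1.1.
  apply: (mulfI nd); rewrite /lam mulrA [_ * (_ / _)]mulrC divfK //.
  by apply/eqP; rewrite mulNr -addr_eq0 addrC F1.
have Ec2 : c2.2 = lam * c1.2.
  apply: (mulfI nd); rewrite /lam mulrA [_ * (_ / _)]mulrC divfK //.
  by apply/eqP; rewrite mulNr -addr_eq0 addrC F2.
have nl : lam != 0.
  by apply: contra n2 => /eqP z; rewrite [c2]surjective_pairing Ec1 Ec2 z !mul0r.
clearbody lam; exists c1 => // e.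
have P2' : P (lform (seg m0 m1 m2 m3 c1 e2)).
  have -> : seg m0 m1 m2 m3 c1 e2 = lam^-1 *: seg m0 m1 m2 m3 c2 e2.
    by apply/rowP => i; rewrite !mxE Ec1 Ec2; field.
  by rewrite linearZ; apply: hideal_scale.
(* Cramer's rule for [e] in the basis [e1], [e2]. *)
have -> : seg m0 m1 m2 m3 c1 e = (det2 e e2 / det2 e1 e2) *: seg m0 m1 m2 m3 c1 e1 +
    (det2 e1 e / det2 e1 e2) *: seg m0 m1 m2 m3 c1 e2.
  by apply/rowP => i; rewrite !mxE /det2; move: d12; rewrite /det2 => d12; field.
by rewrite linearD !linearZ; apply: hidealD => //; apply: hideal_scale.
Qed.

End SkewLines.

(** * The quadric of a frame *)

Section Quadric.
Variable K : fieldType.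
Local Notation S := {mpoly K[4]}.
Variables m0 m1 m2 m3 : 'rV[K]_4.
Hypothesis ind : independent4 m0 m1 m2 m3.

Definition frame : 'M[K]_4 := \matrix_i nth 0 [:: m0; m1; m2; m3] i.
Definition quadric : S := lform m0 * lform m3 - lform m1 * lform m2.

Lemma row_frame : [/\ row 0 frame = m0, row 1 frame = m1, row 2 frame = m2 & row 3 frame = m3].
Proof. by split; rewrite rowK. Qed.

Lemma frame_unit : frame \in unitmx.
Proof.
rewrite -row_free_unit -kermx_eq0; apply/rowV0P => r /sub_kermxP.
rewrite mulmx_sum_row !big_ord_recl big_ord0 addr0 !rowK /= !addrA => /ind[e0 e1 e2 e3].
apply/rowP => i; rewrite [RHS]mxE.
case: (unliftP ord0 i) => [j ->|->//]; case: (unliftP ord0 j) => [j' ->|->//].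
by case: (unliftP ord0 j') => [j'' ->|->//]; rewrite (ord1 j'').
Qed.

Lemma segre_frame_quadric : segre_frame quadric frame.
Proof. by split; [exact: frame_unit|have [-> -> -> ->] := row_frame]. Qed.

Lemma seg_row_free c : c != (0, 0) ->
  row_free (col_mx (seg m0 m1 m2 m3 c (1, 0)) (seg m0 m1 m2 m3 c (0, 1))).
Proof.
move=> nc; apply: row_free_pair => x y E.
have [E0 E1 E2 E3] : [/\ x * c.1 = 0, y * c.1 = 0, x * c.2 = 0 & y * c.2 = 0].
  by apply: ind; rewrite -[RHS]E; apply/rowP => i; rewrite !mxE /=; ring.
by split; apply: (pair_zero nc).
Qed.

Lemma ruling_line (P : set S) p c : curve_point P p -> c != (0, 0) ->
  (forall e, P (lform (seg m0 m1 m2 m3 c e))) ->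
  P = ideal2 (lform (seg m0 m1 m2 m3 c (1, 0))) (lform (seg m0 m1 m2 m3 c (0, 1))) /\ p = 1%N.
Proof. by move=> cP nc Pe; apply: line_of_forms; [exact: cP|apply: seg_row_free|..]. Qed.

Lemma quadric_mem (P : set S) c : homogeneous_ideal P -> c != (0, 0) ->
  (forall e, P (lform (seg m0 m1 m2 m3 c e))) -> P quadric.
Proof.
move=> hP nc Pe; have := Pe (1, 0); have := Pe (0, 1).
rewrite /seg /= !mulr0 !mulr1 !scale0r !addr0 !add0r !linearD !linearZ /=.
set g := _ + _ => Pg; set f := _ + _ => Pf.
case: c nc @f @g {Pe} Pf Pg => a b; rewrite xpair_eqE negb_and /= => /orP[] nz Pf Pg.
  have -> : quadric = a^-1 *: ((a *: lform m0 + b *: lform m2) * lform m3 -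
      (a *: lform m1 + b *: lform m3) * lform m2).
    rewrite !mulrDl -!scalerAl [lform m3 * _]mulrC opprD addrACA subrr addr0.
    by rewrite -scalerBr scalerA mulVf // scale1r.
  by apply: hideal_scale => //; apply: hideal_sub => //; apply: hidealMr.
have -> : quadric = b^-1 *: ((a *: lform m1 + b *: lform m3) * lform m0 -
    (a *: lform m0 + b *: lform m2) * lform m1).
  rewrite !mulrDl -!scalerAl [lform m1 * lform m0]mulrC opprD addrACA subrr add0r.
  by rewrite -scalerBr scalerA mulVf // scale1r /quadric; congr (_ - _); rewrite mulrC.
by apply: hideal_scale => //; apply: hideal_sub => //; apply: hidealMr.
Qed.

Lemma first_ruling_line (P : set S) p c : curve_point P p -> c != (0, 0) ->
  (forall e, P (lform (seg m0 m1 m2 m3 c e))) -> first_ruling frame P.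
Proof.
move=> cP nc Pe; have [-> _] := ruling_line cP nc Pe; have [r0 r1 r2 r3] := row_frame.
(* The ruling is defined by [x 0 1 *: row 0 M - x 0 0 *: row 2 M], so matching
   [c.1 *: m0 + c.2 *: m2] needs [x = (- c.2, c.1)]. *)
exists (\row_i (if i == 0 then - c.2 else c.1)); split.
  apply: contra nc => /eqP /rowP E; have := E 0; have := E 1; rewrite !mxE /=.
  by case: c {Pe E} => a b /= -> /eqP; rewrite oppr_eq0 => /eqP ->.
rewrite r0 r1 r2 r3 !mxE /= !scaleNr !opprK.
by congr (ideal2 (lform _) (lform _)); apply/rowP => i; rewrite !mxE /=; ring.
Qed.

Lemma second_ruling_line (P : set S) c :
  P = ideal2 (lform (seg m0 m2 m1 m3 c (1, 0))) (lform (seg m0 m2 m1 m3 c (0, 1))) ->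
  c != (0, 0) -> second_ruling frame P.
Proof.
move=> -> nc; have [r0 r1 r2 r3] := row_frame.
exists (\row_i (if i == 0 then - c.2 else c.1)); split.
  apply: contra nc => /eqP /rowP E; have := E 0; have := E 1; rewrite !mxE /=.
  by case: c {E} => a b /= -> /eqP; rewrite oppr_eq0 => /eqP ->.
rewrite r0 r1 r2 r3 !mxE /= !scaleNr !opprK.
by congr (ideal2 (lform _) (lform _)); apply/rowP => i; rewrite !mxE /=; ring.
Qed.

Lemma mderiv_lform (v : 'rV[K]_4) i : (lform v)^`M(i) = (v 0 i)%:MP.
Proof.
rewrite /lform linear_sum (bigD1 i) //= big1 ?addr0 => [|j ne].
  rewrite linearZ /= mderivX mnm1E eqxx scale1r.
  have -> : (U_(i) - U_(i) = 0 :> 'X_{1..4})%MM by apply/mnmP => j; rewrite mnmBE subnn mnm0E.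
  by rewrite mpolyX0 -mul_mpolyC mulr1.
by rewrite linearZ /= mderivX mnm1E (negPf ne) scale0r scaler0.
Qed.

(** The partial derivatives are the frame coordinates, up to sign and order, multiplied by an
    invertible matrix. A point containing all of them contains every linear form, which no point
    does. *)
Lemma smooth_quadric_frame : smooth_quadric quadric.
Proof.
split.
  by apply: rpredB; apply: (dhomogM (form_lform _) (form_lform _)).
move=> P pP _; apply: contrapT => /forallNP Pd; have hP := point_ideal pP.
have {}Pd i : P quadric^`M(i) by apply: contrapT; apply: Pd.
(* The gradient of [m0 m3 - m1 m2] with respect to the frame coordinates. *)
pose L (i : 'I_4) : S := nth 0 [:: lform m3; - lform m2; - lform m1; lform m0] i.
have derivE i : quadric^`M(i) = \sum_s frame s i *: L s.
  rewrite !big_ord_recl big_ord0 addr0 !mxE /L /= linearB /= !mderivM !mderiv_lform.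
  by rewrite -!mul_mpolyC; ring.
have PL r : P (L r).
  have -> : L r = \sum_i invmx frame i r *: quadric^`M(i).
    under eq_bigr do rewrite derivE scaler_sumr.
    rewrite exchange_big /=.
    have E s : \sum_i invmx frame i r *: (frame s i *: L s) = (s == r)%:R *: L s.
      have <- : (frame *m invmx frame) s r = (s == r)%:R by rewrite mulmxV ?frame_unit // mxE.
      by rewrite mxE scaler_suml; apply: eq_bigr => i _; rewrite scalerA mulrC.
    under eq_bigr do rewrite E.
    by rewrite (bigD1 r) //= eqxx scale1r big1 ?addr0 // => s ne; rewrite (negPf ne) scale0r.
  by apply: hideal_sum => // i _; apply: hideal_scale.
have P0 : P (lform m0) := PL 3.
have P1 : P (lform m1) by rewrite -[lform m1]opprK; apply: hideal_opp => //; exact: (PL 2).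
have P2 : P (lform m2) by rewrite -[lform m2]opprK; apply: hideal_opp => //; exact: (PL 1).
have P3 : P (lform m3) := PL 0.
have [v []] := lform_notin pP; rewrite -[v](mulmxKV frame_unit).
rewrite mulmx_sum_row !big_ord_recl big_ord0 addr0 !rowK /= !linearD !linearZ /=.
by do 3!(apply: hidealD => //; first exact: hideal_scale); apply: hideal_scale.
Qed.

End Quadric.

Lemma pchar0_natr_inj (K : fieldType) : [pchar K] =i pred0 -> injective (fun n : nat => n%:R : K).
Proof.
move=> /pcharf0P char0 m n /eqP; wlog le_mn : m n / (m <= n)%N.
  by move=> H E; case: (leqP m n) => [|/ltnW] le; [exact: H|symmetry; apply: H; rewrite 1?eq_sym].
rewrite eq_sym -subr_eq0 -natrB // char0 subn_eq0 => le_nm.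
by apply/eqP; rewrite eqn_leq le_mn.
Qed.

(** * Both rulings from a grid of lines *)

Section GridQuadric.
Variable K : fieldType.
Hypothesis Kinf : injective (fun n : nat => n%:R : K).
Local Notation S := {mpoly K[4]}.
Variables (k l : nat) (P : 'I_k -> set S) (p : 'I_k -> nat).
Variables (Q : 'I_l -> set S) (q : 'I_l -> nat) (G : grid P p Q q).
Let cP := grid_left G.
Let cQ := grid_right G.
Let hP i : homogeneous_ideal (P i) := point_ideal (curve_point_proj (cP i)).
Let hQ j : homogeneous_ideal (Q j) := point_ideal (curve_point_proj (cQ j)).

Lemma grid_meet_line i j (x y : 'rV[K]_4) :
  row_free (col_mx x y) -> P i (lform x) -> P i (lform y) ->
  exists2 c : K * K, c != (0, 0) & Q j (lform (c.1 *: x + c.2 *: y)).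
Proof.
move=> rf Px Py; have [EP _] := line_of_forms (cP i) rf Px Py.
have [h [nh]] := grid_coplanar Kinf i j G.
rewrite EP => /ideal2_lform[a [b Eh]] Qh; exists (a, b); last by rewrite -Eh.
by apply: contra nh => /eqP[a0 b0]; rewrite Eh a0 b0 !scale0r addr0.
Qed.

(** Three skew lines [P i] fix the frame and put every [Q j] in one ruling, which shows in passing
    that each [Q j] is a line and hence that there are at least three. Three of the [Q j] then put
    every [P i] in the other ruling. *)
Lemma skew_grid_quadric : (forall i, has_line_forms (P i)) ->
  (forall i i', i != i' -> disjoint_subschemes (P i) (P i')) ->
  (2 < k)%N -> (2 < \sum_j q j)%N ->
  exists (f : S) (M : 'M[K]_4), [/\ smooth_quadric f, segre_frame f M,
    forall i, P i f /\ first_ruling M (P i) &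
    forall j, [/\ Q j f, second_ruling M (Q j) & q j = 1%N]].
Proof.
move=> lines disj k2 q2.
pose i0 : 'I_k := Ordinal (ltnW (ltnW k2)); pose i1 : 'I_k := Ordinal (ltnW k2).
pose i2 : 'I_k := Ordinal k2.
have [m0 [m1 [m2 [m3 [ind [P00 P01] [P12 P13] [P202 P213]]]]]] :=
  skew_frame (cP i0) (cP i1) (cP i2) (lines i0) (lines i1) (lines i2)
    (disj i0 i1 isT) (disj i0 i2 isT) (disj i1 i2 isT).
have ind' := independent4_swap ind.
(* In the swapped frame the three chosen lines have parameters [(1, 0)], [(0, 1)] and [(1, -1)],
   read off from their equations; the plane common to [Q j] and each of them is a decomposable form
   on [Q j]. *)
have exc j : exists c, c != (0, 0) /\ forall e, Q j (lform (seg m0 m2 m1 m3 c e)).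
  have meet (x y : 'rV[K]_4) i u : x = seg m0 m2 m1 m3 (1, 0) u -> y = seg m0 m2 m1 m3 (0, 1) u ->
      P i (lform x) -> P i (lform y) -> u != (0, 0) ->
      exists2 c, c != (0, 0) & Q j (lform (seg m0 m2 m1 m3 c u)).
    move=> Ex Ey Px Py nu; have rf : row_free (col_mx x y).
      by rewrite Ex Ey !(seg_swap m0 m2 m1 m3); apply: seg_row_free.
    have [c nc Qc] := grid_meet_line j rf Px Py; exists c => //.
    suff <- : c.1 *: x + c.2 *: y = seg m0 m2 m1 m3 c u by [].
    by rewrite Ex Ey; apply/rowP => i'; rewrite !mxE /=; ring.
  have [|||c0 n0 Q0] := meet m0 m1 i0 (1, 0) _ _ P00 P01.
  - by apply/rowP => i'; rewrite !mxE /=; ring.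
  - by apply/rowP => i'; rewrite !mxE /=; ring.
  - by rewrite xpair_eqE oner_eq0.
  have [|||c1 n1 Q1] := meet m2 m3 i1 (0, 1) _ _ P12 P13.
  - by apply/rowP => i'; rewrite !mxE /=; ring.
  - by apply/rowP => i'; rewrite !mxE /=; ring.
  - by rewrite xpair_eqE oner_eq0 andbF.
  have [|||c2 n2 Q2] := meet (m0 - m2) (m1 - m3) i2 (1, -1) _ _ P202 P213.
  - by apply/rowP => i'; rewrite !mxE /=; ring.
  - by apply/rowP => i'; rewrite !mxE /=; ring.
  - by rewrite xpair_eqE oner_eq0.
  have [|||c nc Qc] := ruling_form (cQ j) ind' n0 n1 n2 _ _ _ Q0 Q1 Q2.
  - by rewrite /det2 /= mulr1 mulr0 subr0 oner_eq0.
  - by rewrite /det2 /= mul1r mul0r subr0 oppr_eq0 oner_eq0.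
  - by rewrite /det2 /= mul0r mul1r sub0r oppr_eq0 oner_eq0.
  by exists c.
pose c j := projT1 (cid (exc j)).
have cE j : c j != (0, 0) /\ forall e, Q j (lform (seg m0 m2 m1 m3 (c j) e)).
  exact: projT2 (cid (exc j)).
have lineQ j := ruling_line ind' (cQ j) (cE j).1 (cE j).2.
have l2 : (2 < l)%N.
  by move: q2; under eq_bigr do rewrite (lineQ _).2; rewrite sum1_card card_ord.
(* Proportional parameters would give the same line, against the injectivity of [Q]. *)
have det_ne j j' : j != j' -> det2 (c j) (c j') != 0.
  apply: contra_neq => det0; apply: (grid_injr G).
  apply: (curve_point_sub (cQ j') (cQ j)); rewrite (lineQ j').1.
  have prop e : exists s, seg m0 m2 m1 m3 (c j') e = s *: seg m0 m2 m1 m3 (c j) e.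
    have [nc _] := cE j; move: det0; rewrite /det2 => /eqP; rewrite subr_eq0 => /eqP.
    case: (c j) nc => a b; case: (c j') => a' b' /=; rewrite xpair_eqE negb_and => nc E.
    case/orP: nc => nz; [exists (a' / a)|exists (b' / b)]; apply/rowP => i; rewrite !mxE /=.
      have -> : b' = a' / a * b by apply: (mulfI nz); rewrite E; field.
      by field.
    have -> : a' = b' / b * a by apply: (mulfI nz); rewrite -E; field.
    by field.
  have sub e : Q j (lform (seg m0 m2 m1 m3 (c j') e)).
    by have [s ->] := prop e; rewrite linearZ; apply: hideal_scale => //; apply: (cE j).2.
  exact: ideal2_min.
pose j0 : 'I_l := Ordinal (ltnW (ltnW l2)); pose j1 : 'I_l := Ordinal (ltnW l2).
pose j2 : 'I_l := Ordinal l2.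
have exd i : exists2 d, d != (0, 0) & forall e, P i (lform (seg m0 m1 m2 m3 d e)).
  have meet j : exists2 d, d != (0, 0) & P i (lform (seg m0 m1 m2 m3 d (c j))).
    have [h [nh Ph]] := grid_coplanar Kinf i j G; rewrite (lineQ j).1.
    move=> /ideal2_lform[a [b Eh]]; exists (a, b).
      by apply: contra nh => /eqP[a0 b0]; rewrite Eh a0 b0 !scale0r addr0.
    suff <- : h = seg m0 m1 m2 m3 (a, b) (c j) by [].
    by rewrite Eh; apply/rowP => i'; rewrite !mxE /=; ring.
  have [d0 n0 Q0] := meet j0; have [d1 n1 Q1] := meet j1; have [d2 n2 Q2] := meet j2.
  exact: (ruling_form (cP i) ind n0 n1 n2 (det_ne j0 j1 isT) (det_ne j0 j2 isT) (det_ne j1 j2 isT)).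
exists (quadric m0 m1 m2 m3), (frame m0 m1 m2 m3); split.
- exact: smooth_quadric_frame.
- exact: segre_frame_quadric.
- move=> i; have [d nd Pd] := exd i; split; first exact: (quadric_mem (hP i) nd).
  exact: (first_ruling_line ind (cP i) nd Pd).
move=> j; have [nc Qc] := cE j; have [EQ q1] := lineQ j; split=> //.
  suff -> : quadric m0 m1 m2 m3 = quadric m0 m2 m1 m3 by exact: (quadric_mem (hQ j) nc).
  by rewrite /quadric [lform m1 * _]mulrC.
exact: (second_ruling_line EQ nc).
Qed.

End GridQuadric.

(** The given lines need not come indexed as the components are. A prime above their intersection
    contains one of them, and [line_of_forms] turns this inclusion into an equality. *)
Lemma skew_lines_components (K : fieldType) k (P : 'I_k -> set {mpoly K[4]}) p A :
  injective P -> (forall i, curve_point (P i) (p i)) -> (forall f, A f <-> forall i, P i f) ->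
  union_of_skew_lines A ->
  [/\ forall i, has_line_forms (P i), forall i, p i = 1%N &
      forall i i', i != i' -> disjoint_subschemes (P i) (P i')].
Proof.
move=> injP cP AP [n [L [lineL [disj EA]]]].
have inP i : exists j, [/\ has_line_forms (P i), p i = 1%N & P i = L j].
  have hL j : homogeneous_ideal (L j).
    by have [u [v [_ ->]]] := lineL j; apply: ideal2_homogeneous.
  have sub : [set f | forall j, predT j -> L j f] `<=` P i.
    move=> f Lf; suff : A f by move/AP.
    by rewrite EA => j _; apply: Lf.
  have [j _ LP] := prime_bigcap (curve_point_proj (cP i)) hL sub; exists j.
  have [u [v [rf EL]]] := lineL j; rewrite EL in LP *.
  have Pu := LP _ (ideal2_l _ _); have Pv := LP _ (ideal2_r _ _).
  by have [EP p1] := line_of_forms (cP i) rf Pu Pv; split=> //; exists u, v.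
split=> [i|i|i i' ne]; [by case: (inP i) => j []|by case: (inP i) => j []|].
have [j [_ _ Ei]] := inP i; have [j' [_ _ Ei']] := inP i'; rewrite Ei Ei'; apply: disj.
by apply: contra ne => /eqP E; apply/eqP/injP; rewrite Ei Ei' E.
Qed.

Theorem proposition3p1 (K : fieldType) (charK : [pchar K] =i pred0)
    (A B : set {mpoly K[4]}) (a b m : nat)
    (curveA : reduced_curve A) (degA : curve_degree A a)
    (curveB : reduced_curve B) (degB : curve_degree B b)
    (no_common_component : forall P, component A P -> ~ component B P)
    (leq_ab : (a <= b)%N)
    (card_AB : (zeros A `&` zeros B #= `I_m)%card)
    (m_eq : m = (a * b)%N) :
  (a = 1%N -> disjoint_union_of_plane_curves_coplanar_with A B) /\
  ((2 <= a)%N ->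
     (plane_curve (A `&` B) \/
      (union_of_skew_lines A /\ union_of_skew_lines B)) /\
     (union_of_skew_lines A -> union_of_skew_lines B -> (3 <= a)%N ->
        exists (q : {mpoly K[4]}) (M : 'M[K]_4),
          smooth_quadric q /\ A q /\ B q /\
          segre_frame q M /\ type_a0 M a A /\ type_0b M b B)).
Proof.
have Kinf : injective (fun n : nat => n%:R : K).
  exact: pchar0_natr_inj.
have [k [l [P [p [Q [q [G [sp sq] AP BQ]]]]]]] :=
  grid_of_curves Kinf curveA degA curveB degB no_common_component card_AB m_eq.
split=> [a1|a2]; first by apply: (grid_single Kinf G AP BQ); rewrite sp.
split.
  apply: (grid_plane_or_skew_lines Kinf G) => //; first by rewrite sp.
  by rewrite sq; apply: leq_trans leq_ab.
move=> skewA _ a3.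
have [lines p1 disj] := skew_lines_components (grid_injl G) (grid_left G) AP skewA.
have Ek : k = a.
  by rewrite -sp; under eq_bigr do rewrite p1; rewrite sum1_card card_ord.
have [||f [M [sm fr Pf Qf]]] := skew_grid_quadric Kinf G lines disj.
- by rewrite Ek.
- by rewrite sq; apply: leq_trans leq_ab.
have El : l = b.
  by rewrite -sq; under eq_bigr => j _ do [have [_ _ ->] := Qf j]; rewrite sum1_card card_ord.
exists f, M; split=> //; split; first by apply/AP => i; case: (Pf i).
split; first by apply/BQ => j; case: (Qf j).
split=> //; split.
  rewrite -Ek; exists P; split; first exact: (grid_injl G).
  split; first by move=> i; case: (Pf i).
  by apply/seteqP; split=> g; [move/AP => Pg i _; apply: Pg|move=> Pg; apply/AP => i; apply: Pg].
rewrite -El; exists Q; split; first exact: (grid_injr G).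
split; first by move=> j; case: (Qf j).
by apply/seteqP; split=> g; [move/BQ => Qg j _; apply: Qg|move=> Qg; apply/BQ => j; apply: Qg].
Qed.
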